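(* There exist absolute constants $C_1,C_2,C_3>0$ such that the following holds. Let $1\le r\le n$ be integers, let $\boldsymbol{M}\in\mathbb{R}^{n\times n}$ be a (fixed) positive semidefinite matrix with spectral decomposition $\boldsymbol{M}=\sum_{i=1}^n\sigma_i\boldsymbol{u}_i\boldsymbol{u}_i^\top$, where $\sigma_1\ge\dots\ge\sigma_n\ge 0$ and $\boldsymbol{u}_1,\dots,\boldsymbol{u}_n$ are orthonormal, and set $\boldsymbol{M}_r=\sum_{i=1}^r\sigma_i\boldsymbol{u}_i\boldsymbol{u}_i^\top$ and $\boldsymbol{N}=\boldsymbol{M}-\boldsymbol{M}_r=\sum_{i=r+1}^n\sigma_i\boldsymbol{u}_i\boldsymbol{u}_i^\top$. Let $p\in(0,1]$ satisfy $p\ge C_1\frac{\log n}{n}$ and let $\Omega$ be sampled according to the off-diagonal symmetric independent $\mathrm{Ber}(p)$ model. Then there is an event $E$ with $\mathbb{P}[E]\ge 1-2n^{-3}$ on which the following is true: whenever the tuning parameters $\alpha,\lambda$ satisfy $$100\sqrt{\|\boldsymbol{M}_r\|_{\ell_\infty}}\le\alpha\le 200\sqrt{\|\boldsymbol{M}_r\|_{\ell_\infty}}\quad\text{and}\quad 100\|\boldsymbol{\Omega}-p\boldsymbol{J}\|\le\lambda\le 200\|\boldsymbol{\Omega}-p\boldsymbol{J}\|,$$ every local minimum $\widehat{\boldsymbol{X}}\in\mathbb{R}^{n\times r}$ of $$f(\boldsymbol{X})=\frac12\|\mathcal{P}_\Omega(\boldsymbol{X}\boldsymbol{X}^\top-\boldsymbol{M})\|_F^2+\lambda\sum_{i=1}^n\left[(\|\boldsymbol{x}_i\|_2-\alpha)_+\right]^4,\qquad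 \boldsymbol{X}=[\boldsymbol{x}_1,\dots,\boldsymbol{x}_n]^\top\in\mathbb{R}^{n\times r},$$ satisfies $$\left\|\widehat{\boldsymbol{X}}\widehat{\boldsymbol{X}}^\top-\boldsymbol{M}_r\right\|_F^2\le C_2\sum_{i=1}^r\left\{\left[C_3\left(\sqrt{\frac np}+\frac{\log n}{p}\right)\|\boldsymbol{M}_r\|_{\ell_\infty}+C_3\sigma_{2r+1-i}-\sigma_i\right]_+\right\}^2+C_2\frac{[p(1-p)n+\log n]\,r\,\|\boldsymbol{N}\|_{\ell_\infty}^2}{p^2}$$ and $$\left\|\widehat{\boldsymbol{X}}\widehat{\boldsymbol{X}}^\top-\boldsymbol{M}\right\|_F^2\le C_2\sum_{i=1}^r\left\{\left[C_3\left(\sqrt{\frac np}+\frac{\log n}{p}\right)\|\boldsymbol{M}_r\|_{\ell_\infty}+C_3\sigma_{2r+1-i}-\sigma_i\right]_+\right\}^2+C_2\frac{[p(1-p)n+\log n]\,r\,\|\boldsymbol{N}\|_{\ell_\infty}^2}{p^2}+\|\boldsymbol{N}\|_F^2.$$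
   Context: Off-diagonal symmetric independent $\mathrm{Ber}(p)$ model: $\Omega\subset[n]\times[n]$ is a random index set such that (1) $(i,i)\notin\Omega$ for all $i$; (2) for all $i<j$, $(i,j)\in\Omega$ independently with probability $p$; (3) for all $i>j$, $(i,j)\in\Omega$ if and only if $(j,i)\in\Omega$. Notation: $\boldsymbol{\Omega}\in\{0,1\}^{n\times n}$ is the matrix with $\Omega_{i,j}=1$ iff $(i,j)\in\Omega$; $\boldsymbol{J}$ is the $n\times n$ all-ones matrix; $\mathcal{P}_\Omega(\boldsymbol{A})$ is the matrix with entry $A_{i,j}$ if $(i,j)\in\Omega$ and $0$ otherwise. $\|\cdot\|$ is the spectral norm, $\|\cdot\|_F$ the Frobenius norm, $\|\boldsymbol{A}\|_{\ell_\infty}=\max_{i,j}|A_{i,j}|$. $[x]_+=(x)_+=\max\{x,0\}$. The vector $\boldsymbol{x}_i\in\mathbb{R}^r$ is the $i$-th row of $\boldsymbol{X}$. Absolute constants do not depend on $n,r,p,\boldsymbol{M}$ or anything else. If eigenvalues are repeated, any ordering of the eigenvectors in the spectral decomposition may be fixed, and $\boldsymbol{M}_r$ is the corresponding fixed matrix. Convention: $\sigma_j:=0$ for $j>n$. *)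

(* Defs.v *)
From HB Require Import structures.
From mathcomp Require Import all_boot all_order all_algebra.
From mathcomp Require Import all_classical all_reals all_analysis.
Import Order.TTheory GRing.Theory Num.Theory.
Import numFieldNormedType.Exports.

Set Implicit Arguments.
Unset Strict Implicit.
Unset Printing Implicit Defensive.

Local Open Scope classical_set_scope.
Local Open Scope ring_scope.

Section Matrices.
Context {R : realType}.

Definition frobenius_norm (m n : nat) (A : 'M[R]_(m, n)) : R :=
  Num.sqrt (\sum_(i < m) \sum_(j < n) A i j ^+ 2).

(* On row and column vectors the Frobenius norm is the Euclidean norm. *)
Definition spectral_norm (m n : nat) (A : 'M[R]_(m, n)) : R :=
  sup [set frobenius_norm (A *m x) | x in
         [set x : 'cV[R]_n | frobenius_norm x = 1]].

Definition linf_norm (m n : nat) (A : 'M[R]_(m, n)) : R := `|A|.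

Lemma linf_normE (m n : nat) (A : 'M[R]_(m, n)) :
  linf_norm A = \big[Num.max/0]_(ij : 'I_m * 'I_n) `|A ij.1 ij.2|.
Proof. by rewrite /linf_norm [LHS]/Num.Def.normr /= mx_normrE. Qed.

Definition pos_part (x : R) : R := Num.max x 0.

Definition psd (n : nat) (A : 'M[R]_n) : Prop :=
  A^T = A /\ forall x : 'cV[R]_n, 0 <= (x^T *m A *m x) 0 0.

(* The indices of sigma and u run from 1; entries of u beyond n are irrelevant,
   while sigma j = 0 for j > n. *)
Definition spectral_decomposition (n : nat) (A : 'M[R]_n)
    (sigma : nat -> R) (u : nat -> 'cV[R]_n) : Prop :=
  [/\ forall i j : nat, (1 <= i <= j)%N -> (j <= n)%N -> sigma j <= sigma i,
      forall i : nat, (1 <= i <= n)%N -> 0 <= sigma i,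
      forall j : nat, (n < j)%N -> sigma j = 0,
      forall i j : nat, (1 <= i <= n)%N -> (1 <= j <= n)%N ->
        ((u i)^T *m u j) 0 0 = (i == j)%:R &
      A = \sum_(1 <= i < n.+1) sigma i *: (u i *m (u i)^T)].

Definition spectral_truncation (n : nat) (sigma : nat -> R)
    (u : nat -> 'cV[R]_n) (r : nat) : 'M[R]_n :=
  \sum_(1 <= i < r.+1) sigma i *: (u i *m (u i)^T).

Definition mask_mx (n : nat) (S : {set 'I_n * 'I_n}) : 'M[R]_n :=
  \matrix_(i, j) ((i, j) \in S)%:R.

Definition mask_proj (n : nat) (S : {set 'I_n * 'I_n}) (A : 'M[R]_n)
  : 'M[R]_n := \matrix_(i, j) (if (i, j) \in S then A i j else 0).

Definition completion_objective (n r : nat) (S : {set 'I_n * 'I_n})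
    (M : 'M[R]_n) (alpha lambda : R) (X : 'M[R]_(n, r)) : R :=
  2^-1 * frobenius_norm (mask_proj S (X *m X^T - M)) ^+ 2
  + lambda * \sum_(i < n) pos_part (frobenius_norm (row i X) - alpha) ^+ 4.

End Matrices.

Definition local_minimum (R : realType) (T : topologicalType) (f : T -> R)
    (x : T) : Prop :=
  \forall y \near x, f x <= f y.

Section Probability.
Context {R : realType} (d : measure_display) (T : measurableType d)
  (P : probability T R).

Definition mutually_independent (I : finType) (D : {set I}) (A : I -> set T)
  : Prop :=
  (forall i, i \in D -> measurable (A i)) /\
  (forall J : {set I}, J \subset D ->
     P (\bigcap_(i in [set` J]) A i) = (\prod_(i in J) P (A i))%E).

Definition offdiag_symmetric_Ber (n : nat) (p : R)
    (Omega : T -> {set 'I_n * 'I_n}) : Prop :=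
  let upper := [set e : 'I_n * 'I_n | (e.1 < e.2)%N]%SET in
  let entry (e : 'I_n * 'I_n) := [set t | e \in Omega t] in
  [/\ forall t (i : 'I_n), (i, i) \notin Omega t,
      mutually_independent upper entry,
      forall e, e \in upper -> P (entry e) = p%:E &
      forall t (i j : 'I_n), (j < i)%N ->
        ((i, j) \in Omega t) = ((j, i) \in Omega t)].

End Probability.

(* Main.v *)
(* Write Mr = U U^T with U rotated so that X^T U is positive semidefinite, and let
   D = X - U, E = X X^T - Mr. At a local minimum, combining the first and second
   order conditions in the direction D gives
     |P D D^T|^2 - 3 |P E|^2 + (terms in the residual N) + (regularizer) >= 0,
   where P keeps the sampled entries. Three properties of the sample turn this
   into p |E|^2 <= (terms linear in |D|^2): a bound on |Omega - p J|, a bound on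
   |P N - p N|, and the lower bound
     sum_k Omega_kl <U_k, z>^2 >= (47/48) p |U z|^2 - kappa |z|^2
   for all l and z, which controls P (U D^T). In the basis of eigenvectors of
   D^T D, von Neumann's trace inequality compares the remaining terms with the
   eigenvalues sigma_i and sigma_(2r+1-i) and leaves r scalar quadratic problems.

   The spectral norms are bounded by the moment method: E tr A^L counts closed
   walks of length L using every edge twice, and these are compared with the
   walks on 2L vertices in a matrix with Bernoulli(1/3) entries, whose spectral norm
   is controlled by a net. The lower bound for all z at once is obtained by
   replacing z with a random point of a cube and changing the measure on it. *)

(* The regularizer pays for the fourth-order terms. Comparing sampled with full forms by Hadamard
   products costs 10 times |Omega - p J| S4, where S4 is the sum of the |D_k|^4, and lambda >= 100
   |Omega - p J| lets the penalty give back 100 of these. The obstacle is the sampled square of U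
   D^T: there the Hadamard bound produces the sum of the |U_k|^4 and S4 as separate factors, and
   nothing absorbs that product. Only a lower bound is needed, and it is taken column by column, for
   all z at once. A net over z would bring in the dimension r; averaging over a cube costs only
   kappa of order mu (sqrt(n p) + log n), where mu is the max norm of Mr. In the moment method L is
   a power of two of order n p (1 - p) + log n. This one choice gives the noise level sqrt L, the
   failure probability n exp(-2 L), and the factor p (1 - p) of the final bound. *)
Require Import Defs.
From HB Require Import structures.
From mathcomp Require Import all_boot all_order all_algebra.
From mathcomp Require Import all_classical all_reals all_analysis.
From mathcomp Require Import ring lra zify.
Import Order.TTheory GRing.Theory Num.Theory.
Import numFieldNormedType.Exports.

Set Implicit Arguments.
Unset Strict Implicit.
Unset Printing Implicit Defensive.

Local Open Scope classical_set_scope.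
Local Open Scope ring_scope.

(** * Frobenius and spectral norms *)

Section Norms.
Context {R : realType}.

Lemma sum_sqr_ge0 (I : finType) (P : pred I) (f : I -> R) :
  0 <= \sum_(i | P i) f i ^+ 2.
Proof. by apply: sumr_ge0 => i _; exact: sqr_ge0. Qed.

Lemma sum_cauchy_sqr (I : finType) (f g : I -> R) :
  (\sum_i f i * g i) ^+ 2 <= (\sum_i f i ^+ 2) * (\sum_i g i ^+ 2).
Proof.
set a := \sum_i f i ^+ 2; set b := \sum_i g i ^+ 2; set c := \sum_i f i * g i.
have a0 : 0 <= a := sum_sqr_ge0 _ _; have b0 : 0 <= b := sum_sqr_ge0 _ _.
have H x y : 0 <= x ^+ 2 * a + 2 * x * y * c + y ^+ 2 * b.
  have -> : x ^+ 2 * a + 2 * x * y * c + y ^+ 2 * b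
      = \sum_i (x * f i + y * g i) ^+ 2.
    rewrite /a /b /c !mulr_sumr -!big_split /=; apply: eq_bigr => i _; ring.
  exact: sum_sqr_ge0.
have [b00|bn0] := eqVneq b 0; last first.
  have bp : 0 < b by rewrite lt_def bn0.
  (* For x = b the form is least at y = - c, with value b (a b - c^2). *)
  have := H b (- c).
  have -> : b ^+ 2 * a + 2 * b * - c * c + (- c) ^+ 2 * b
     = b * (a * b - c ^+ 2) by ring.
  by rewrite pmulr_rge0// subr_ge0.
suff -> : c = 0 by rewrite expr0n /= mulr_ge0.
apply: big1 => i _.
have := psumr_eq0P (fun i _ => sqr_ge0 (g i)) b00 => /(_ i isT) /eqP.
by rewrite sqrf_eq0 => /eqP ->; rewrite mulr0.
Qed.

Lemma sum_cauchy (I : finType) (f g : I -> R) :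
  \sum_i f i * g i
    <= Num.sqrt (\sum_i f i ^+ 2) * Num.sqrt (\sum_i g i ^+ 2).
Proof.
apply: le_trans (ler_norm _) _.
rewrite -sqrtrM ?sum_sqr_ge0// -sqrtr_sqr ler_sqrt; last first.
  by rewrite mulr_ge0// sum_sqr_ge0.
exact: sum_cauchy_sqr.
Qed.

Definition mxdot (m n : nat) (A B : 'M[R]_(m, n)) : R := \tr (A^T *m B).

Lemma mxdotE (m n : nat) (A B : 'M[R]_(m, n)) :
  mxdot A B = \sum_i \sum_j A i j * B i j.
Proof.
rewrite /mxdot /mxtrace exchange_big /=; apply: eq_bigr => j _.
by rewrite mxE; apply: eq_bigr => i _; rewrite mxE.
Qed.

Lemma mxdotEp (m n : nat) (A B : 'M[R]_(m, n)) :
  mxdot A B = \sum_(e : 'I_m * 'I_n) A e.1 e.2 * B e.1 e.2.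
Proof. by rewrite mxdotE pair_bigA. Qed.

Lemma mxdotC (m n : nat) (A B : 'M[R]_(m, n)) : mxdot A B = mxdot B A.
Proof. by rewrite !mxdotEp; apply: eq_bigr => e _; rewrite mulrC. Qed.

Lemma mxdotDl (m n : nat) (A B C : 'M[R]_(m, n)) :
  mxdot (A + B) C = mxdot A C + mxdot B C.
Proof. by rewrite /mxdot linearD /= mulmxDl mxtraceD. Qed.

Lemma mxdotZl (m n : nat) a (A B : 'M[R]_(m, n)) :
  mxdot (a *: A) B = a * mxdot A B.
Proof. by rewrite /mxdot linearZ /= -scalemxAl mxtraceZ. Qed.

Lemma mxdotNl (m n : nat) (A B : 'M[R]_(m, n)) : mxdot (- A) B = - mxdot A B.
Proof. by rewrite -scaleN1r mxdotZl mulN1r. Qed.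

Lemma mxdotDr (m n : nat) (A B C : 'M[R]_(m, n)) :
  mxdot A (B + C) = mxdot A B + mxdot A C.
Proof. by rewrite mxdotC mxdotDl !(mxdotC A). Qed.

Lemma mxdotZr (m n : nat) a (A B : 'M[R]_(m, n)) :
  mxdot A (a *: B) = a * mxdot A B.
Proof. by rewrite mxdotC mxdotZl mxdotC. Qed.

Lemma mxdotNr (m n : nat) (A B : 'M[R]_(m, n)) : mxdot A (- B) = - mxdot A B.
Proof. by rewrite mxdotC mxdotNl mxdotC. Qed.

Definition mxdot_lin := (mxdotDl, mxdotDr, mxdotNl, mxdotNr, mxdotZl, mxdotZr).

Lemma mxdot_sqr (m n : nat) (A : 'M[R]_(m, n)) :
  mxdot A A = \sum_i \sum_j A i j ^+ 2.
Proof.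
by rewrite mxdotE; apply: eq_bigr => i _; apply: eq_bigr => j _; rewrite expr2.
Qed.

Lemma mxdot_ge0 (m n : nat) (A : 'M[R]_(m, n)) : 0 <= mxdot A A.
Proof. by rewrite mxdotEp; apply: sumr_ge0 => e _; rewrite -expr2 sqr_ge0. Qed.

Lemma mxdot_eq0 (m n : nat) (A : 'M[R]_(m, n)) : mxdot A A = 0 -> A = 0.
Proof.
rewrite mxdotEp => A0; apply/matrixP => i j; rewrite mxE.
have ge0 (e : 'I_m * 'I_n) : true -> 0 <= A e.1 e.2 * A e.1 e.2.
  by rewrite -expr2 sqr_ge0.
have := psumr_eq0P ge0 A0 => /(_ (i, j) isT) /eqP.
by rewrite /= mulf_eq0 orbb => /eqP.
Qed.

Lemma mxdot_mull (m n k : nat) (A : 'M[R]_(m, n)) (B : 'M[R]_(n, k)) (C : 'M[R]_(m, k)) :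
  mxdot (A *m B) C = mxdot B (A^T *m C).
Proof. by rewrite /mxdot trmx_mul mulmxA. Qed.

Lemma mxdot_mulr (m n k : nat) (A : 'M[R]_(m, n)) (B : 'M[R]_(n, k)) (C : 'M[R]_(m, k)) :
  mxdot (A *m B) C = mxdot A (C *m B^T).
Proof. by rewrite /mxdot trmx_mul -mulmxA mxtrace_mulC mulmxA. Qed.

Lemma mxdot_tr (m n : nat) (A B : 'M[R]_(m, n)) : mxdot A^T B^T = mxdot A B.
Proof. by rewrite mxdotC /mxdot trmxK mxtrace_mulC. Qed.

Lemma frob_sqr (m n : nat) (A : 'M[R]_(m, n)) :
  frobenius_norm A ^+ 2 = mxdot A A.
Proof.
by rewrite mxdot_sqr sqr_sqrtr//; apply: sumr_ge0 => i _; exact: sum_sqr_ge0.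
Qed.

Lemma frobE (m n : nat) (A : 'M[R]_(m, n)) :
  frobenius_norm A = Num.sqrt (mxdot A A).
Proof. by rewrite -frob_sqr sqrtr_sqr ger0_norm// sqrtr_ge0. Qed.

Lemma frob_ge0 (m n : nat) (A : 'M[R]_(m, n)) : 0 <= frobenius_norm A.
Proof. exact: sqrtr_ge0. Qed.

Lemma frob_eq0 (m n : nat) (A : 'M[R]_(m, n)) : frobenius_norm A = 0 -> A = 0.
Proof. by move=> A0; apply: mxdot_eq0; rewrite -frob_sqr A0 expr0n. Qed.

Lemma frobZ (m n : nat) a (A : 'M[R]_(m, n)) :
  frobenius_norm (a *: A) = `|a| * frobenius_norm A.
Proof.
by rewrite !frobE mxdotZl mxdotZr mulrA -expr2 sqrtrM ?sqr_ge0// sqrtr_sqr.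
Qed.

Lemma frobN (m n : nat) (A : 'M[R]_(m, n)) :
  frobenius_norm (- A) = frobenius_norm A.
Proof. by rewrite -scaleN1r frobZ normrN1 mul1r. Qed.

Lemma mxdot_le_frob (m n : nat) (A B : 'M[R]_(m, n)) :
  mxdot A B <= frobenius_norm A * frobenius_norm B.
Proof.
rewrite !frobE !mxdot_sqr !pair_bigA mxdotEp /=; exact: sum_cauchy.
Qed.

Lemma norm_mxdot_le_frob (m n : nat) (A B : 'M[R]_(m, n)) :
  `|mxdot A B| <= frobenius_norm A * frobenius_norm B.
Proof.
by rewrite ler_norml mxdot_le_frob andbT lerNl -mxdotNl -(frobN A) mxdot_le_frob.
Qed.

Lemma frobD (m n : nat) (A B : 'M[R]_(m, n)) :
  frobenius_norm (A + B) <= frobenius_norm A + frobenius_norm B.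
Proof.
have H0 : 0 <= frobenius_norm A + frobenius_norm B.
  by rewrite addr_ge0// frob_ge0.
rewrite -(@ler_pXn2r _ 2) ?nnegrE ?frob_ge0//.
rewrite frob_sqr !mxdot_lin (mxdotC B A) -!frob_sqr.
have := mxdot_le_frob A B; lra.
Qed.

Lemma frob_mulmx (m n k : nat) (A : 'M[R]_(m, n)) (B : 'M[R]_(n, k)) :
  frobenius_norm (A *m B) <= frobenius_norm A * frobenius_norm B.
Proof.
rewrite -(@ler_pXn2r _ 2) ?nnegrE ?frob_ge0 ?mulr_ge0 ?frob_ge0//.
rewrite exprMn !frob_sqr !mxdot_sqr.
rewrite mulr_suml; apply: ler_sum => i _.
rewrite [X in _ <= _ * X]exchange_big /= mulr_sumr; apply: ler_sum => j _.
by rewrite mxE sum_cauchy_sqr.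
Qed.

Lemma spec_has_ubound (m n : nat) (A : 'M[R]_(m, n)) :
  has_ubound [set frobenius_norm (A *m x) | x in
         [set x : 'cV[R]_n | frobenius_norm x = 1]].
Proof.
exists (frobenius_norm A) => _ [x /= x1 <-].
by rewrite -[leRHS]mulr1 -x1 frob_mulmx.
Qed.

Lemma frob_delta (m n : nat) (i : 'I_m) (j : 'I_n) :
  frobenius_norm (delta_mx i j : 'M[R]_(m, n)) = 1.
Proof.
rewrite frobE mxdotE (bigD1 i) //= (bigD1 j) //= !mxE !eqxx /= mulr1.
rewrite big1 => [|k kj]; last by rewrite mxE (negbTE kj) andbF mul0r.
rewrite big1 => [|k ki]; last first.
  by apply: big1 => l _; rewrite mxE (negbTE ki) mul0r.
by rewrite !addr0 sqrtr1.
Qed.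

Lemma spec_norm_ge0 (m n : nat) (A : 'M[R]_(m, n)) : 0 <= spectral_norm A.
Proof.
rewrite /spectral_norm; set S := image _ _.
(* The unit sphere is empty when n = 0; then [sup] is 0. *)
have [S0|/set0P[y [x x1 xy]]] := eqVneq S set0; first by rewrite S0 sup0.
apply: le_trans (frob_ge0 (A *m x)) _.
by apply: ub_le_sup; [exact: spec_has_ubound | exists x].
Qed.

Lemma spec_normP (m n : nat) (A : 'M[R]_(m, n)) (x : 'cV[R]_n) :
  frobenius_norm (A *m x) <= spectral_norm A * frobenius_norm x.
Proof.
have [x0|xn0] := eqVneq (frobenius_norm x) 0.
  by rewrite (frob_eq0 x0) mulmx0 frobE /mxdot mulmx0 mxtrace0 sqrtr0 mulr_ge0
    ?spec_norm_ge0 ?frob_ge0.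
have xp : 0 < frobenius_norm x by rewrite lt_def xn0 frob_ge0.
rewrite -ler_pdivrMr//.
have -> : frobenius_norm (A *m x) / frobenius_norm x
    = frobenius_norm (A *m ((frobenius_norm x)^-1 *: x)).
  by rewrite -scalemxAr frobZ ger0_norm ?invr_ge0 ?frob_ge0// mulrC.
apply: ub_le_sup; first exact: spec_has_ubound.
exists ((frobenius_norm x)^-1 *: x) => //=.
by rewrite frobZ ger0_norm ?invr_ge0 ?frob_ge0// mulVf.
Qed.

(** For n = 0 there are no unit vectors, the norm is 0, and b could be negative. *)
Lemma spec_norm_le (m n : nat) (A : 'M[R]_(m, n)) (b : R) : (0 < n)%N ->
  (forall x : 'cV[R]_n, frobenius_norm x = 1 -> frobenius_norm (A *m x) <= b) ->
  spectral_norm A <= b.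
Proof.
case: n A => // n A _ H; apply: ge_sup => [|_ [x /= x1 <-]]; last exact: H.
pose e : 'cV[R]_n.+1 := delta_mx 0 0.
by exists (frobenius_norm (A *m e)), e; rewrite //= frob_delta.
Qed.

Lemma spec_bilin (m n : nat) (A : 'M[R]_(m, n)) (f : 'I_m -> R) (g : 'I_n -> R) :
  \sum_i \sum_j A i j * f i * g j
  <= spectral_norm A * Num.sqrt (\sum_i f i ^+ 2) * Num.sqrt (\sum_j g j ^+ 2).
Proof.
have colE k (h : 'I_k -> R) :
    Num.sqrt (\sum_i h i ^+ 2) = frobenius_norm (\col_i h i).
  rewrite frobE mxdotE; congr Num.sqrt; apply: eq_bigr => i _.
  by rewrite big_ord1 !mxE expr2.
have -> : \sum_i \sum_j A i j * f i * g j
   = mxdot (\col_i f i) (A *m \col_j g j).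
  rewrite mxdotE; apply: eq_bigr => i _; rewrite big_ord1 !mxE mulr_sumr.
  by apply: eq_bigr => j _; rewrite !mxE mulrCA mulrA.
rewrite !colE; apply: le_trans (mxdot_le_frob _ _) _.
rewrite [leRHS]mulrAC [leRHS]mulrC ler_wpM2l ?frob_ge0//; exact: spec_normP.
Qed.

Lemma spec_normN (m n : nat) (A : 'M[R]_(m, n)) :
  spectral_norm (- A) = spectral_norm A.
Proof.
rewrite /spectral_norm; congr sup; apply/seteqP; split => _ [x x1 <-];
  by exists x => //; rewrite mulNmx frobN.
Qed.

(* Expanding the two inner products turns the sum into r*r bilinear forms in H. *)
Lemma spec_hadamard (n r1 r2 : nat) (H : 'M[R]_n) (A C : 'M[R]_(n, r1))
    (B D : 'M[R]_(n, r2)) :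
  \sum_k \sum_l H k l * (A *m C^T) k l * (B *m D^T) k l
  <= spectral_norm H
     * Num.sqrt (\sum_k (\sum_a A k a ^+ 2) * (\sum_b B k b ^+ 2))
     * Num.sqrt (\sum_l (\sum_a C l a ^+ 2) * (\sum_b D l b ^+ 2)).
Proof.
have -> : \sum_k \sum_l H k l * (A *m C^T) k l * (B *m D^T) k l
   = \sum_(ab : 'I_r1 * 'I_r2) \sum_k \sum_l
       H k l * (A k ab.1 * B k ab.2) * (C l ab.1 * D l ab.2).
  rewrite [RHS]exchange_big /=; apply: eq_bigr => k _.
  rewrite [RHS]exchange_big /=; apply: eq_bigr => l _.
  rewrite !mxE -mulrA big_distrlr /= pair_bigA mulr_sumr; apply: eq_bigr => -[a b] _ /=.
  by rewrite !mxE; ring.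
have sqE (r1' r2' : nat) (F : 'M[R]_(n, r1')) (G : 'M[R]_(n, r2')) :
    \sum_k (\sum_a F k a ^+ 2) * (\sum_b G k b ^+ 2)
    = \sum_(ab : 'I_r1' * 'I_r2') \sum_k (F k ab.1 * G k ab.2) ^+ 2.
  rewrite [RHS]exchange_big /=; apply: eq_bigr => k _.
  rewrite big_distrlr /= pair_bigA; apply: eq_bigr => -[a b] _ /=; ring.
apply: le_trans.
  by apply: ler_sum => ab _; exact: spec_bilin.
rewrite !sqE; under eq_bigr do rewrite -mulrA.
rewrite -mulr_sumr -mulrA ler_wpM2l ?spec_norm_ge0//.
have rootK (r1' r2' : nat) (F : 'M[R]_(n, r1')) (G : 'M[R]_(n, r2')) :
    \sum_(ab : 'I_r1' * 'I_r2')
       Num.sqrt (\sum_k (F k ab.1 * G k ab.2) ^+ 2) ^+ 2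
    = \sum_(ab : 'I_r1' * 'I_r2') \sum_k (F k ab.1 * G k ab.2) ^+ 2.
  by apply: eq_bigr => ab _; rewrite sqr_sqrtr// sum_sqr_ge0.
by rewrite -(rootK _ _ A B) -(rootK _ _ C D) sum_cauchy.
Qed.

End Norms.

(** * Alignment and trace inequalities *)

Section OrthogonalGroup.
Context {R : realType}.

Lemma continuous_sum (T : topologicalType) (I : finType) (F : I -> T -> R) :
  (forall i, continuous (F i)) -> continuous (fun x => \sum_i F i x).
Proof.
move=> cF x; rewrite /index_enum; elim: (Finite.enum I) => [|i s IH].
  under eq_fun do rewrite big_nil.
  exact: cst_continuous.
under eq_fun do rewrite big_cons.
by apply: cvgD => //; exact: cF.
Qed.

Lemma continuous_mul (T : topologicalType) (f g : T -> R) :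
  continuous f -> continuous g -> continuous (fun x => f x * g x).
Proof. by move=> cf cg x; apply: continuousM; [exact: cf | exact: cg]. Qed.

(** Compactness of the orthogonal group: it is closed as an intersection of level sets of Gram
    entries, and bounded because its columns are unit vectors. Matrices are flattened because the
    extreme value theorem is stated for row vectors. *)
Lemma orth_argmax (r : nat) (f : 'M[R]_r -> R) :
  continuous (fun v : 'rV[R]_(r * r) => f (vec_mx v)) ->
  exists2 Q : 'M[R]_r, Q^T *m Q = 1%:M &
    forall Q' : 'M[R]_r, Q'^T *m Q' = 1%:M -> f Q' <= f Q.
Proof.
move=> cf.
pose g (ij : 'I_r * 'I_r) (v : 'rV[R]_(r * r)) : R :=
  \sum_k v 0 (mxvec_index k ij.1) * v 0 (mxvec_index k ij.2).
have gE ij v : g ij v = ((vec_mx v)^T *m vec_mx v) ij.1 ij.2.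
  by rewrite mxE; apply: eq_bigr => k _; rewrite !mxE.
pose K := \bigcap_(ij in [set: 'I_r * 'I_r])
  (g ij @^-1` [set (ij.1 == ij.2)%:R]).
have KP v : K v <-> (vec_mx v)^T *m vec_mx v = 1%:M.
  split=> [Kv|vv ij _ /=]; last by rewrite gE vv mxE.
  by apply/matrixP => i j; have := Kv (i, j) I; rewrite /= gE /= => ->; rewrite mxE.
have clK : closed K.
  apply: closed_bigI => ij _; apply: preimage_closed; last exact: closed_eq.
  move=> v _; apply: continuous_sum => k.
  by apply: continuous_mul; exact: coord_continuous.
have bK : bounded_set K.
  exists 1; split => // x x1 v /KP vv /=.
  apply: le_trans (ltW x1).
  rewrite [leLHS]/Num.Def.normr /= mx_normrE; apply: bigmax_le => // -[i j] _ /=.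
  rewrite (ord1 i); case/mxvec_indexP: j => k l.
  have : ((vec_mx v)^T *m vec_mx v) l l = 1 by rewrite vv mxE eqxx.
  rewrite mxE (bigD1 k) //= !mxE => H.
  rewrite -(@expr_le1 _ 2) // real_normK ?num_real// expr2 -H lerDl.
  by apply: sumr_ge0 => m _; rewrite !mxE -expr2 sqr_ge0.
have K0 : K !=set0.
  by exists (mxvec 1%:M); apply/KP; rewrite mxvecK trmx1 mulmx1.
have [v vK vmax] := EVT_max_rV K0 (bounded_closed_compact bK clK)
  (continuous_subspaceT cf).
exists (vec_mx v); first by apply/KP; rewrite inE in vK.
move=> Q QQ; rewrite -(mxvecK Q); apply: vmax.
by rewrite inE; apply/KP; rewrite mxvecK.
Qed.

Lemma continuous_entry (r : nat) (i j : 'I_r) :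
  continuous (fun v : 'rV[R]_(r * r) => vec_mx v i j).
Proof. by under eq_fun do rewrite mxE; exact: coord_continuous. Qed.

Lemma continuous_tr_mul (r : nat) (K : 'M[R]_r) :
  continuous (fun v : 'rV[R]_(r * r) => \tr (K *m vec_mx v)).
Proof.
apply: continuous_sum => i; under eq_fun do rewrite mxE.
apply: continuous_sum => k; apply: continuous_mul; last exact: continuous_entry.
exact: cst_continuous.
Qed.

Lemma continuous_tr_conj (r : nat) (C W : 'M[R]_r) :
  continuous (fun v : 'rV[R]_(r * r) =>
    \tr (C *m ((vec_mx v)^T *m W *m vec_mx v))).
Proof.
apply: continuous_sum => i; under eq_fun do rewrite mxE.
apply: continuous_sum => k; under eq_fun do rewrite mxE.
apply: continuous_mul; first exact: cst_continuous.
apply: continuous_sum => j; apply: continuous_mul; last exact: continuous_entry.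
under eq_fun do rewrite mxE.
apply: continuous_sum => l; apply: continuous_mul; last exact: cst_continuous.
under eq_fun do rewrite mxE.
exact: continuous_entry.
Qed.

End OrthogonalGroup.

(** * Polar factor and diagonalization as solutions of extremal problems *)

Section Alignment.
Context {R : realType}.

(** Stands in for the derivative test at a maximum. A nonzero a violates the hypothesis at e = a /
    (2 c), where c = |a| + |b| keeps |e| <= 1 and makes the quadratic side at most half of the
    linear one. *)
Lemma linear_le_quadratic (a b : R) :
  (forall e, `|e| <= 1 -> e * a <= e ^+ 2 * b) -> a = 0.
Proof.
move=> H; have [//|a0] := eqVneq a 0.
have na0 : 0 < `|a| by rewrite normr_gt0.
set c := `|a| + `|b|; have c0 : 0 < c by rewrite /c; have := normr_ge0 b; lra.
have bc : b <= c by rewrite /c; have := ler_norm b; lra.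
have ac : `|a / (2 * c)| <= 1.
  rewrite normrM normfV (gtr0_norm (mulr_gt0 _ c0))// ler_pdivrMr ?mulr_gt0// /c.
  by have := normr_ge0 b; lra.
have := H _ ac.
have -> : a / (2 * c) * a = a ^+ 2 / (2 * c) by field; lra.
have -> : (a / (2 * c)) ^+ 2 * b = (a ^+ 2 / (2 * c)) * (b / (2 * c)) by field; lra.
have : b / (2 * c) <= 2^-1 by rewrite ler_pdivrMr ?mulr_gt0//; lra.
have a2 : 0 < a ^+ 2 by rewrite exprn_even_gt0.
have : 0 < a ^+ 2 / (2 * c) by rewrite (divr_gt0 a2)// mulr_gt0.
set q := _ / _; set u := b / _; nra.
Qed.

Lemma mxdot_delta (m n : nat) (B : 'M[R]_(m, n)) i j :
  mxdot (delta_mx i 0 : 'cV_m) (B *m (delta_mx j 0 : 'cV_n)) = B i j.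
Proof.
rewrite mxdotE; under eq_bigr do rewrite big_ord1 mxE.
rewrite (bigD1 i) //= [X in _ + X]big1 ?addr0 => [|k ki]; last first.
  by rewrite (negbTE ki) mul0r.
rewrite !mxE !eqxx mul1r (bigD1 j) //= [X in _ + X]big1 ?addr0 => [|k kj].
  by rewrite !mxE !eqxx mulr1.
by rewrite !mxE (negbTE kj) mulr0.
Qed.

Lemma mxdot_delta1 (n : nat) (i j : 'I_n) :
  mxdot (delta_mx i 0 : 'cV[R]_n) (delta_mx j 0) = (i == j)%:R.
Proof. by rewrite -[X in mxdot _ X]mul1mx mxdot_delta mxE. Qed.

Lemma mul_cv_scalar (n : nat) (v w : 'cV[R]_n) : v^T *m w = (mxdot v w)%:M.
Proof. by rewrite /mxdot [LHS]mx11_scalar trace_mx11. Qed.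

Lemma mxtrace_mul_cv (n : nat) (A : 'M[R]_n) (v w : 'cV[R]_n) :
  \tr (A *m (v *m w^T)) = mxdot w (A *m v).
Proof. by rewrite mulmxA mxtrace_mulC /mxdot mulmxA. Qed.

(** At v = 0 the inverse is 0 and the reflection degenerates to the identity, which is still
    orthogonal. *)
Definition householder (n : nat) (v : 'cV[R]_n) : 'M[R]_n :=
  1%:M - (2 / mxdot v v) *: (v *m v^T).

Lemma householder_tr (n : nat) (v : 'cV[R]_n) : (householder v)^T = householder v.
Proof. by rewrite /householder linearB /= trmx1 linearZ /= trmx_mul trmxK. Qed.

Lemma mul_outer_cv (n : nat) (v w : 'cV[R]_n) :
  (v *m v^T) *m (w *m w^T) = mxdot v w *: (v *m w^T).
Proof.
by rewrite mulmxA -(mulmxA v) mul_cv_scalar mul_mx_scalar scalemxAl.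
Qed.

Lemma householder_orth (n : nat) (v : 'cV[R]_n) :
  (householder v)^T *m householder v = 1%:M.
Proof.
rewrite householder_tr /householder; set k := 2 / _.
rewrite mulmxBl !mulmxBr !mulmx1 !mul1mx -scalemxAl -scalemxAr mul_outer_cv.
rewrite !scalerA; have [v0|v0] := eqVneq (mxdot v v) 0.
  by rewrite v0 /k v0 invr0 !(mulr0, mul0r) !scale0r !subr0.
have -> : k * k * mxdot v v = k + k by rewrite /k; field.
by rewrite scalerDl opprB addrK subrK.
Qed.

Lemma orth_mul (n : nat) (A B : 'M[R]_n) : A^T *m A = 1%:M -> B^T *m B = 1%:M ->
  (A *m B)^T *m (A *m B) = 1%:M.
Proof. by move=> A1 B1; rewrite trmx_mul mulmxA -(mulmxA B^T) A1 mulmx1. Qed.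

Lemma mxdot0r (m n : nat) (A : 'M[R]_(m, n)) : mxdot A 0 = 0.
Proof. by rewrite /mxdot mulmx0 mxtrace0. Qed.

Lemma mxdot_gt0 (m n : nat) (A : 'M[R]_(m, n)) : A != 0 -> 0 < mxdot A A.
Proof.
move=> A0; rewrite lt_def mxdot_ge0 andbT.
by apply: contra_neq A0; exact: mxdot_eq0.
Qed.

(** Q maximizes tr (K Q), the orthogonal Procrustes problem. Comparison with one reflection gives
    positivity of K Q, comparison with a product of two gives symmetry; no singular value
    decomposition is involved. *)
Lemma polar_alignment (r : nat) (K : 'M[R]_r) :
  exists Q : 'M[R]_r, [/\ Q^T *m Q = 1%:M, (K *m Q)^T = K *m Q &
    forall v : 'cV[R]_r, 0 <= mxdot v (K *m Q *m v)].
Proof.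
have [Q Q1 Qmax] := @orth_argmax _ _ (fun Q => \tr (K *m Q)) (@continuous_tr_mul _ _ K).
set A := K *m Q.
have Amax O : O^T *m O = 1%:M -> \tr (A *m O) <= \tr A.
  by move=> O1; rewrite /A -mulmxA; apply: Qmax; exact: orth_mul.
pose q (x y : 'cV[R]_r) := mxdot x (A *m y).
have trP v w : \tr (A *m (v *m w^T)) = q w v by rewrite mxtrace_mul_cv.
have qge0 v : 0 <= q v v.
  have [->|/mxdot_gt0 vv] := eqVneq v 0; first by rewrite /q mulmx0 mxdot0r.
  have := Amax _ (householder_orth v).
  rewrite /householder mulmxBr mulmx1 -scalemxAr linearB /= mxtraceZ trP gerBl.
  by rewrite pmulr_rge0// divr_gt0.
(* The product of two reflections is a rotation; letting w tend to v makes it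
   an infinitesimal one. *)
have rot v w : 2 * mxdot v w * q w v <= mxdot w w * q v v + mxdot v v * q w w.
  have [->|/mxdot_gt0 vv] := eqVneq v 0.
    by rewrite /q mulmx0 !mxdot0r !(mulr0, mul0r, addr0).
  have [->|/mxdot_gt0 ww] := eqVneq w 0.
    by rewrite /q mulmx0 !mxdot0r !(mulr0, mul0r, addr0).
  have := Amax _ (orth_mul (householder_orth v) (householder_orth w)).
  rewrite /householder mulmxBl !mulmxBr !mulmx1 mul1mx -!scalemxAl -!scalemxAr.
  rewrite mul_outer_cv -!scalemxAr !raddfB /= !mxtraceZ !trP => H.
  have vw := mulr_gt0 vv ww.
  rewrite -subr_ge0 -(pmulr_rge0 _ (divr_gt0 (ltr0n _ 2) vw)).
  set X := (X in 0 <= X); move: H.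
  rewrite -subr_ge0; congr (0 <= _); rewrite /X.
  by field; rewrite !gt_eqF.
exists Q; split=> //.
apply/matrixP => i j; rewrite mxE -/A -!mxdot_delta.
set v := delta_mx i 0; set z := delta_mx j 0.
have vv1 : mxdot v v = 1 by rewrite mxdot_delta1 eqxx.
apply/eqP; rewrite -subr_eq0; apply/eqP.
apply: (@linear_le_quadratic _
  (mxdot z z * q v v + q z z - 2 * mxdot v z * q z v)) => e _.
have := rot v (v + e *: z).
rewrite /q mulmxDr -scalemxAr !mxdot_lin (mxdotC z v) vv1; nra.
Qed.

(** V maximizes tr (C V^T W V) for a diagonal C with strictly decreasing entries. Strictness forces
    the off-diagonal entries to vanish, and the same optimality orders the diagonal, so sorting
    needs no separate permutation. *)
Lemma sorted_diagonalization (r : nat) (W : 'M[R]_r) : W^T = W ->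
  exists V : 'M[R]_r, [/\ V^T *m V = 1%:M,
    forall i j, i != j -> (V^T *m W *m V) i j = 0 &
    forall i j : 'I_r, (i <= j)%N ->
      (V^T *m W *m V) j j <= (V^T *m W *m V) i i].
Proof.
move=> Wsym; pose c : 'rV[R]_r := \row_(i < r) (r - i)%:R.
pose C := diag_mx c.
have [V V1 Vmax] := @orth_argmax _ _ (fun V => \tr (C *m (V^T *m W *m V)))
  (@continuous_tr_conj _ _ C W).
set B := V^T *m W *m V.
have Bsym : B^T = B by rewrite /B !trmx_mul trmxK Wsym mulmxA.
have Csym : C^T = C by rewrite tr_diag_mx.
(* Optimality of V against V times the reflection in v. *)
have cond (v : 'cV[R]_r) : mxdot v (B *m v) * mxdot v (C *m v)
    <= mxdot v v * mxdot v (C *m B *m v).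
  have [->|/mxdot_gt0 vv] := eqVneq v 0; first by rewrite !mulmx0 !mxdot0r mulr0.
  have := Vmax _ (orth_mul V1 (householder_orth v)).
  rewrite trmx_mul householder_tr.
  have -> : householder v *m V^T *m W *m (V *m householder v)
     = householder v *m B *m householder v by rewrite /B !mulmxA.
  rewrite /householder; set k := 2 / _.
  rewrite mulmxBl mul1mx mulmxBr mulmx1 -scalemxAl -scalemxAr mulmxBl.
  rewrite -!scalemxAl !mulmxBr -!scalemxAr !linearB /= !linearZ /=.
  have -> : \tr (C *m (B *m (v *m v^T))) = mxdot v (C *m B *m v).
    by rewrite mulmxA mxtrace_mul_cv.
  have -> : \tr (C *m (v *m v^T *m B)) = mxdot v (C *m B *m v).
    rewrite mulmxA mxtrace_mulC mulmxA mxtrace_mul_cv.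
    by rewrite -mulmxA -{1}Bsym -mxdot_mull mxdotC -{1}Csym mxdot_mull trmxK mulmxA.
  have -> : \tr (C *m (v *m v^T *m B *m (v *m v^T)))
     = mxdot v (B *m v) * mxdot v (C *m v).
    rewrite -[v *m v^T *m B *m _]mulmxA (mulmxA B) -[v *m v^T *m _]mulmxA.
    rewrite [v^T *m (_ *m _)]mulmxA mul_cv_scalar mul_scalar_mx -!scalemxAr.
    by rewrite linearZ /= mxtrace_mul_cv.
  set s := mxdot v (B *m v); set t := mxdot v (C *m v); set m := mxdot v (C *m _ *m _).
  rewrite -/B /GRing.scale /= => H; have k0 : 0 < k by rewrite divr_gt0.
  have kd : k * mxdot v v = 2 by rewrite /k; field; rewrite gt_eqF.
  have {H} : k * (k * (s * t)) <= k * (2 * m) by lra.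
  by rewrite (ler_pM2l k0) -kd -[k * _ * m]mulrA (ler_pM2l k0).
have Ce i j : (C *m B) i j = c 0 i * B i j by rewrite mul_diag_mx mxE.
have entry i j x : i != j ->
    (c 0 i + x ^+ 2 * c 0 j) * (B i i + 2 * x * B i j + x ^+ 2 * B j j)
    <= (1 + x ^+ 2) * (c 0 i * B i i + x * (c 0 i + c 0 j) * B i j
                       + x ^+ 2 * c 0 j * B j j).
  move=> ij; have := cond (delta_mx i 0 + x *: delta_mx j 0).
  rewrite !mulmxDr -!scalemxAr !mxdot_lin !mxdot_delta !mxdot_delta1 !Ce.
  rewrite !eqxx (negbTE ij) [j == i]eq_sym (negbTE ij) /=.
  have -> : B j i = B i j by rewrite -[in LHS]Bsym mxE.
  have -> : C i i = c 0 i by rewrite mxE eqxx.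
  have -> : C j j = c 0 j by rewrite mxE eqxx.
  have -> : C i j = 0 by rewrite mxE (negbTE ij).
  have -> : C j i = 0 by rewrite mxE eq_sym (negbTE ij).
  lra.
have cdec (i j : 'I_r) : (i < j)%N -> c 0 j < c 0 i.
  by move=> ij; rewrite !mxE ltr_nat; have := ltn_ord j; lia.
exists V; split=> //.
  have off (i j : 'I_r) : (i < j)%N -> B i j = 0.
    move=> ij; have cij := cdec _ _ ij.
    have nij : i != j by rewrite -val_eqE /= ltn_eqF.
    have : (c 0 i - c 0 j) * B i j = 0.
      (* [entry] at x = e reads e b - e^3 b <= e^2 (...); since |e| <= 1 the cubic term is moved
         into the quadratic side as |b| e^2. *)
      set b := _ * _.
      apply: (@linear_le_quadratic _
        ((c 0 i - c 0 j) * (B i i - B j j) + `|b|)) => e e1.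
      have := entry i j e nij.
      have : e * (e ^+ 2 * b) <= e ^+ 2 * `|b|.
        rewrite mulrCA ler_wpM2l ?sqr_ge0//.
        apply: le_trans (ler_norm _) _; rewrite normrM -[leRHS]mul1r.
        by rewrite ler_wpM2r.
      rewrite /b; nra.
    by move/eqP; rewrite mulf_eq0 subr_eq0 (gt_eqF cij) => /eqP.
  move=> i j; rewrite -val_eqE neq_ltn => /orP[|] ij; first exact: off.
  by rewrite -/B -Bsym mxE off.
move=> i j; rewrite leq_eqVlt => /orP[/eqP/val_inj -> //|ij].
have nij : i != j by rewrite -val_eqE /= ltn_eqF.
(* Adding x = 1 and x = -1 cancels B i j and leaves (c_i - c_j) (B i i - B j j) >= 0. *)
have := entry i j (-1) nij; have := entry i j 1 nij; have := cdec _ _ ij.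
rewrite -/B; nra.
Qed.

End Alignment.

(** * Rearrangement and trace inequalities *)

Section TraceInequalities.
Context {R : realType}.

(* Linear programming duality: [p j + q l] dominates [a j * s l], with equality
   on the diagonal. *)
Lemma substochastic_rearrangement (r m : nat) (a s : nat -> R)
    (b : 'I_r -> 'I_m -> R) :
  (forall k, a k.+1 <= a k) -> (forall k, (r <= k)%N -> a k = 0) ->
  (forall k, s k.+1 <= s k) -> (forall k, 0 <= s k) ->
  (forall j l, 0 <= b j l) -> (forall j, \sum_l b j l <= 1) ->
  (forall l, \sum_j b j l <= 1) ->
  \sum_j \sum_l b j l * (a j * s l) <= \sum_(j < r) a j * s j.
Proof.
move=> adec a0 sdec s0 b0 brow bcol.
have adecw : {homo a : i j / (i <= j)%N >-> j <= i}.
  by apply: homo_leq => // x y z xy yz; apply: le_trans yz xy.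
have sdecw : {homo s : i j / (i <= j)%N >-> j <= i}.
  by apply: homo_leq => // x y z xy yz; apply: le_trans yz xy.
have age0 k : 0 <= a k.
  have [rk|kr] := leqP r k; first by rewrite a0.
  by rewrite -(a0 r)// adecw// ltnW.
pose p j := \sum_(j <= k < r) (a k - a k.+1) * s k.
pose q l := \sum_(l <= k < r) a k.+1 * (s k - s k.+1).
have p0 j : 0 <= p j by apply: sumr_ge0 => k _; rewrite mulr_ge0// subr_ge0.
have q0 j : 0 <= q j by apply: sumr_ge0 => k _; rewrite mulr_ge0// subr_ge0.
have pq j : p j + q j = a j * s j.
  rewrite /p /q -big_split /=.
  have [jr|rj] := leqP j r; last by rewrite big_geq ?a0 ?mul0r// ltnW.
  rewrite (eq_bigr (fun k => - (a k.+1 * s k.+1 - a k * s k))) => [|k _]; last by ring.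
  by rewrite sumrN (telescope_sumr (fun k => a k * s k))// a0// mul0r sub0r opprK.
have pS k : p k = (a k - a k.+1) * s k + p k.+1.
  have [kr|rk] := ltnP k r; first by rewrite /p big_ltn.
  by rewrite /p !big_geq// ?(leq_trans rk)// !a0 ?(leq_trans rk)// subrr mul0r addr0.
have qS k : q k = a k.+1 * (s k - s k.+1) + q k.+1.
  have [kr|rk] := ltnP k r; first by rewrite /q big_ltn.
  by rewrite /q !big_geq// ?(leq_trans rk)// !a0 ?(leq_trans rk)// mul0r addr0.
have dual j l : a j * s l <= p j + q l.
  have [jl|lj] := leqP j l.
    suff : s l * (a j - a l) <= p j - p l by have := pq l; lra.
    move: jl; elim: l => [|l IH]; first by rewrite leqn0 => /eqP ->; lra.
    rewrite leq_eqVlt => /orP[/eqP -> |]; first by lra.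
    rewrite ltnS => jl; have := IH jl; have := pS l.
    have := adec l; have := sdec l; have := adecw _ _ jl; nra.
  suff : a j * (s l - s j) <= q l - q j by have := pq j; lra.
  move: (ltnW lj) => {lj}; elim: j => [|j IH]; first by rewrite leqn0 => /eqP ->; lra.
  rewrite leq_eqVlt => /orP[/eqP -> |]; first by lra.
  rewrite ltnS => lj; have := IH lj; have := qS j.
  have := adec j; have := sdec j; have := sdecw _ _ lj; nra.
have qr l : (r <= l)%N -> q l = 0 by move=> rl; rewrite /q big_geq.
have qsum : \sum_(l < m) q l <= \sum_(l < r) q l.
  have [mr|rm] := leqP m r.
    rewrite -!(big_mkord xpredT q) [leRHS](@big_cat_nat _ _ _ m)//= lerDl.
    by apply: sumr_ge0.
  rewrite -!(big_mkord xpredT q) [leLHS](@big_cat_nat _ _ _ r)//= 1?ltnW//.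
  rewrite [X in _ + X]big_nat [X in _ + X]big1 ?addr0// => l /andP[rl _]; exact: qr.
apply: (@le_trans _ _ (\sum_j \sum_l b j l * (p j + q l))).
  by apply: ler_sum => j _; apply: ler_sum => l _; rewrite ler_wpM2l.
under eq_bigr do (under eq_bigr do rewrite mulrDr; rewrite big_split /=).
rewrite big_split /= -[leRHS](eq_bigr _ (fun (j : 'I_r) _ => pq j)) big_split /=.
apply: lerD.
  by apply: ler_sum => j _; rewrite -mulr_suml -[leRHS]mul1r ler_wpM2r.
apply: le_trans qsum.
by rewrite exchange_big /=; apply: ler_sum => l _; rewrite -mulr_suml -[leRHS]mul1r ler_wpM2r.
Qed.

(** Follows from |y - O c|^2 >= 0 and |O c| <= |c|. Columns shorter than 1 are allowed because
    [von_neumann_trace] normalizes columns that may be zero. *)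
Lemma bessel (n m : nat) (O : 'M[R]_(n, m)) (y : 'cV[R]_n) :
  (forall i j, i != j -> (O^T *m O) i j = 0) ->
  (forall i, (O^T *m O) i i <= 1) ->
  \sum_l (O^T *m y) l 0 ^+ 2 <= mxdot y y.
Proof.
move=> Ooff Odiag; set c := O^T *m y.
have cE : \sum_l c l 0 ^+ 2 = mxdot c c.
  by rewrite mxdot_sqr; apply: eq_bigr => l _; rewrite big_ord1.
have H := mxdot_ge0 (y - O *m c).
have yO : mxdot y (O *m c) = mxdot c c by rewrite mxdotC mxdot_mull mxdotC.
have OO : mxdot (O *m c) (O *m c) <= mxdot c c.
  rewrite mxdot_mull mulmxA -cE mxdotE; apply: ler_sum => l _.
  rewrite big_ord1 [(_ *m c) l 0]mxE (bigD1 l) //= big1 ?addr0 => [|k kl]; last first.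
    by rewrite Ooff ?mul0r// eq_sym.
  by rewrite mulrCA -expr2 -[leRHS]mul1r ler_wpM2r ?sqr_ge0.
move: H; rewrite !mxdot_lin (mxdotC (O *m c) y) yO cE; lra.
Qed.

Lemma mulmx_colE (m n k : nat) (A : 'M[R]_(m, n)) (B : 'M[R]_(n, k)) i j :
  (A *m col j B) i 0 = (A *m B) i j.
Proof. by rewrite !mxE; apply: eq_bigr => l _; rewrite mxE. Qed.

Lemma mxdot_col (m n : nat) (A B : 'M[R]_(m, n)) i j :
  mxdot (col i A) (col j B) = (A^T *m B) i j.
Proof. by rewrite mxdotE mxE; apply: eq_bigr => k _; rewrite big_ord1 !mxE. Qed.

(** After normalizing the columns of Y, the squared entries of O^T Y have row and column sums at
    most 1 by Bessel's inequality applied on either side, so [substochastic_rearrangement]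
    applies. *)
Lemma von_neumann_trace (n m r : nat) (O : 'M[R]_(n, m)) (Y : 'M[R]_(n, r))
    (s a : nat -> R) :
  O^T *m O = 1%:M ->
  (forall i j, i != j -> (Y^T *m Y) i j = 0) ->
  (forall j : 'I_r, (Y^T *m Y) j j = a j) ->
  (forall k, a k.+1 <= a k) -> (forall k, (r <= k)%N -> a k = 0) ->
  (forall k, s k.+1 <= s k) -> (forall k, 0 <= s k) ->
  \sum_(j < r) \sum_(l < m) s l * (O^T *m Y) l j ^+ 2 <= \sum_(j < r) a j * s j.
Proof.
move=> O1 Yoff Ydiag adec a0 sdec s0.
have age0 (j : 'I_r) : 0 <= a j.
  by rewrite -Ydiag mxE; apply: sumr_ge0 => k _; rewrite mxE -expr2 sqr_ge0.
(* Division by 0 gives 0, so a zero column stays zero. *)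
pose Yh : 'M[R]_(n, r) := \matrix_(i, j) (Y i j / Num.sqrt (a j)).
have YYh i j : (Yh^T *m Yh) i j
    = (Y^T *m Y) i j / (Num.sqrt (a i) * Num.sqrt (a j)).
  rewrite !mxE mulr_suml; apply: eq_bigr => k _; rewrite !mxE invfM; ring.
have Yhoff i j : i != j -> (Yh^T *m Yh) i j = 0.
  by move=> ij; rewrite YYh Yoff// mul0r.
have Yhdiag i : (Yh^T *m Yh) i i <= 1.
  rewrite YYh Ydiag -expr2 sqr_sqrtr//.
  have [->|ai] := eqVneq (a i) 0; first by rewrite mul0r.
  by rewrite divff.
have YhY i j : Y i j = Yh i j * Num.sqrt (a j).
  rewrite mxE; have [aj|aj] := eqVneq (a j) 0; last first.
    by rewrite divfK// sqrtr_eq0 -ltNge lt_def aj age0.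
  rewrite aj sqrtr0 mulr0.
  have := Ydiag j; rewrite aj mxE => H.
  have ge0 (k : 'I_n) : true -> 0 <= Y^T j k * Y k j.
    by rewrite mxE -expr2 sqr_ge0.
  have := psumr_eq0P ge0 H => /(_ i isT) /eqP.
  by rewrite mxE mulf_eq0 orbb => /eqP.
have OYh l j : (O^T *m Y) l j = (O^T *m Yh) l j * Num.sqrt (a j).
  by rewrite mxE [in RHS]mxE mulr_suml; apply: eq_bigr => k _; rewrite YhY mulrA.
have diag1 (k : nat) i : (1%:M : 'M[R]_k) i i <= 1 by rewrite mxE eqxx.
have off1 (k : nat) i j : i != j -> (1%:M : 'M[R]_k) i j = 0.
  by rewrite mxE => /negbTE ->.
have Obes (y : 'cV[R]_n) : \sum_l (O^T *m y) l 0 ^+ 2 <= mxdot y y.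
  by apply: bessel; rewrite O1; [exact: off1 | exact: diag1].
apply: le_trans (@substochastic_rearrangement r m a s
  (fun j l => (O^T *m Yh) l j ^+ 2) adec a0 sdec s0 _ _ _); last 3 first.
- by move=> j l; exact: sqr_ge0.
- move=> j; apply: le_trans (Yhdiag j); rewrite -mxdot_col.
  under eq_bigr do rewrite -mulmx_colE.
  exact: Obes.
- move=> l; have := bessel (col l O) Yhoff Yhdiag.
  rewrite mxdot_col O1 mxE eqxx; congr (_ <= _); apply: eq_bigr => j _.
  by rewrite mulmx_colE -[in RHS](trmxK (O^T *m Yh)) [in RHS]mxE trmx_mul trmxK.
apply: ler_sum => j _; apply: ler_sum => l _.
by rewrite OYh exprMn sqr_sqrtr//; lra.
Qed.

Lemma mxdot_outer (m n k l : nat) (A : 'M[R]_(m, k)) (B : 'M[R]_(n, k))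
    (C : 'M[R]_(m, l)) (D : 'M[R]_(n, l)) :
  mxdot (A *m B^T) (C *m D^T) = mxdot (C^T *m A) (D^T *m B).
Proof.
rewrite /mxdot !trmx_mul !trmxK -[B *m A^T *m _]mulmxA [LHS]mxtrace_mulC.
by rewrite !mulmxA.
Qed.

Lemma mxdot_cols (m n r : nat) (A : 'M[R]_(m, n)) (Z : 'M[R]_(m, r))
    (Y : 'M[R]_(n, r)) :
  mxdot Z (A *m Y) = \sum_j mxdot (col j Z) (A *m col j Y).
Proof.
rewrite mxdotE exchange_big /=; apply: eq_bigr => j _.
by rewrite mxdotE; apply: eq_bigr => i _; rewrite big_ord1 mulmx_colE [col _ _ _ _]mxE.
Qed.

Lemma psd_trace_ge0 (n r : nat) (A : 'M[R]_r) (D : 'M[R]_(n, r)) :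
  (forall v : 'cV[R]_r, 0 <= mxdot v (A *m v)) -> 0 <= mxdot A (D^T *m D).
Proof.
move=> Apsd; have -> : mxdot A (D^T *m D) = mxdot D^T (A *m D^T).
  by rewrite mxdotC mxdot_mulr.
by rewrite mxdot_cols sumr_ge0.
Qed.

(** Symmetry of X^T U makes T = U^T D symmetric, whence |E|^2 = 2 g + 2 |T|^2 + 4 <T, W> + |W|^2
    with g = |U D^T|^2, while positivity says g + <T, W> >= 0. Each bound is a multiple of this
    inequality plus a multiple of |W + c T|^2 >= 0, with c = 2 and c = 8/5. *)
Lemma aligned_error_bounds (n r : nat) (X U : 'M[R]_(n, r)) :
  (X^T *m U)^T = X^T *m U ->
  (forall v : 'cV[R]_r, 0 <= mxdot v (X^T *m U *m v)) ->
  let D := X - U in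
  let E := X *m X^T - U *m U^T in
  mxdot (D *m D^T) (D *m D^T) <= 2 * mxdot E E /\
  mxdot (U *m D^T) (U *m D^T) / 2 + mxdot (D *m D^T) (D *m D^T) / 5 <= mxdot E E.
Proof.
move=> XUsym XUpsd D E.
set W := D^T *m D; set T := U^T *m D.
have DE : X = U + D by rewrite /D addrC subrK.
have XUE : X^T *m U = U^T *m U + T.
  by rewrite -XUsym trmx_mul trmxK DE mulmxDr.
have Tsym : T^T = T.
  apply: (addrI (U^T *m U)); rewrite -XUE -[in RHS]XUsym XUE linearD /=.
  by rewrite [(U^T *m U)^T]trmx_mul trmxK.
have Tsym' : D^T *m U = T by rewrite -[RHS]Tsym trmx_mul trmxK.
have EE : E = U *m D^T + D *m U^T + D *m D^T.
  rewrite /E {1 2}DE linearD /= mulmxDl !mulmxDr.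
  by apply/matrixP => i j; rewrite !mxE; lra.
have PW := psd_trace_ge0 D XUpsd; rewrite XUE mxdotDl -/W in PW.
have W0 := mxdot_ge0 (W + 2 *: T); have W1 := mxdot_ge0 (W + (8 / 5) *: T).
have G0 := mxdot_ge0 (U *m D^T).
move: W0 W1 G0; rewrite EE !mxdot_lin !mxdot_outer Tsym' -/T -/W.
rewrite (mxdotC W T) (mxdotC W (U^T *m U)); move: PW (mxdot_ge0 W).
move: (mxdot (U^T *m U) W) (mxdot T W) (mxdot T T) (mxdot W W) => g tw tt ww.
by move=> ? ? ? ? ?; split; lra.
Qed.

(* The decomposition D D^T = Y Y^T with orthogonal columns Y replaces the
   singular value decomposition of D. *)
Lemma orthogonal_columns (n r : nat) (D : 'M[R]_(n, r)) :
  exists (V : 'M[R]_r) (a : nat -> R), [/\ V *m V^T = 1%:M,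
    forall i j, i != j -> ((D *m V)^T *m (D *m V)) i j = 0,
    forall j : 'I_r, ((D *m V)^T *m (D *m V)) j j = a j,
    forall k, a k.+1 <= a k & forall k, (r <= k)%N -> a k = 0].
Proof.
have Wsym : (D^T *m D)^T = D^T *m D by rewrite trmx_mul trmxK.
have [V [V1 Voff Vsort]] := sorted_diagonalization Wsym.
have E : (D *m V)^T *m (D *m V) = V^T *m (D^T *m D) *m V.
  by rewrite trmx_mul !mulmxA.
pose a k := if insub k is Some j then (V^T *m (D^T *m D) *m V) j j else 0.
have aE (j : 'I_r) : a j = (V^T *m (D^T *m D) *m V) j j by rewrite /a valK.
have a0 k : (r <= k)%N -> a k = 0.
  by move=> rk; rewrite /a insubN// -leqNgt.
have age0 (j : 'I_r) : 0 <= a j.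
  by rewrite aE -E mxE; apply: sumr_ge0 => k _; rewrite mxE -expr2 sqr_ge0.
exists V, a; split=> [|i j ij|j|k|//]; first exact: mulmx1C.
- by rewrite E Voff.
- by rewrite E aE.
- have [kr|rk] := ltnP k.+1 r.
    have := Vsort (Ordinal (ltnW kr)) (Ordinal kr) (leqnSn k).
    by rewrite -!aE.
  rewrite (a0 k.+1)//; have [kr|rk'] := ltnP k r; first exact: (age0 (Ordinal kr)).
  by rewrite a0.
Qed.

(** Duality of spectral and nuclear norm at rank r: bound column by column, then apply
    Cauchy-Schwarz over the r columns. When Y has orthogonal columns, [mxdot_outer_diag] identifies
    the last factor with |Z Y^T|. *)
Lemma spec_nuclear (n r : nat) (A : 'M[R]_n) (Z Y : 'M[R]_(n, r)) :
  mxdot A (Z *m Y^T) <= spectral_norm A * Num.sqrt r%:R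
    * Num.sqrt (\sum_j (Z^T *m Z) j j * (Y^T *m Y) j j).
Proof.
have diag0 (B : 'M[R]_(n, r)) j : 0 <= (B^T *m B) j j.
  by rewrite -mxdot_col mxdot_ge0.
have -> : mxdot A (Z *m Y^T) = \sum_j mxdot (col j Z) (A *m col j Y).
  by rewrite mxdotC mxdot_mulr trmxK mxdot_cols.
apply: (@le_trans _ _ (\sum_j spectral_norm A *
    Num.sqrt ((Z^T *m Z) j j * (Y^T *m Y) j j))).
  apply: ler_sum => j _; apply: le_trans (mxdot_le_frob _ _) _.
  rewrite sqrtrM// -!mxdot_col -!frobE mulrCA ler_wpM2l ?frob_ge0//.
  exact: spec_normP.
rewrite -mulr_sumr -mulrA ler_wpM2l ?spec_norm_ge0//.
under eq_bigr do rewrite -[Num.sqrt _]mul1r.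
apply: le_trans (sum_cauchy _ _) _.
rewrite [X in Num.sqrt X * _](_ : _ = r%:R); last first.
  by under eq_bigr do rewrite expr1n; rewrite sumr_const card_ord.
by under eq_bigr do rewrite sqr_sqrtr ?mulr_ge0//.
Qed.

Lemma mxdot_outer_diag (n r : nat) (Z Y : 'M[R]_(n, r)) :
  (forall i j, i != j -> (Y^T *m Y) i j = 0) ->
  mxdot (Z *m Y^T) (Z *m Y^T) = \sum_j (Z^T *m Z) j j * (Y^T *m Y) j j.
Proof.
move=> Yoff; rewrite mxdot_outer mxdotE; apply: eq_bigr => j _.
rewrite (bigD1 j) //= big1 ?addr0// => k kj.
by rewrite Yoff ?mulr0// eq_sym.
Qed.

End TraceInequalities.

(** * Second-order conditions *)

Section LocalMinima.
Context {R : realType}.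

Lemma local_minimum_line (n r : nat) (f : 'M[R]_(n, r) -> R)
    (X Z : 'M[R]_(n, r)) : local_minimum f X ->
  exists2 e : R, 0 < e & forall t, `|t| <= e -> f X <= f (X + t *: Z).
Proof.
rewrite /local_minimum => /nbhs_ballP[/= e e0 He].
pose c : R := 1 + \sum_i \sum_j `|Z i j|.
have Zc i j : `|Z i j| < c.
  rewrite /c (bigD1 i) //= (bigD1 j) //=.
  have h1 : 0 <= \sum_(k | k != j) `|Z i k| by apply: sumr_ge0.
  have h2 : 0 <= \sum_(l | l != i) \sum_k `|Z l k|.
    by apply: sumr_ge0 => ? _; apply: sumr_ge0.
  lra.
have c0 : 0 < c.
  have : 0 <= \sum_i \sum_j `|Z i j| by apply: sumr_ge0 => ? _; apply: sumr_ge0.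
  rewrite /c; lra.
exists (e / c); first by rewrite divr_gt0.
move=> t te; apply: He; split=> // i j.
rewrite /ball /= !mxE opprD addrA subrr add0r normrN normrM.
have [->|t0] := eqVneq t 0; first by rewrite normr0 mul0r.
apply: (@lt_le_trans _ _ (`|t| * c)); first by rewrite ltr_pM2l ?normr_gt0.
by rewrite -ler_pdivlMr.
Qed.

(** The hypothesis forces a = 0 and b >= 0. The combination 2 b - 4 a is the one in which the cross
    terms cancel in [sdot_second]. *)
Lemma second_order_ge0 (a b k e : R) : 0 < e ->
  (forall t, `|t| <= e -> 0 <= a * t + b * t ^+ 2 + k * `|t| ^+ 3) ->
  0 <= 2 * b - 4 * a.
Proof.
move=> e0 H.
have a0 : - (a * e) = 0.
  apply: (@linear_le_quadratic _ _ (`|b| * e ^+ 2 + `|k| * e ^+ 3)) => x x1.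
  have xe : `|x * e| <= e by rewrite normrM (gtr0_norm e0) -[leRHS]mul1r ler_pM2r.
  have := H _ xe; rewrite normrM (gtr0_norm e0) !exprMn.
  have h1 : b * (x ^+ 2 * e ^+ 2) <= `|b| * (x ^+ 2 * e ^+ 2).
    by rewrite ler_wpM2r ?ler_norm// mulr_ge0// sqr_ge0.
  have h2 : k * (`|x| ^+ 3 * e ^+ 3) <= `|k| * (x ^+ 2 * e ^+ 3).
    apply: (@le_trans _ _ (`|k| * (`|x| ^+ 3 * e ^+ 3))).
      by rewrite ler_wpM2r ?ler_norm// mulr_ge0// exprn_ge0// ltW.
    have x32 : `|x| ^+ 3 <= x ^+ 2.
      rewrite exprS real_normK ?num_real//.
      by have := sqr_ge0 x; nra.
    by apply: ler_wpM2l => //; apply: ler_wpM2r => //; rewrite exprn_ge0// ltW.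
  lra.
have {a0}a0 : a = 0 by apply/eqP; move/eqP: a0; rewrite oppr_eq0 mulf_eq0 (gt_eqF e0) orbF.
subst a.
rewrite mulr0 subr0 pmulr_rge0// leNgt; apply/negP => b0.
pose d := 2 * (`|k| + 1); have d0 : 0 < d by rewrite /d; have := normr_ge0 k; lra.
(* At this t the cubic term is at most half of the negative quadratic one. *)
pose t := Num.min e (- b / d).
have bd : 0 < - b / d by rewrite divr_gt0// oppr_gt0.
have t0 : 0 < t by rewrite lt_min e0.
have te : t <= e by rewrite ge_min lexx.
have tb : t * d <= - b by rewrite -ler_pdivlMr// ge_min lexx orbT.
have := H t; rewrite (gtr0_norm t0) => /(_ te).
have kt : k * t <= - b / 2.
  have : k * t <= `|k| * t by rewrite ler_wpM2r ?ler_norm// ltW.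
  rewrite /d in tb; lra.
have : 0 < t ^+ 2 by rewrite exprn_gt0.
have : k * t ^+ 3 = t ^+ 2 * (k * t) by ring.
nra.
Qed.

(** The third Taylor polynomial dominates on the whole domain: its square minus 1 + y is y^4 ((y -
    2)^2 + 16) / 256. This yields an upper expansion of a Euclidean norm along a line. *)
Lemma sqrt_cubic_bound (y : R) : 0 <= 1 + y ->
  Num.sqrt (1 + y) <= 1 + y / 2 - y ^+ 2 / 8 + y ^+ 3 / 16.
Proof.
move=> y1; set P := (X in _ <= X).
have P0 : 0 <= P.
  rewrite /P; have := sqr_ge0 (y - 1); have := sqr_ge0 (y - 2); have := sqr_ge0 y; nra.
rewrite -[P]ger0_norm// -sqrtr_sqr ler_sqrt ?sqr_ge0// -subr_ge0.
have -> : P ^+ 2 - (1 + y) = y ^+ 4 * (5 / 64 - y / 64 + y ^+ 2 / 256).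
  by rewrite /P; field.
rewrite mulr_ge0 ?exprn_even_ge0//; have := sqr_ge0 (y - 2); lra.
Qed.

(** Closure under sums and products keeps the remainders implicit; only the existence of a cubic
    bound matters for [second_order_ge0]. *)
Definition bounded1 (F : R -> R) :=
  exists2 K, 0 <= K & forall t, `|t| <= 1 -> `|F t| <= K.

Lemma bounded1_cst c : bounded1 (fun=> c).
Proof. by exists `|c|. Qed.

Lemma bounded1_id : bounded1 id.
Proof. by exists 1. Qed.

Lemma bounded1D F G : bounded1 F -> bounded1 G -> bounded1 (fun t => F t + G t).
Proof.
move=> [K K0 FK] [L L0 GL]; exists (K + L); first exact: addr_ge0.
by move=> t t1; apply: le_trans (ler_normD _ _) _; rewrite lerD ?FK ?GL.
Qed.

Lemma bounded1M F G : bounded1 F -> bounded1 G -> bounded1 (fun t => F t * G t).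
Proof.
move=> [K K0 FK] [L L0 GL]; exists (K * L); first exact: mulr_ge0.
by move=> t t1; rewrite normrM ler_pM ?FK ?GL.
Qed.

Lemma pos_part_le (x y : R) : x <= y -> pos_part x <= pos_part y.
Proof. by move=> xy; rewrite /pos_part ge_max !le_max xy lexx orbT. Qed.

Lemma pos_part_ge0 (x : R) : 0 <= pos_part x.
Proof. by rewrite /pos_part le_max lexx orbT. Qed.

Lemma pos_part_id (x : R) : 0 <= x -> pos_part x = x.
Proof. by rewrite /pos_part; case: ltgtP. Qed.

Lemma pos_part_eq0 (x : R) : x <= 0 -> pos_part x = 0.
Proof. by rewrite /pos_part; case: ltgtP. Qed.

Lemma pos_part_exp4 (x : R) : pos_part x ^+ 4 <= x ^+ 4.
Proof.
have [x0|/ltW x0] := leP 0 x; first by rewrite pos_part_id.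
by rewrite pos_part_eq0// expr0n /= exprn_even_ge0.
Qed.

Lemma frob_addZ (n r : nat) (x z : 'M[R]_(n, r)) (t : R) :
  frobenius_norm (x + t *: z) =
  Num.sqrt (mxdot x x + 2 * t * mxdot x z + t ^+ 2 * mxdot z z).
Proof. by rewrite frobE !mxdot_lin (mxdotC z x); congr Num.sqrt; ring. Qed.

(** Here s = |x|, c = <x, z> / s, t2 = |x - z|^2 and Z = |z|^2; the left side is 2 b - 4 a for (|x +
    t z| - al)^4. Since x - z is small, c and sqrt Z are close to s and the leading part is 12 h^2
    c^2 - 16 h^3 c. *)
Lemma regularizer_numeric (s al c t2 h Z : R) :
  0 <= al -> al <= s -> 0 < s -> (s - c) ^+ 2 <= t2 -> 100 ^+ 2 * t2 <= al ^+ 2 ->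
  h = s - al -> Z = t2 - s ^+ 2 + 2 * s * c ->
  2 * (6 * h ^+ 2 * c ^+ 2 + 4 * h ^+ 3 * ((Z - c ^+ 2) / (2 * s)))
    - 4 * (4 * h ^+ 3 * c) <= - Z ^+ 2 + 130 * 100 * al ^+ 2 * Z.
Proof.
move=> al0 als s0 sc t2al hE ZE0.
have sc1 : (100 * (s - c)) ^+ 2 <= al ^+ 2.
  by rewrite exprMn; apply: le_trans t2al; apply: ler_wpM2l; rewrite ?exprn_ge0.
have {sc1}: `|100 * (s - c)| <= `|al|.
  by rewrite -(@ler_pXn2r _ 2) ?nnegrE// !real_normK ?num_real.
rewrite (ger0_norm al0) ler_norml => /andP[sc1 sc2].
have c1 : 99 * s <= 100 * c by lra.
have c2 : 100 * c <= 101 * s by lra.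
have h0 : 0 <= h by lra.
have hs : h <= s by lra.
have t20 : 0 <= t2 by apply: le_trans sc; exact: sqr_ge0.
have ZE : Z = c ^+ 2 + (t2 - (s - c) ^+ 2) by rewrite ZE0; ring.
have s2 : al ^+ 2 <= s ^+ 2 by rewrite ler_pXn2r ?nnegrE// ltW.
have Z1 : 98 / 100 * s ^+ 2 <= Z by rewrite ZE; nra.
have Z2 : Z <= 102 / 100 * s ^+ 2 + s ^+ 2 / (10 * 100) by rewrite ZE; have := sqr_ge0 (s - c); nra.
have Zsq : Z ^+ 2 <= 105 / 100 * s ^+ 4.
  have -> : s ^+ 4 = s ^+ 2 * s ^+ 2 by ring.
  have := sqr_ge0 s; nra.
have term2 : 8 * h ^+ 3 * ((Z - c ^+ 2) / (2 * s)) <= al ^+ 2 * s ^+ 2 / (10 * 100).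
  have -> : 8 * h ^+ 3 * ((Z - c ^+ 2) / (2 * s)) = h ^+ 3 * (4 * (Z - c ^+ 2) / s).
    by field; rewrite gt_eqF.
  have q0 : 4 * (Z - c ^+ 2) / s <= al ^+ 2 / ((10 * 100) * s).
    rewrite ler_pdivrMr// ; have -> : al ^+ 2 / ((10 * 100) * s) * s = al ^+ 2 / (10 * 100).
      by field; rewrite gt_eqF.
    rewrite ZE; have := sqr_ge0 (s - c); lra.
  apply: (@le_trans _ _ (h ^+ 3 * (al ^+ 2 / ((10 * 100) * s)))).
    by rewrite ler_wpM2l// exprn_ge0.
  apply: (@le_trans _ _ (s ^+ 3 * (al ^+ 2 / ((10 * 100) * s)))).
    apply: ler_wpM2r; last by apply: lerXn2r; rewrite ?nnegrE// ltW.
    by apply: divr_ge0; [exact: sqr_ge0 | lra].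
  have -> : s ^+ 3 * (al ^+ 2 / ((10 * 100) * s)) = al ^+ 2 * s ^+ 2 / (10 * 100).
    by field; rewrite gt_eqF.
  exact: lexx.
have main : 12 * h ^+ 2 * c ^+ 2 - 16 * h ^+ 3 * c = (4 * h ^+ 2 * c) * (3 * c - 4 * h).
  by ring.
have k0 : 0 <= 4 * h ^+ 2 * c by rewrite mulr_ge0 ?mulr_ge0 ?sqr_ge0//; lra.
clear sc t2al sc1 sc2 ZE0.
suff : (4 * h ^+ 2 * c) * (3 * c - 4 * h) + al ^+ 2 * s ^+ 2 / (10 * 100) + 105 / 100 * s ^+ 4
   <= 130 * 100 * al ^+ 2 * Z by lra.
have s2al : 0 <= al ^+ 2 * (Z - 98 / 100 * s ^+ 2) by rewrite mulr_ge0 ?sqr_ge0//; lra.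
have s4 : s ^+ 4 = s ^+ 2 * s ^+ 2 by ring.
(* If s >= 100 al then h is close to s, and 12 - 16 = -4 beats Z^2, which is about s^4. Otherwise
   all terms are at most multiples of al^2 s^2; the bound s^4 <= 100^2 al^2 s^2 is what makes 130 *
   100 this large. *)
have [big|small] := lerP (100 * al) s.
  have d1 : 3 * c - 4 * h <= - (92 / 100) * s by lra.
  have d2 : 388 / 100 * s ^+ 3 <= 4 * h ^+ 2 * c.
    have hh : (99 / 100 * s) ^+ 2 <= h ^+ 2.
      by rewrite ler_pXn2r ?nnegrE//; lra.
    have h3 : (99 / 100 * s) ^+ 2 * (99 / 100 * s) <= h ^+ 2 * c.
      by apply: ler_pM => //; rewrite ?sqr_ge0//; lra.
    have : 0 < s ^+ 3 by rewrite exprn_gt0.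
    have -> : s ^+ 3 = s ^+ 2 * s by ring.
    lra.
  have d3 : (4 * h ^+ 2 * c) * (3 * c - 4 * h)
      <= (388 / 100 * s ^+ 3) * (- (92 / 100) * s).
    nra.
  have -> : s ^+ 4 = s ^+ 3 * s by ring.
  have : 0 < s ^+ 3 * s by rewrite mulr_gt0// exprn_gt0.
  have : al ^+ 2 * s ^+ 2 <= s ^+ 3 * s.
    have -> : s ^+ 3 * s = s ^+ 2 * s ^+ 2 by ring.
    by rewrite ler_wpM2r// sqr_ge0.
  have : 0 <= al ^+ 2 * Z by rewrite mulr_ge0 ?sqr_ge0//; have := sqr_ge0 s; lra.
  lra.
have d1 : 3 * c - 4 * h <= 4 * al by lra.
have d2 : 4 * h ^+ 2 * c <= 4 * s ^+ 2 * (101 / 100 * s).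
  by apply: ler_pM; rewrite ?mulr_ge0 ?sqr_ge0 ?ler_wpM2l ?ler_pXn2r ?nnegrE//; lra.
have d3 : (4 * h ^+ 2 * c) * (3 * c - 4 * h) <= (4 * s ^+ 2 * (101 / 100 * s)) * (4 * al).
  apply: (@le_trans _ _ ((4 * h ^+ 2 * c) * (4 * al))); first by rewrite ler_wpM2l.
  by rewrite ler_wpM2r//; lra.
have d4 : s ^+ 2 * (s * al) <= s ^+ 2 * (100 * al ^+ 2).
  by rewrite ler_wpM2l ?sqr_ge0//; nra.
have d5 : s ^+ 2 * s ^+ 2 <= s ^+ 2 * (100 * 100 * al ^+ 2).
  have ss : s * s <= (100 * al) * (100 * al).
    by move: small s0; clear => ? ?; apply: ler_pM; lra.
  by apply: ler_wpM2l; [exact: sqr_ge0 | move: ss; clear; lra].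
have d6 : 0 <= al ^+ 2 * s ^+ 2 by rewrite mulr_ge0 ?sqr_ge0.
move: d3 d4 d5 d6 s2al; rewrite s4; clear; lra.
Qed.

End LocalMinima.

(** * Expansion of the regularizer and of the objective along a line *)

Section SecondOrder.
Context {R : realType}.

Lemma bounded1_exp F n : bounded1 F -> bounded1 (fun t : R => F t ^+ n).
Proof.
move=> FB; elim: n => [|n IH]; first by under eq_fun do rewrite expr0; exact: bounded1_cst.
by under eq_fun do rewrite exprS; exact: bounded1M.
Qed.

Lemma quartic_taylor (h c d : R) (E : R -> R) : bounded1 E ->
  exists K, forall t, `|t| <= 1 ->
    (h + c * t + d * t ^+ 2 + E t * t ^+ 3) ^+ 4
    <= h ^+ 4 + (4 * h ^+ 3 * c * t
                 + (6 * h ^+ 2 * c ^+ 2 + 4 * h ^+ 3 * d) * t ^+ 2 + K * `|t| ^+ 3).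
Proof.
move=> BE; pose q t := c + (d * t + E t * t ^+ 2).
have Bq : bounded1 q.
  do 2 (apply: bounded1D; first by [apply: bounded1_cst | apply: bounded1M;
    [exact: bounded1_cst | exact: bounded1_id]]).
  by apply: bounded1M => //; apply: bounded1_exp; exact: bounded1_id.
pose rm t := 4 * h ^+ 3 * E t + (6 * h ^+ 2 * ((d + E t * t) * (c + q t))
   + (4 * h * q t ^+ 3 + t * q t ^+ 4)).
have Brm : bounded1 rm.
  apply: bounded1D; first exact: bounded1M (bounded1_cst _) BE.
  apply: bounded1D.
    apply: bounded1M; first exact: bounded1_cst.
    apply: bounded1M; apply: bounded1D => //; try exact: bounded1_cst.
    exact: bounded1M BE bounded1_id.
  apply: bounded1D; apply: bounded1M; try exact: bounded1_exp.
    exact: bounded1_cst.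
  exact: bounded1_id.
have [K K0 HK] := Brm; exists K => t t1.
have -> : (h + c * t + d * t ^+ 2 + E t * t ^+ 3) ^+ 4 =
    h ^+ 4 + (4 * h ^+ 3 * c * t
                 + (6 * h ^+ 2 * c ^+ 2 + 4 * h ^+ 3 * d) * t ^+ 2 + rm t * t ^+ 3).
  by rewrite /rm /q; ring.
rewrite lerD2l lerD2l; apply: le_trans (ler_norm _) _.
by rewrite normrM normrX ler_wpM2r ?exprn_ge0 ?HK.
Qed.

(** Three cases: the penalty vanishes near x, or x = z = 0 and it is constant, or the norm is smooth
    at x. The coefficients form one tuple so that [fin_all_exists] can choose them for all rows at
    once. *)
Lemma regularizer_taylor (r : nat) (x z : 'rV[R]_r) (al : R) :
  0 <= al -> 100 ^+ 2 * mxdot (x - z) (x - z) <= al ^+ 2 ->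
  exists abeK : R * R * R * R, let: (a, b, e, K) := abeK in
  [/\ 2 * b - 4 * a <= - mxdot z z ^+ 2 + 130 * 100 * al ^+ 2 * mxdot z z, 0 < e &
    forall t, `|t| <= e -> pos_part (frobenius_norm (x + t *: z) - al) ^+ 4
      <= pos_part (frobenius_norm x - al) ^+ 4
         + (a * t + b * t ^+ 2 + K * `|t| ^+ 3)].
Proof.
move=> al0 ual; set s := frobenius_norm x; set Z := mxdot z z.
set u := x - z in ual.
have s0 : 0 <= s := frob_ge0 _.
have Z0 : 0 <= Z := mxdot_ge0 _.
have un : 100 * frobenius_norm u <= al.
  rewrite -(@ler_pXn2r _ 2) ?nnegrE ?mulr_ge0 ?frob_ge0//.
  by rewrite exprMn frob_sqr.
have [sal|als] := ltP s al.
  (* Within this radius |x + t z| <= al, so the penalty stays 0. *)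
  exists (0, 0, (al - s) / (1 + frobenius_norm z), 0); split.
  - have zn : frobenius_norm z <= 101 / 100 * al.
      have -> : z = x + - u by rewrite /u opprB addrC subrK.
      have := frobD x (- u); rewrite frobN -/s; lra.
    have : Z <= (101 / 100 * al) ^+ 2.
      by rewrite /Z -frob_sqr lerXn2r ?nnegrE ?frob_ge0// (le_trans _ zn) ?frob_ge0.
    move=> ZZ; have : 0 <= Z * (130 * 100 * al ^+ 2 - Z).
      by apply: mulr_ge0 => //; have := sqr_ge0 al; lra.
    lra.
  - by rewrite divr_gt0 ?subr_gt0// ltr_wpDr ?frob_ge0.
  - move=> t te.
    have : frobenius_norm (x + t *: z) <= al.
      apply: le_trans (frobD _ _) _; rewrite frobZ -/s.
      move: te; rewrite ler_pdivlMr ?ltr_wpDr ?frob_ge0//.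
      by have := normr_ge0 t; lra.
    move=> H; have sal' : s - al <= 0 by lra.
    rewrite (pos_part_eq0 sal') pos_part_eq0 ?subr_le0// expr0n /=; lra.
have [s00|sn0] := eqVneq s 0.
  have a0 : al = 0 by lra.
  have z0 : z = 0.
    have x0 : x = 0 := frob_eq0 s00.
    have : frobenius_norm u = 0 by have := frob_ge0 u; lra.
    by move=> /frob_eq0; rewrite /u x0 sub0r => /eqP; rewrite oppr_eq0 => /eqP.
  exists (0, 0, 1, 0); split=> //.
    by rewrite /Z z0 mxdot0r expr0n /= !mulr0 subrr oppr0 addr0.
  by move=> t _; rewrite z0 scaler0 addr0 !mul0r !addr0 lexx.
have sp : 0 < s by rewrite lt_def sn0.
have s2 : mxdot x x = s ^+ 2 by rewrite -frob_sqr.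
set m := mxdot x z; pose c := m / s; pose h := s - al.
pose d := (Z - c ^+ 2) / (2 * s).
(* The terms of order three and more after substituting y = (2 t m + t^2 Z) / s^2 into s times the
   cubic of [sqrt_cubic_bound]. *)
pose E t := - (4 * m * Z + t * Z ^+ 2) / (8 * s ^+ 3)
  + (2 * m + t * Z) ^+ 3 / (16 * s ^+ 5).
have BE : bounded1 E.
  apply: bounded1D; apply: bounded1M; try exact: bounded1_cst.
    have -> : (fun t => - (4 * m * Z + t * Z ^+ 2)) = (fun t => - (4 * m * Z) + t * (- Z ^+ 2)).
      by apply/funext => t; ring.
    apply: bounded1D; first exact: bounded1_cst.
    exact: bounded1M bounded1_id (bounded1_cst _).
  apply: bounded1_exp; apply: bounded1D; first exact: bounded1_cst.
  exact: bounded1M bounded1_id (bounded1_cst _).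
have [K HK] := quartic_taylor h c d BE.
exists (4 * h ^+ 3 * c, 6 * h ^+ 2 * c ^+ 2 + 4 * h ^+ 3 * d, 1, K); split=> //.
- have mc : m = s * c by rewrite /c mulrC divfK.
  apply: (@regularizer_numeric _ s al c (mxdot u u) h Z) => //.
  + have -> : s - c = mxdot x u / s.
      rewrite /u !mxdot_lin s2 -/m mc; field; by rewrite gt_eqF.
    rewrite expr_div_n ler_pdivrMr ?exprn_gt0//.
    rewrite -(frob_sqr u) -exprMn -[leLHS]real_normK ?num_real//.
    rewrite lerXn2r ?nnegrE ?mulr_ge0 ?frob_ge0// mulrC.
    exact: norm_mxdot_le_frob.
  + by rewrite /u !mxdot_lin (mxdotC z x) -/m -/Z s2 mc; ring.
- move=> t t1; rewrite (pos_part_id (x := s - al)) ?subr_ge0//.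
  apply: le_trans (HK t t1) => {HK}.
  apply: le_trans (pos_part_exp4 _).
  rewrite lerXn2r ?nnegrE ?pos_part_ge0// pos_part_le// lerBlDr.
  rewrite frob_addZ -/m -/Z s2; pose y := (2 * t * m + t ^+ 2 * Z) / s ^+ 2.
  have s2p : 0 < s ^+ 2 by rewrite exprn_gt0.
  have -> : s ^+ 2 + 2 * t * m + t ^+ 2 * Z = s ^+ 2 * (1 + y).
    by rewrite /y; field; rewrite gt_eqF.
  have y1 : 0 <= 1 + y.
    rewrite -(pmulr_rge0 _ s2p).
    have -> : s ^+ 2 * (1 + y) = mxdot (x + t *: z) (x + t *: z).
      rewrite !mxdot_lin (mxdotC z x) -/m -/Z s2 /y; field; by rewrite gt_eqF.
    exact: mxdot_ge0.
  rewrite sqrtrM ?sqr_ge0// sqrtr_sqr ger0_norm//.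
  have -> : h + c * t + d * t ^+ 2 + E t * t ^+ 3 + al
      = s * (1 + y / 2 - y ^+ 2 / 8 + y ^+ 3 / 16).
    by rewrite /h /d /c /E /y; field; rewrite gt_eqF.
  by rewrite ler_wpM2l// sqrt_cubic_bound.
Qed.

(** The mask enters as a weight so that [sdot_split] can separate p from the deviation of the mask,
    in the form required by [spec_hadamard]. *)
Definition sdot (n : nat) (S : {set 'I_n * 'I_n}) (A B : 'M[R]_n) : R :=
  \sum_k \sum_l mask_mx S k l * A k l * B k l.

Lemma sdotE (n : nat) (S : {set 'I_n * 'I_n}) (A B : 'M[R]_n) :
  sdot S A B = mxdot (mask_proj S A) B.
Proof.
rewrite mxdotE; apply: eq_bigr => k _; apply: eq_bigr => l _.
by rewrite !mxE; case: ifP; rewrite ?mul1r ?mul0r.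
Qed.

Lemma frob_mask_proj (n : nat) (S : {set 'I_n * 'I_n}) (A : 'M[R]_n) :
  frobenius_norm (mask_proj S A) ^+ 2 = sdot S A A.
Proof.
rewrite frob_sqr mxdotE; apply: eq_bigr => k _; apply: eq_bigr => l _.
by rewrite !mxE; case: ifP; rewrite ?mul1r ?mul0r.
Qed.

Lemma sdotC (n : nat) (S : {set 'I_n * 'I_n}) (A B : 'M[R]_n) :
  sdot S A B = sdot S B A.
Proof. by apply: eq_bigr => k _; apply: eq_bigr => l _; rewrite mulrAC. Qed.

Lemma mask_projD (n : nat) (S : {set 'I_n * 'I_n}) (A B : 'M[R]_n) :
  mask_proj S (A + B) = mask_proj S A + mask_proj S B.
Proof. by apply/matrixP => i j; rewrite !mxE; case: ifP; rewrite ?addr0. Qed.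

Lemma mask_projZ (n : nat) (S : {set 'I_n * 'I_n}) a (A : 'M[R]_n) :
  mask_proj S (a *: A) = a *: mask_proj S A.
Proof. by apply/matrixP => i j; rewrite !mxE; case: ifP; rewrite ?mulr0. Qed.

Lemma sdotDl (n : nat) (S : {set 'I_n * 'I_n}) (A B C : 'M[R]_n) :
  sdot S (A + B) C = sdot S A C + sdot S B C.
Proof. by rewrite !sdotE mask_projD mxdotDl. Qed.

Lemma sdotZl (n : nat) (S : {set 'I_n * 'I_n}) a (A B : 'M[R]_n) :
  sdot S (a *: A) B = a * sdot S A B.
Proof. by rewrite !sdotE mask_projZ mxdotZl. Qed.

Lemma sdotNl (n : nat) (S : {set 'I_n * 'I_n}) (A B : 'M[R]_n) :
  sdot S (- A) B = - sdot S A B.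
Proof. by rewrite -scaleN1r sdotZl mulN1r. Qed.

Lemma sdotDr (n : nat) (S : {set 'I_n * 'I_n}) (A B C : 'M[R]_n) :
  sdot S A (B + C) = sdot S A B + sdot S A C.
Proof. by rewrite sdotC sdotDl !(sdotC S A). Qed.

Lemma sdotZr (n : nat) (S : {set 'I_n * 'I_n}) a (A B : 'M[R]_n) :
  sdot S A (a *: B) = a * sdot S A B.
Proof. by rewrite sdotC sdotZl sdotC. Qed.

Lemma sdotNr (n : nat) (S : {set 'I_n * 'I_n}) (A B : 'M[R]_n) :
  sdot S A (- B) = - sdot S A B.
Proof. by rewrite sdotC sdotNl sdotC. Qed.

Definition sdot_lin := (sdotDl, sdotDr, sdotNl, sdotNr, sdotZl, sdotZr).

(* If a t + b t^2 is the second-order expansion of the objective along X + t Z,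
   minimality gives a = 0 and b >= 0, used here as 2 b - 4 a >= 0. For the
   regularizer an upper expansion is enough. *)
Lemma completion_second_order (n r : nat) (S : {set 'I_n * 'I_n})
    (M B : 'M[R]_n) (al la : R) (X Z : 'M[R]_(n, r)) :
  local_minimum (completion_objective S M al la) X -> 0 <= al -> 0 <= la ->
  (forall i, 100 ^+ 2 * mxdot (row i X - row i Z) (row i X - row i Z) <= al ^+ 2) ->
  B = X *m Z^T + Z *m X^T ->
  0 <= sdot S B B + 2 * sdot S (X *m X^T - M) (Z *m Z^T)
       - 4 * sdot S (X *m X^T - M) B
       + la * \sum_i (- mxdot (row i Z) (row i Z) ^+ 2
                      + 130 * 100 * al ^+ 2 * mxdot (row i Z) (row i Z)).
Proof.
move=> locmin al0 la0 Hrow BE.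
have [A AE] : exists A, X *m X^T - M = A by eexists.
have [C CE] : exists C, Z *m Z^T = C by eexists.
rewrite AE CE.
have /fin_all_exists[q Hq] := fun i => regularizer_taylor al0 (Hrow i).
pose qa i := (q i).1.1.1; pose qb i := (q i).1.1.2.
pose qe i := (q i).1.2; pose qK i := (q i).2.
have {}Hq i : [/\ 2 * qb i - 4 * qa i <= - mxdot (row i Z) (row i Z) ^+ 2
       + 130 * 100 * al ^+ 2 * mxdot (row i Z) (row i Z), 0 < qe i &
    forall t, `|t| <= qe i -> pos_part (frobenius_norm (row i X + t *: row i Z) - al) ^+ 4
      <= pos_part (frobenius_norm (row i X) - al) ^+ 4
         + (qa i * t + qb i * t ^+ 2 + qK i * `|t| ^+ 3)].
  by have := Hq i; rewrite /qa /qb /qe /qK; case: (q i) => -[[a b] e] K.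
have [e0 e0p He0] := local_minimum_line Z locmin.
(* The radius 1 / w lies below 1, e0 and every qe i without taking a minimum over rows. *)
pose w := 1 + e0^-1 + \sum_i (qe i)^-1.
have qep i : 0 < (qe i)^-1 by rewrite invr_gt0; case: (Hq i).
have sq0 : 0 <= \sum_i (qe i)^-1 by apply: sumr_ge0 => i _; exact: ltW.
have e0i : 0 < e0^-1 by rewrite invr_gt0.
have w0 : 0 < w by rewrite /w; lra.
have we0 : w^-1 <= e0 by rewrite invf_ple ?posrE// /w; lra.
have w1 : w^-1 <= 1 by rewrite invf_ple ?posrE// invr1 /w; lra.
have wqe i : w^-1 <= qe i.
  have [_ qe0 _] := Hq i; rewrite invf_ple ?posrE//.
  apply: (@le_trans _ _ (\sum_i (qe i)^-1)); last by rewrite /w; lra.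
  by rewrite (bigD1 i) //= lerDl; apply: sumr_ge0 => k _; exact: ltW.
pose a := sdot S A B + la * \sum_i qa i.
pose b := (sdot S B B / 2 + sdot S A C) + la * \sum_i qb i.
pose K := (`|sdot S B C| + `|sdot S C C|) + la * \sum_i qK i.
have main : 0 <= 2 * b - 4 * a.
  apply: (@second_order_ge0 _ a b K (w^-1)); first by rewrite invr_gt0.
  move=> t tw; have := He0 t (le_trans tw we0).
  have t1 := le_trans tw w1.
  rewrite /completion_objective !frob_mask_proj.
  have -> : (X + t *: Z) *m (X + t *: Z)^T - M = A + t *: B + t ^+ 2 *: C.
    rewrite -AE BE -CE linearD /= linearZ /= mulmxDl !mulmxDr.
    rewrite -!scalemxAl -!scalemxAr scalerA -expr2 scalerDr.
    by apply/matrixP => i j; rewrite !mxE; lra.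
  rewrite AE !sdot_lin (sdotC S B A) (sdotC S C A) (sdotC S C B).
  set P := \sum_i pos_part (frobenius_norm (row i X) - al) ^+ 4.
  have : la * \sum_i pos_part (frobenius_norm (row i (X + t *: Z)) - al) ^+ 4
      <= la * (P + (t * \sum_i qa i + t ^+ 2 * \sum_i qb i
                    + `|t| ^+ 3 * \sum_i qK i)).
    rewrite ler_wpM2l// !mulr_sumr -!big_split /=; apply: ler_sum => i _.
    have [_ _] := Hq i => /(_ t (le_trans tw (wqe i))).
    by rewrite linearD /= linearZ /= => H; apply: le_trans H _; lra.
  have h1 : t ^+ 3 * sdot S B C <= `|t| ^+ 3 * `|sdot S B C|.
    by apply: le_trans (ler_norm _) _; rewrite normrM normrX.
  have h2 : t ^+ 4 * sdot S C C <= `|t| ^+ 3 * `|sdot S C C|.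
    apply: le_trans (ler_norm _) _; rewrite normrM normrX exprSr ler_wpM2r//.
    by rewrite -[leRHS]mulr1 ler_wpM2l ?exprn_ge0.
  have h3 : 0 <= `|t| ^+ 3 * `|sdot S C C| by rewrite mulr_ge0 ?exprn_ge0.
  have -> : t * (t ^+ 2 * sdot S B C) = t ^+ 3 * sdot S B C by ring.
  have -> : t ^+ 2 * (t ^+ 2 * sdot S C C) = t ^+ 4 * sdot S C C by ring.
  rewrite /a /b /K; clear -h1 h2 h3; lra.
apply: le_trans main _; rewrite /a /b.
have : la * \sum_i (2 * qb i - 4 * qa i) <= la * \sum_i
    (- mxdot (row i Z) (row i Z) ^+ 2
     + 130 * 100 * al ^+ 2 * mxdot (row i Z) (row i Z)).
  rewrite ler_wpM2l//; apply: ler_sum => i _; by case: (Hq i).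
rewrite [\sum_i (2 * qb i - 4 * qa i)]big_split /= sumrN -!mulr_sumr; lra.
Qed.

End SecondOrder.

(** * The deterministic error bound *)

Section SpectralFacts.
Context {R : realType}.

(** The lower bound is the upper one applied to s_k = d_0 - d_(r-1-k), which is again nonnegative
    and decreasing. The squared entries of an orthogonal matrix are exactly doubly stochastic, so
    the constant d_0 cancels. *)
Lemma von_neumann_trace_lower (r : nat) (H : 'M[R]_r) (d a : nat -> R) :
  H^T *m H = 1%:M ->
  (forall k, a k.+1 <= a k) -> (forall k, (r <= k)%N -> a k = 0) ->
  (forall k, d k.+1 <= d k) ->
  \sum_(j < r) a j * d (r - j.+1)%N <= \sum_(j < r) \sum_(i < r) a j * (d i * H i j ^+ 2).
Proof.
move=> H1 adec a0 ddec.
have ddecw : {homo d : i j / (i <= j)%N >-> j <= i}.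
  by apply: homo_leq => // x y z xy yz; apply: le_trans yz xy.
have H1' := mulmx1C H1.
have colsum j : \sum_i H i j ^+ 2 = 1.
  have : (H^T *m H) j j = 1 by rewrite H1 mxE eqxx.
  by rewrite mxE => <-; apply: eq_bigr => i _; rewrite mxE expr2.
have rowsum i : \sum_j H i j ^+ 2 = 1.
  have : (H *m H^T) i i = 1 by rewrite H1' mxE eqxx.
  by rewrite mxE => <-; apply: eq_bigr => j _; rewrite mxE expr2.
pose s k := d 0%N - d (r - k.+1)%N.
have := @substochastic_rearrangement R r r a s (fun j l => H (rev_ord l) j ^+ 2) adec a0.
have -> : \sum_j \sum_l H (rev_ord l) j ^+ 2 * (a j * s l)
    = d 0%N * \sum_(j < r) a j - \sum_(j < r) \sum_(i < r) a j * (d i * H i j ^+ 2).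
  rewrite mulr_sumr -sumrB; apply: eq_bigr => j _.
  rewrite -[d 0%N * a j]mul1r -(colsum j) mulr_suml -sumrB.
  rewrite [RHS](reindex_inj rev_ord_inj) /=; apply: eq_bigr => i _.
  by rewrite /s; ring.
have -> : \sum_(j < r) a j * s j
    = d 0%N * \sum_(j < r) a j - \sum_(j < r) a j * d (r - j.+1)%N.
  by rewrite mulr_sumr -sumrB; apply: eq_bigr => j _; rewrite /s; ring.
rewrite lerD2l lerN2; apply.
- by move=> k; rewrite /s lerD2l lerN2 ddecw// leq_sub2l.
- by move=> k; rewrite /s subr_ge0 ddecw.
- by move=> j l; exact: sqr_ge0.
- by move=> j; rewrite -(colsum j) [leRHS](reindex_inj rev_ord_inj).
- by move=> l; rewrite rowsum.
Qed.

Definition spectral_factor (n r : nat) (sigma : nat -> R) (u : nat -> 'cV[R]_n)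
  : 'M[R]_(n, r) := \matrix_(i, j) (Num.sqrt (sigma j.+1) * u j.+1 i 0).

Definition spectral_tail (n r : nat) (u : nat -> 'cV[R]_n) : 'M[R]_(n, n - r) :=
  \matrix_(i, l) u (r + l).+1 i 0.

Section Decomposition.
Variables (n r : nat) (M : 'M[R]_n) (sigma : nat -> R) (u : nat -> 'cV[R]_n).
Hypotheses (rn : (r <= n)%N) (Mdec : spectral_decomposition M sigma u).
Let Mr := spectral_truncation sigma u r.
Let N := M - Mr.
Let U := spectral_factor r sigma u.
Let O := spectral_tail r u.

Lemma sigma_ge0 k : 0 <= sigma k.+1.
Proof.
case: Mdec => _ s0 sn _ _; have [kn|nk] := leqP k.+1 n; first exact: s0.
by rewrite sn.
Qed.

Lemma sigma_dec k : sigma k.+2 <= sigma k.+1.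
Proof.
case: Mdec => sdec _ sn _ _; have [kn|nk] := leqP k.+2 n.
  by apply: sdec => //=.
by rewrite (sn k.+2)// sigma_ge0.
Qed.

Lemma u_orth i j : (i < n)%N -> (j < n)%N ->
  \sum_k u i.+1 k 0 * u j.+1 k 0 = (i == j)%:R.
Proof.
case: Mdec => _ _ _ uo _ ilt jlt; have := uo i.+1 j.+1; rewrite !ltnS /= => <- //.
by rewrite mxE; apply: eq_bigr => k _; rewrite mxE.
Qed.

Lemma truncation_factor : U *m U^T = Mr.
Proof.
rewrite /Mr /spectral_truncation big_add1 /= big_mkord.
apply/matrixP => i j; rewrite mxE summxE; apply: eq_bigr => k _.
rewrite !mxE big_ord1 !mxE mulrACA -expr2 sqr_sqrtr//; exact: sigma_ge0.
Qed.

Lemma factor_gram i j : (U^T *m U) i j = sigma j.+1 * (i == j)%:R.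
Proof.
rewrite mxE; under eq_bigr do rewrite !mxE mulrACA.
rewrite -mulr_sumr u_orth ?(leq_trans (ltn_ord _))//.
have [->|ij] := eqVneq i j; last by rewrite -val_eqE in ij; rewrite (negbTE ij) !mulr0.
by rewrite eqxx -expr2 sqr_sqrtr// sigma_ge0.
Qed.

Lemma tail_orth : O^T *m O = 1%:M.
Proof.
apply/matrixP => i j; rewrite !mxE; under eq_bigr do rewrite !mxE.
rewrite u_orth; first by rewrite eqn_add2l.
  by have := ltn_ord i; lia.
by have := ltn_ord j; lia.
Qed.

Lemma residualE : N = O *m diag_mx (\row_l sigma (r + l).+1) *m O^T.
Proof.
case: Mdec => _ _ _ _ ME; rewrite /N ME /Mr /spectral_truncation.
rewrite (@big_cat_nat _ _ _ r.+1) //= [X in X - _]addrC addrK -{1}[r.+1]add0n.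
have -> : n.+1 = ((n - r) + r.+1)%N by lia.
rewrite big_addn addnK big_mkord.
apply/matrixP => i j; rewrite mxE summxE; apply: eq_bigr => k _.
rewrite mul_mx_diag !mxE big_ord1 !mxE addnS addnC; ring.
Qed.

Lemma residual_sym : N^T = N.
Proof. by rewrite residualE !trmx_mul trmxK tr_diag_mx mulmxA. Qed.

Lemma tail_factor : O^T *m U = 0.
Proof.
apply/matrixP => i j; rewrite !mxE; under eq_bigr do rewrite !mxE mulrCA.
rewrite -mulr_sumr u_orth ?(leq_trans (ltn_ord _))//.
  by rewrite gtn_eqF ?mulr0// ltn_addr.
by have := ltn_ord i; lia.
Qed.

Lemma residual_factor : N *m U = 0.
Proof. by rewrite residualE -mulmxA tail_factor mulmx0. Qed.

Lemma residual_quadratic (m : nat) (Y : 'M[R]_(n, m)) :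
  mxdot N (Y *m Y^T) = \sum_(j < m) \sum_(l < n - r) sigma (r + l).+1 * (O^T *m Y) l j ^+ 2.
Proof.
rewrite residualE mxdot_outer mxdotE mulmxA.
apply: eq_bigr => j _; apply: eq_bigr => l _.
have -> : (Y^T *m O) = (O^T *m Y)^T by rewrite trmx_mul trmxK.
rewrite mul_mx_diag !mxE; ring.
Qed.

(** Squared row norms of U are diagonal entries of Mr; this is how the max norm of Mr controls the
    factor. *)
Lemma factor_row_le k : \sum_a U k a ^+ 2 <= linf_norm Mr.
Proof.
have -> : \sum_a U k a ^+ 2 = Mr k k.
  by rewrite -truncation_factor [RHS]mxE; apply: eq_bigr => a _; rewrite [_^T _ _]mxE expr2.
apply: le_trans (ler_norm _) _; rewrite linf_normE.
exact: (le_bigmax _ (fun ij : 'I_n * 'I_n => `|Mr ij.1 ij.2|) (k, k)).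
Qed.

End Decomposition.
End SpectralFacts.

(** * Sampled quadratic forms against their expectation *)

Section SampledError.
Context {R : realType}.

Lemma sdot_split (n : nat) (S : {set 'I_n * 'I_n}) (p : R) (A B : 'M[R]_n) :
  sdot S A B = p * mxdot A B
    + \sum_k \sum_l (mask_mx S - p *: const_mx 1) k l * A k l * B k l.
Proof.
rewrite mxdotE mulr_sumr -big_split; apply: eq_bigr => k _ /=.
rewrite mulr_sumr -big_split; apply: eq_bigr => l _ /=.
by rewrite !mxE; ring.
Qed.

Lemma sdot_tr (n : nat) (S : {set 'I_n * 'I_n}) (A B : 'M[R]_n) :
  (forall i j, ((i, j) \in S) = ((j, i) \in S)) ->
  sdot S A^T B^T = sdot S A B.
Proof.
move=> Ssym; rewrite /sdot exchange_big /=.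
by apply: eq_bigr => k _; apply: eq_bigr => l _; rewrite !mxE Ssym.
Qed.

Lemma absorb (c e x y : R) : 0 < e -> c * x * y <= e * y ^+ 2 + c ^+ 2 / (4 * e) * x ^+ 2.
Proof.
move=> e0; rewrite -subr_ge0.
have -> : e * y ^+ 2 + c ^+ 2 / (4 * e) * x ^+ 2 - c * x * y
   = e * (y - c / (2 * e) * x) ^+ 2 by field; rewrite gt_eqF.
by rewrite mulr_ge0 ?sqr_ge0// ltW.
Qed.

(** The scalar problem left for each index: over a >= 0 the left side is largest at a = 10 y when y
    >= 0, and at a = 0 otherwise. *)
Lemma quadratic_max (a y : R) : 0 <= a ->
  a * y - a ^+ 2 / 20 <= 5 * pos_part y ^+ 2.
Proof.
move=> a0; have [y0|y0] := leP 0 y.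
  by rewrite pos_part_id//; have := sqr_ge0 (a - 10 * y); lra.
have := mulr_ge0_le0 a0 (ltW y0); have := sqr_ge0 (pos_part y).
by have := sqr_ge0 a; lra.
Qed.

(** The loss p / 48 occurs for P and for P^T, which gives the p / 24 of [sampled_error_lower]. *)
Definition alignment_gap (n r : nat) (S : {set 'I_n * 'I_n}) (p kap : R)
    (U : 'M[R]_(n, r)) : Prop :=
  forall (l : 'I_n) (z : 'cV[R]_r),
    p * (47 / 48) * \sum_k (U *m z) k 0 ^+ 2
    <= \sum_k mask_mx S k l * (U *m z) k 0 ^+ 2 + kap * mxdot z z.

Section Sampling.
Variables (n r : nat) (S : {set 'I_n * 'I_n}) (p kap nu mu : R).
Variables (X U : 'M[R]_(n, r)).
Hypothesis Ssym : forall i j, ((i, j) \in S) = ((j, i) \in S).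
Hypothesis p0 : 0 < p.
Hypothesis kap0 : 0 <= kap.
Hypothesis gapU : alignment_gap S p kap U.
Hypothesis nuE : nu = spectral_norm (mask_mx S - p *: const_mx 1).
Hypothesis rowU : forall k, \sum_a U k a ^+ 2 <= mu.
Let D := X - U.
Let P := U *m D^T.
Let F := D *m D^T.
Let H := mask_mx S - p *: const_mx 1 : 'M[R]_n.
Let q (A B : 'M[R]_n) := \sum_k \sum_l H k l * A k l * B k l.
Let S4 := \sum_k (\sum_a D k a ^+ 2) ^+ 2.
Let E := X *m X^T - U *m U^T.
Let F2 := \sum_k (\sum_a D k a ^+ 2).

Lemma nu_ge0 : 0 <= nu. Proof. by rewrite nuE spec_norm_ge0. Qed.

Lemma sqrt_S4 : Num.sqrt (\sum_k (\sum_a D k a ^+ 2) * (\sum_b D k b ^+ 2)) ^+ 2 = S4.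
Proof.
rewrite sqr_sqrtr; first by apply: eq_bigr => k _; rewrite expr2.
by apply: sumr_ge0 => k _; rewrite mulr_ge0// sum_sqr_ge0.
Qed.

Lemma sqrt_UD : Num.sqrt (\sum_k (\sum_a U k a ^+ 2) * (\sum_b D k b ^+ 2)) ^+ 2 <= mu * F2.
Proof.
rewrite sqr_sqrtr; last by apply: sumr_ge0 => k _; rewrite mulr_ge0// sum_sqr_ge0.
by rewrite /F2 mulr_sumr; apply: ler_sum => k _; rewrite ler_wpM2r ?sum_sqr_ge0.
Qed.

Lemma q_FF_le : q F F <= nu * S4.
Proof.
have := spec_hadamard H D D D D; rewrite -/F -/(q F F) -nuE.
by rewrite -mulrA -expr2 sqrt_S4.
Qed.

Lemma q_FF_ge : - (nu * S4) <= q F F.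
Proof.
have := spec_hadamard (- H) D D D D; rewrite spec_normN -/F -nuE.
rewrite -mulrA -expr2 sqrt_S4 lerNl; apply: le_trans; rewrite /q -sumrN.
by apply: ler_sum => k _; rewrite -sumrN; apply: ler_sum => l _; rewrite [(- H) k l]mxE; lra.
Qed.

(** In U D^T against D U^T each side of the Hadamard bound carries |U_k|^2 |D_k|^2, which is linear
    in |D|^2 after bounding the rows of U. *)
Lemma q_PPt_ge : - (nu * (mu * F2)) <= q P P^T.
Proof.
have := spec_hadamard (- H) U D D U.
have -> : D *m U^T = P^T by rewrite /P trmx_mul trmxK.
rewrite -/P spec_normN -nuE => Hq.
rewrite lerNl; apply: le_trans (le_trans _ Hq) _.
  rewrite /q -sumrN; apply: ler_sum => k _; rewrite -sumrN; apply: ler_sum => l _.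
  by rewrite [(- H) k l]mxE; lra.
have -> : \sum_l (\sum_a D l a ^+ 2) * (\sum_b U l b ^+ 2)
    = \sum_k (\sum_a U k a ^+ 2) * (\sum_b D k b ^+ 2).
  by apply: eq_bigr => k _; rewrite mulrC.
by rewrite -mulrA -expr2 ler_wpM2l ?nu_ge0// sqrt_UD.
Qed.

(** The geometric mean of mu F2 and S4 is split by the arithmetic-geometric inequality. *)
Lemma q_PF_ge : - (nu * (mu * F2 + S4) / 2) <= q P F.
Proof.
have := spec_hadamard (- H) U D D D.
rewrite -/P -/F spec_normN -nuE => Hq.
rewrite lerNl; apply: le_trans (le_trans _ Hq) _.
  rewrite /q -sumrN; apply: ler_sum => k _; rewrite -sumrN; apply: ler_sum => l _.
  by rewrite [(- H) k l]mxE; lra.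
rewrite -!mulrA ler_wpM2l ?nu_ge0//.
have := sqrt_UD; have := sqrt_S4.
set x := Num.sqrt _; set y := Num.sqrt _ => <- xy.
have := sqr_ge0 (x - y); lra.
Qed.

(** Here [spec_hadamard] would separate the |U_k|^4 from the |D_k|^4; instead every column of P has
    the form U z with z a row of D, and [gapU] applies to each. *)
Lemma q_PP_ge : - (p / 48 * mxdot P P + kap * F2) <= q P P.
Proof.
have -> : q P P = sdot S P P - p * mxdot P P by rewrite (sdot_split S p) addrC addKr.
suff : p * (47 / 48) * mxdot P P <= sdot S P P + kap * F2 by lra.
have -> : F2 = \sum_l mxdot (col l D^T) (col l D^T).
  apply: eq_bigr => l _; rewrite mxdot_sqr; apply: eq_bigr => a _.
  by rewrite big_ord1 !mxE.
have -> : mxdot P P = \sum_l \sum_k (U *m col l D^T) k 0 ^+ 2.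
  rewrite mxdotE exchange_big; apply: eq_bigr => l _; apply: eq_bigr => k _.
  by rewrite mulmx_colE expr2.
have -> : sdot S P P = \sum_l \sum_k mask_mx S k l * (U *m col l D^T) k 0 ^+ 2.
  rewrite /sdot exchange_big; apply: eq_bigr => l _; apply: eq_bigr => k _.
  by rewrite mulmx_colE expr2 mulrA.
by rewrite mulr_sumr mulr_sumr -big_split /=; apply: ler_sum => l _; exact: gapU.
Qed.

(** With E = P + P^T + F one has q(E, E) = 2 q(P, P) + 2 q(P, P^T) + 4 q(P, F) + q(F, F); the
    multiplicities of the error terms come from this expansion. *)
Lemma sampled_error_lower :
  p * mxdot E E - (p / 24 * mxdot P P + 2 * kap * F2)
    - 4 * nu * (mu * F2) - 3 * nu * S4 <= sdot S E E.
Proof.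
have EE : E = P + P^T + F.
  rewrite /E /P /F trmx_mul trmxK.
  have -> : X = U + D by rewrite /D addrC subrK.
  rewrite linearD /= mulmxDl !mulmxDr; apply/matrixP => i j; rewrite !mxE; lra.
have tr A B : sdot S A^T B^T = sdot S A B := sdot_tr A B Ssym.
have Ft : F^T = F by rewrite /F trmx_mul trmxK.
have dd A B : sdot S A B - p * mxdot A B = q A B.
  by rewrite (sdot_split S p) addrC addKr.
have hPF := dd P F; have hFF := dd F F; have hPP := dd P P; have hPPt := dd P P^T.
have := q_PF_ge; have := q_FF_ge; have := q_PP_ge; have := q_PPt_ge.
rewrite -hPF -hFF -hPP -hPPt EE !mxdot_lin !sdot_lin.
have -> : sdot S P^T P = sdot S P P^T by rewrite sdotC.
have -> : sdot S P^T P^T = sdot S P P by rewrite tr.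
have -> : sdot S P^T F = sdot S P F by rewrite -[in LHS]Ft tr.
rewrite [sdot S F P]sdotC.
have -> : sdot S F P^T = sdot S P F by rewrite sdotC -[in LHS]Ft tr.
have -> : mxdot P^T P = mxdot P P^T by rewrite mxdotC.
have -> : mxdot P^T P^T = mxdot P P by rewrite mxdot_tr.
have -> : mxdot P^T F = mxdot P F by rewrite -[in LHS]Ft mxdot_tr.
rewrite [mxdot F P]mxdotC.
have -> : mxdot F P^T = mxdot P F by rewrite mxdotC -[in LHS]Ft mxdot_tr.
lra.
Qed.

End Sampling.
End SampledError.

(** * From the second-order condition to the eigenvalue bound *)

Section DeterministicBound.
Context {R : realType}.

Lemma pos_partZ (c x : R) : 0 <= c -> pos_part (c * x) = c * pos_part x.
Proof.
move=> c0; have [x0|x0] := leP 0 x.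
  by rewrite !pos_part_id// mulr_ge0.
rewrite (pos_part_eq0 (ltW x0)) mulr0 pos_part_eq0//.
exact: mulr_ge0_le0 c0 (ltW x0).
Qed.

Lemma outer_addE (n r : nat) (U D : 'M[R]_(n, r)) :
  (U + D) *m (U + D)^T - U *m U^T = U *m D^T + D *m U^T + D *m D^T.
Proof.
rewrite linearD /= mulmxDl !mulmxDr.
by rewrite addrC addrA (addrA (- _)) addNr add0r addrA.
Qed.

Lemma outer_derivE (n r : nat) (U D : 'M[R]_(n, r)) :
  (U + D) *m D^T + D *m (U + D)^T
  = U *m D^T + D *m U^T + D *m D^T + D *m D^T.
Proof. by rewrite linearD /= mulmxDl mulmxDr addrACA addrA. Qed.

(** The derivative of X X^T in direction D is E + F. With the weights of 2 b - 4 a the products of E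
    and F cancel, leaving only the two squares and the residual. *)
Lemma sdot_second (n : nat) (S : {set 'I_n * 'I_n}) (E F N : 'M[R]_n) :
  sdot S (E + F) (E + F) + 2 * sdot S (E - N) F - 4 * sdot S (E - N) (E + F)
  = sdot S F F - 3 * sdot S E E + 4 * sdot S N E + 2 * sdot S N F.
Proof. by rewrite !sdot_lin (sdotC S F E); ring. Qed.

Lemma deterministic_bound (n r : nat) (S : {set 'I_n * 'I_n}) (M : 'M[R]_n)
    (sigma : nat -> R) (u : nat -> 'cV[R]_n) (p kap c0 al la Dn : R)
    (X : 'M[R]_(n, r)) :
  let Mr := spectral_truncation sigma u r in
  let N := M - Mr in
  let nu := spectral_norm (mask_mx S - p *: const_mx 1) in
  let K := 6 * kap + (12 + c0) * (nu * linf_norm Mr) in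
  (r <= n)%N -> spectral_decomposition M sigma u ->
  (forall i j, ((i, j) \in S) = ((j, i) \in S)) ->
  0 < p -> 0 <= kap -> 130 * 100 * (200 * (200 * 200)) <= c0 ->
  alignment_gap S p kap (spectral_factor r sigma u) ->
  spectral_norm (mask_proj S N - p *: N) <= Dn ->
  100 * Num.sqrt (linf_norm Mr) <= al <= 200 * Num.sqrt (linf_norm Mr) ->
  100 * nu <= la <= 200 * nu ->
  local_minimum (completion_objective S M al la) X ->
  mxdot (X *m X^T - Mr) (X *m X^T - Mr)
    <= 10 / 256 * (\sum_(1 <= i < r.+1)
         pos_part (16 * (K / p) + 96 * sigma (2 * r + 1 - i)%N - sigma i) ^+ 2)
       + 872 * (Dn ^+ 2 * r%:R / p ^+ 2).
Proof.
move=> Mr N nu K rn Mdec Ssym p0 kap0 c0P gap0 Dnoise /andP[al1 al2]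
  /andP[la1 la2] locmin.
set mu := linf_norm Mr in al1 al2 K *.
have mu0 : 0 <= mu by exact: normr_ge0.
have nu0 : 0 <= nu by exact: spec_norm_ge0.
have al0 : 0 <= al by apply: le_trans al1; rewrite mulr_ge0 ?sqrtr_ge0.
have la0 : 0 <= la by apply: le_trans la1; rewrite mulr_ge0.
set U0 := spectral_factor r sigma u in gap0.
have U0E : U0 *m U0^T = Mr := truncation_factor r Mdec.
have [Q [Q1 KQsym KQpsd]] := polar_alignment (X^T *m U0).
have Q1' := mulmx1C Q1.
(* The rotation changes neither U U^T, nor the row norms, nor the gap property. *)
pose U := U0 *m Q.
have UE : U *m U^T = Mr.
  by rewrite /U trmx_mul mulmxA -(mulmxA U0) Q1' mulmx1.
have XU : X^T *m U0 *m Q = X^T *m U by rewrite /U mulmxA.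
rewrite XU in KQsym KQpsd.
have rowU k : \sum_a U k a ^+ 2 <= mu.
  have -> : \sum_a U k a ^+ 2 = \sum_a U0 k a ^+ 2.
    have sq (A : 'M[R]_(n, r)) : \sum_a A k a ^+ 2 = (A *m A^T) k k.
      by rewrite mxE; apply: eq_bigr => a _; rewrite mxE expr2.
    by rewrite !sq UE U0E.
  exact: (factor_row_le r Mdec).
have gapU : alignment_gap S p kap U.
  move=> l z; have := gap0 l (Q *m z).
  by rewrite mulmxA -/U mxdot_mull mulmxA Q1 mul1mx.
set D := X - U; set P := U *m D^T; set F := D *m D^T.
set E := X *m X^T - Mr.
have EU : E = X *m X^T - U *m U^T by rewrite UE.
have [eb1 eb2] := aligned_error_bounds KQsym KQpsd.
rewrite -EU -/D -/F -/P in eb1 eb2.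
have [V [a [V1 Yoff Ydiag adec a0]]] := orthogonal_columns D.
set Y := D *m V in Yoff Ydiag.
pose Zm := U *m V.
have PE : P = Zm *m Y^T.
  by rewrite /Zm /Y trmx_mul mulmxA -(mulmxA U) V1 mulmx1.
have FE : F = Y *m Y^T.
  by rewrite /Y trmx_mul mulmxA -(mulmxA D) V1 mulmx1.
have fE : mxdot F F = \sum_(j < r) a j ^+ 2.
  rewrite FE (mxdot_outer_diag _ Yoff); apply: eq_bigr => j _.
  by rewrite Ydiag expr2.
have trWE : mxdot D D = \sum_(j < r) a j.
  have -> : mxdot D D = mxdot Y Y by rewrite /Y mxdot_mulr -mulmxA V1 mulmx1.
  rewrite /mxdot /mxtrace; apply: eq_bigr => j _; exact: Ydiag.
have age0 k : 0 <= a k.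
  have [rk|kr] := leqP r k; first by rewrite a0.
  by rewrite -(Ydiag (Ordinal kr)) -mxdot_col mxdot_ge0.
(* Zm = U0 (Q V) with Q V orthogonal, so |P|^2 is a doubly stochastic average of the products a_j
   sigma_i; the least possible pairing matches the largest a_j with the smallest sigma_i. *)
have gE : \sum_(j < r) a j * sigma (r - j)%N <= mxdot P P.
  rewrite PE (mxdot_outer_diag _ Yoff).
  have QV1 : (Q *m V)^T *m (Q *m V) = 1%:M by apply: orth_mul => //; exact: mulmx1C.
  have := @von_neumann_trace_lower R r (Q *m V) (fun k => sigma k.+1) a QV1
    adec a0 (sigma_dec Mdec).
  have -> : \sum_(j < r) a j * sigma (r - j.+1).+1 = \sum_(j < r) a j * sigma (r - j)%N.
    by apply: eq_bigr => j _; rewrite subnSK.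
  move=> /le_trans; apply; rewrite le_eqVlt; apply/orP; left; apply/eqP.
  apply: eq_bigr => j _; rewrite Ydiag -mulr_sumr [RHS]mulrC; congr (_ * _).
  have -> : Zm = U0 *m (Q *m V) by rewrite /Zm /U mulmxA.
  set H := Q *m V.
  have GH i : (U0^T *m U0 *m H) i j = sigma i.+1 * H i j.
    rewrite mxE (bigD1 i) //= (factor_gram rn Mdec) eqxx mulr1 big1 ?addr0//.
    by move=> k ki; rewrite (factor_gram rn Mdec) eq_sym (negbTE ki) mulr0 mul0r.
  rewrite trmx_mul -mulmxA (mulmxA U0^T) mxE; apply: eq_bigr => i _.
  by rewrite GH [_^T _ _]mxE; ring.
have NFE : mxdot N F <= \sum_(j < r) a j * sigma (r + j).+1.
  rewrite FE (residual_quadratic rn Mdec).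
  apply: (@von_neumann_trace R n (n - r) r (spectral_tail r u) Y
    (fun k => sigma (r + k).+1) a) => //; first exact: (tail_orth rn Mdec).
    by move=> k; rewrite addnS; exact: sigma_dec Mdec _.
  by move=> k; exact: sigma_ge0 Mdec _.
have Nsym : N^T = N := residual_sym rn Mdec.
have NU0 : N *m U0 = 0 := residual_factor rn Mdec.
(* N vanishes on the range of U, so it meets P only through the sampling noise. *)
have NP0 : mxdot N P = 0.
  have NU : U^T *m N = 0.
    by rewrite -Nsym -trmx_mul /U mulmxA NU0 mul0mx trmx0.
  by rewrite mxdotC mxdot_mull NU mxdot0r.
set f := mxdot F F in eb1 eb2 fE; set g := mxdot P P in eb2 gE.
set e := mxdot E E in eb1 eb2.
set W := mxdot D D in trWE.
have f0 : 0 <= f by exact: mxdot_ge0.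
have g0 : 0 <= g by exact: mxdot_ge0.
have W0 : 0 <= W by exact: mxdot_ge0.
have Dn0 : 0 <= Dn by apply: le_trans Dnoise; exact: spec_norm_ge0.
have maskN : sdot S N = fun A => mxdot (mask_proj S N - p *: N) A + p * mxdot N A.
  by apply/funext => A; rewrite sdotE !mxdot_lin; ring.
have nuc (A B : 'M[R]_(n, r)) : (forall i j, i != j -> (B^T *m B) i j = 0) ->
    mxdot (mask_proj S N - p *: N) (A *m B^T)
      <= Dn * Num.sqrt r%:R * Num.sqrt (mxdot (A *m B^T) (A *m B^T)).
  move=> Boff; rewrite (mxdot_outer_diag _ Boff).
  apply: le_trans (spec_nuclear _ _ _) _.
  by rewrite ler_wpM2r ?sqrtr_ge0// ler_wpM2r ?sqrtr_ge0.
have NPb : sdot S N P <= Dn * Num.sqrt r%:R * Num.sqrt g.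
  by rewrite maskN NP0 mulr0 addr0 /g PE; exact: nuc.
have NFb : sdot S N F <= Dn * Num.sqrt r%:R * Num.sqrt f + p * mxdot N F.
  by rewrite maskN lerD2r /f FE; exact: nuc.
have S4E : \sum_k mxdot (row k D) (row k D) ^+ 2 = \sum_k (\sum_a D k a ^+ 2) ^+ 2.
  apply: eq_bigr => k _; rewrite mxdot_sqr big_ord1.
  by congr (_ ^+ 2); apply: eq_bigr => a' _; rewrite mxE.
have F2E : \sum_k mxdot (row k D) (row k D) = W.
  rewrite /W mxdot_sqr; apply: eq_bigr => k _; rewrite mxdot_sqr big_ord1.
  by apply: eq_bigr => a' _; rewrite mxE.
have [B BE] : exists B, X *m D^T + D *m X^T = B by eexists.
have := completion_second_order locmin al0 la0 _ (esym BE).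
(* The rows of X - D = U have norm at most sqrt mu <= al / 100; the lower limit on alpha serves
   this. *)
have rowbound i : 100 ^+ 2 * mxdot (row i X - row i D) (row i X - row i D) <= al ^+ 2.
  have XD : X - D = U by rewrite /D opprB addrC subrK.
  rewrite -linearB /= XD mxdot_sqr big_ord1.
  under eq_bigr do rewrite mxE.
  have m2 : (100 * Num.sqrt mu) ^+ 2 <= al ^+ 2.
    by rewrite lerXn2r ?nnegrE ?mulr_ge0 ?sqrtr_ge0.
  apply: le_trans m2; rewrite exprMn sqr_sqrtr//.
  by apply: ler_wpM2l => //; rewrite exprn_ge0.
move=> /(_ rowbound) {rowbound} second.
have XE : X = U + D by rewrite /D addrC subrK.
have PT : P^T = D *m U^T by rewrite [P^T]trmx_mul trmxK.
have EP : E = P + P^T + F by rewrite EU PT /P /F XE outer_addE.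
have BEF : B = E + F by rewrite -BE EP PT /P /F XE outer_derivE.
have NE : sdot S N E = 2 * sdot S N P + sdot S N F.
  have -> : sdot S N E = sdot S N P + sdot S N P^T + sdot S N F by rewrite EP !sdotDr.
  have -> : sdot S N P^T = sdot S N P.
    by rewrite -[in LHS]Nsym sdot_tr.
  lra.
have AE : X *m X^T - M = E - N by rewrite /E /N opprB addrA subrK.
set S4 := \sum_k (\sum_a D k a ^+ 2) ^+ 2 in S4E.
have S40 : 0 <= S4 by exact: sum_sqr_ge0.
have WE : \sum_k \sum_a D k a ^+ 2 = W by rewrite /W mxdot_sqr.
have low : p * e - (p / 24 * g + 2 * kap * W) - 4 * nu * (mu * W) - 3 * nu * S4
    <= sdot S E E.
  have := @sampled_error_lower R n r S p kap nu mu X U Ssym gapU (erefl _) rowU.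
  by rewrite -EU -/D WE.
have FFb : sdot S F F <= p * f + nu * S4.
  have := @q_FF_le R n r S p nu X U (erefl _).
  by rewrite (sdot_split S p) lerD2l.
move: second; rewrite AE BEF -/F sdot_second NE.
rewrite big_split /= sumrN -mulr_sumr F2E S4E => second.
(* The lower limit on lambda gives the negative quartic term; the upper limits on lambda and alpha
   keep the rest of order nu mu |D|^2. *)
have noise : la * (- S4 + 130 * 100 * al ^+ 2 * W)
    <= - (100 * nu) * S4 + c0 * (nu * mu) * W.
  have h1 : 100 * nu * S4 <= la * S4 by exact: ler_wpM2r.
  have al2' : al ^+ 2 <= (200 * 200) * mu.
    have -> : (200 * 200) * mu = (200 * Num.sqrt mu) ^+ 2.
      by rewrite exprMn sqr_sqrtr.
    by rewrite lerXn2r ?nnegrE ?mulr_ge0 ?sqrtr_ge0.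
  have h2 : la * al ^+ 2 <= (200 * nu) * ((200 * 200) * mu).
    by apply: ler_pM => //; exact: sqr_ge0.
  have h3 : (la * al ^+ 2) * W <= ((200 * nu) * ((200 * 200) * mu)) * W.
    exact: ler_wpM2r.
  have h4 : 130 * 100 * (200 * (200 * 200)) * (nu * mu * W) <= c0 * (nu * mu * W).
    by apply: ler_wpM2r => //; apply: mulr_ge0 => //; exact: mulr_ge0.
  by clear -h1 h3 h4; lra.
set NF := mxdot N F in NFE NFb.
set x := Dn * Num.sqrt r%:R in NPb NFb.
have gs : Num.sqrt g ^+ 2 = g by rewrite sqr_sqrtr.
have fs : Num.sqrt f ^+ 2 = f by rewrite sqr_sqrtr.
have xs : x ^+ 2 = Dn ^+ 2 * r%:R by rewrite exprMn sqr_sqrtr.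
have p16 : 0 < p / 16 by rewrite divr_gt0.
have p20 : 0 < p / 20 by rewrite divr_gt0.
have ab1 := absorb 8 x (Num.sqrt g) p16.
have ab2 := absorb 6 x (Num.sqrt f) p20.
rewrite gs xs in ab1; rewrite fs xs in ab2.
have E1 : 8 ^+ 2 / (4 * (p / 16)) = 256 / p by field; rewrite gt_eqF.
have E2 : 6 ^+ 2 / (4 * (p / 20)) = 180 / p by field; rewrite gt_eqF.
rewrite E1 in ab1; rewrite E2 in ab2.
have nuS : 0 <= nu * S4 by exact: mulr_ge0.
have peb1 : p * f <= p * (2 * e) by rewrite ler_pM2l.
have peb2 : p * (g / 2 + f / 5) <= p * e by rewrite ler_pM2l.
(* The S4 terms have total coefficient 1 + 9 - 100 < 0. After the absorptions with weights p / 16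
   and p / 20 it remains that (11/10) f + g / 4 <= (5/2) e, which is exactly [eb1] plus half of
   [eb2]. *)
have core : p * (e / 2 + f / 20)
    <= K * W + 6 * p * NF - p / 16 * g + 436 / p * (Dn ^+ 2 * r%:R).
  by rewrite /K; clear -second low FFb noise NPb NFb ab1 ab2 nuS peb1 peb2; lra.
clear -core gE NFE fE trWE age0 p0.
have {}core : e / 2 <= K / p * W + 6 * NF - g / 16 - f / 20
     + 436 * (Dn ^+ 2 * r%:R / p ^+ 2).
  rewrite -(ler_pM2l p0).
  have -> : p * (K / p * W + 6 * NF - g / 16 - f / 20
     + 436 * (Dn ^+ 2 * r%:R / p ^+ 2))
    = K * W + 6 * p * NF - p / 16 * g - p * (f / 20) + 436 / p * (Dn ^+ 2 * r%:R).
    by field; rewrite gt_eqF.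
  by move: core; lra.
set q := Dn ^+ 2 * r%:R / p ^+ 2 in core *.
(* With i = r - j the index r + j + 1 is 2 r + 1 - i. The factor 16 clears the weight of g, hence 96
   = 16 * 6. *)
pose y (j : 'I_r) := 16 * (K / p) + 96 * sigma (r + j).+1 - sigma (r - j)%N.
have -> : \sum_(1 <= i < r.+1)
      pos_part (16 * (K / p) + 96 * sigma (2 * r + 1 - i)%N - sigma i) ^+ 2
    = \sum_(j < r) pos_part (y j) ^+ 2.
  rewrite big_add1 /= big_mkord (reindex_inj rev_ord_inj) /=.
  apply: eq_bigr => j _; rewrite /y; have jr := ltn_ord j.
  have -> : (2 * r + 1 - (r - j.+1).+1)%N = (r + j).+1 by lia.
  by have -> : (r - j.+1).+1 = (r - j)%N by lia.
(* The term f / 20 kept in [core] makes each scalar problem bounded; the factor 5 / 256 is 5 times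
   the square of 1/16. *)
have : \sum_(j < r) (a j * (16^-1 * y j) - a j ^+ 2 / 20)
    <= \sum_(j < r) 5 / 256 * pos_part (y j) ^+ 2.
  apply: ler_sum => j _; apply: le_trans (quadratic_max _ (age0 _)) _.
  by rewrite pos_partZ ?invr_ge0// exprMn; lra.
rewrite -mulr_sumr.
have -> : \sum_(j < r) (a j * (16^-1 * y j) - a j ^+ 2 / 20)
   = K / p * W + 6 * (\sum_(j < r) a j * sigma (r + j).+1)
     - 16^-1 * (\sum_(j < r) a j * sigma (r - j)%N) - 20^-1 * f.
  rewrite trWE fE !mulr_sumr -big_split -!sumrB /=; apply: eq_bigr => j _.
  by rewrite /y; field; rewrite gt_eqF.
by move: core gE NFE; lra.
Qed.

(** The cross term is -2 <X X^T, N>, because N is orthogonal to Mr, and N is positive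
    semidefinite. *)
Lemma residual_pythagoras (n r : nat) (M : 'M[R]_n) (sigma : nat -> R)
    (u : nat -> 'cV[R]_n) (X : 'M[R]_(n, r)) :
  let Mr := spectral_truncation sigma u r in
  let N := M - Mr in
  (r <= n)%N -> spectral_decomposition M sigma u ->
  mxdot (X *m X^T - M) (X *m X^T - M)
    <= mxdot (X *m X^T - Mr) (X *m X^T - Mr) + mxdot N N.
Proof.
move=> Mr N rn Mdec.
have -> : X *m X^T - M = (X *m X^T - Mr) - N by rewrite /N opprB addrA subrK.
have NMr : mxdot Mr N = 0.
  have Nsym : N^T = N := residual_sym rn Mdec.
  have NU0 : N *m spectral_factor r sigma u = 0 := residual_factor rn Mdec.
  rewrite /Mr -(truncation_factor r Mdec) mxdot_mull.
  by rewrite -Nsym -trmx_mul NU0 trmx0 mxdot0r.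
have NX : 0 <= mxdot (X *m X^T) N.
  rewrite mxdotC (residual_quadratic rn Mdec).
  apply: sumr_ge0 => j _; apply: sumr_ge0 => l _.
  by rewrite mulr_ge0 ?sqr_ge0// (sigma_ge0 Mdec).
have H : mxdot (X *m X^T - Mr) N = mxdot (X *m X^T) N by rewrite mxdotDl mxdotNl NMr oppr0 addr0.
move: (X *m X^T - Mr) H => E H; clearbody N.
rewrite mxdotDl mxdotNl !mxdotDr !mxdotNr (mxdotC N E) H; lra.
Qed.

End DeterministicBound.

(** * Spectral norm of a random symmetric matrix *)

Section ExpInequalities.
Context {R : realType}.
Implicit Types x : R.

Lemma mul_sub1_expR x : (1 - x) * expR x <= 1.
Proof.
by rewrite -[leRHS](expRxMexpNx_1 x) mulrC ler_wpM2l ?expR_ge0// expR_ge1Dx.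
Qed.

(** Both signs rest on (1 - v) exp v <= 1, used at v = x / 2 and squared for x >= 0, and at v = x
    for x < 0. *)
Lemma expR_le_quadratic x : x <= 1 -> expR x <= 1 + x + 2 * x ^+ 2.
Proof.
move=> x1; have [x0|x0] := leP 0 x.
  have h1 : 0 < 1 - x / 2 by lra.
  have h2 := mul_sub1_expR (x / 2).
  have h3 : (1 - x / 2) ^+ 2 * expR x <= 1.
    have -> : expR x = expR (x / 2) ^+ 2 by rewrite -expRM_natl; congr expR; field.
    by rewrite -exprMn exprn_ile1// mulr_ge0 ?expR_ge0// ltW.
  have h4 : 0 < (1 - x / 2) ^+ 2 by rewrite exprn_gt0.
  rewrite -(ler_pM2l h4); apply: le_trans h3 _.
  rewrite -subr_ge0.
  have -> : (1 - x / 2) ^+ 2 * (1 + x + 2 * x ^+ 2) - 1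
    = x ^+ 2 * ((1 - x) * (5 - 2 * x)) / 4 by field.
  by rewrite divr_ge0// mulr_ge0 ?sqr_ge0// mulr_ge0; lra.
have h2 := mul_sub1_expR x.
have h1 : 0 < 1 - x by lra.
rewrite -(ler_pM2l h1); apply: le_trans h2 _; nra.
Qed.

(** Averaged over a centred variable the linear term disappears, leaving a sub-Gaussian bound on the
    Laplace transform. *)
Lemma expR_le_subgaussian x : expR x <= x + expR (2 * x ^+ 2).
Proof.
have E := expR_ge1Dx (2 * x ^+ 2).
have [x1|x1] := leP x 1; first by have := expR_le_quadratic x1; lra.
have : expR x <= expR (2 * x ^+ 2) by rewrite ler_expR; nra.
lra.
Qed.

(** Turns bounds on Laplace transforms into bounds on even moments. *)
Lemma even_exp_le_cosh (L : nat) x : ~~ odd L ->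
  x ^+ L <= L`!%:R * (expR x + expR (- x)).
Proof.
move=> Lev; have -> : x ^+ L = `|x| ^+ L.
  by rewrite -normrX ger0_norm// exprn_even_ge0.
have f0 : 0 < L`!%:R :> R by rewrite ltr0n fact_gt0.
have : `|x| ^+ L <= L`!%:R * expR `|x|.
  case: L Lev f0 => [|L] _ f0.
    by rewrite expr0 fact0 mul1r; apply: le_trans (expR_ge1Dx _); rewrite lerDl.
  rewrite mulrC -ler_pdivrMr//; apply: le_trans (expR_ge1Dxn L _) => //.
  by rewrite lerDr.
move=> /le_trans; apply; apply: ler_wpM2l; first exact: ltW.
have [x0|x0] := leP 0 x; first by rewrite (ger0_norm x0) lerDl expR_ge0.
by rewrite (ltr0_norm x0) lerDr expR_ge0.
Qed.

End ExpInequalities.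

(** * Expectations over finite products of Bernoulli laws *)

Section BernoulliProduct.
Context {R : realType}.
Variables (T : finType) (p : R).
Hypotheses (p0 : 0 <= p) (p1 : p <= 1).

Definition bern_weight (b : bool) : R := if b then p else 1 - p.

Definition bern_exp (f : {ffun T -> bool} -> R) : R :=
  \sum_(w : {ffun T -> bool}) (\prod_e bern_weight (w e)) * f w.

Lemma bern_weight_ge0 b : 0 <= bern_weight b.
Proof. by case: b => //=; rewrite subr_ge0. Qed.

Lemma bern_prod_ge0 (w : {ffun T -> bool}) : 0 <= \prod_e bern_weight (w e).
Proof. by apply: prodr_ge0 => e _; exact: bern_weight_ge0. Qed.

Lemma bern_exp_prod (phi : T -> bool -> R) :
  bern_exp (fun w => \prod_e phi e (w e))
  = \prod_e (p * phi e true + (1 - p) * phi e false).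
Proof.
transitivity (\sum_(w : {ffun T -> bool}) \prod_e (bern_weight (w e) * phi e (w e))).
  by apply: eq_bigr => w _; rewrite big_split.
rewrite -(bigA_distr_bigA (fun e b => bern_weight b * phi e b)).
by apply: eq_bigr => e _; rewrite big_bool.
Qed.

Lemma bern_exp_cst (c : R) : bern_exp (fun=> c) = c.
Proof.
transitivity (c * bern_exp (fun w => \prod_e (fun _ _ => 1) e (w e))).
  by rewrite /bern_exp mulr_sumr; apply: eq_bigr => w _; rewrite big1_eq mulr1 mulrC.
by rewrite (bern_exp_prod (fun _ _ => 1)) big1 ?mulr1// => e _; lra.
Qed.

Lemma bern_exp_le (f g : {ffun T -> bool} -> R) :
  (forall w, f w <= g w) -> bern_exp f <= bern_exp g.
Proof.
by move=> fg; apply: ler_sum => w _; rewrite ler_wpM2l ?bern_prod_ge0.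
Qed.

Lemma bern_exp_sum (I : finType) (P : pred I) (f : I -> {ffun T -> bool} -> R) :
  bern_exp (fun w => \sum_(i | P i) f i w) = \sum_(i | P i) bern_exp (f i).
Proof.
by rewrite /bern_exp exchange_big /=; apply: eq_bigr => w _; rewrite mulr_sumr.
Qed.

Lemma bern_expZ (c : R) (f : {ffun T -> bool} -> R) :
  bern_exp (fun w => c * f w) = c * bern_exp f.
Proof. by rewrite /bern_exp mulr_sumr; apply: eq_bigr => w _; rewrite mulrCA. Qed.

(** Several indices may share a coordinate; their factors are grouped, which later counts the
    multiplicity of an edge in a walk. *)
Lemma bern_exp_fam (I : finType) (P : pred I) (f : I -> T) (phi : I -> bool -> R) :
  bern_exp (fun w => \prod_(i | P i) phi i (w (f i)))
  = \prod_e (p * \prod_(i | P i && (f i == e)) phi i true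
             + (1 - p) * \prod_(i | P i && (f i == e)) phi i false).
Proof.
rewrite -(bern_exp_prod (fun e b => \prod_(i | P i && (f i == e)) phi i b)).
apply: eq_bigr => w _; congr (_ * _).
rewrite (partition_big f xpredT) //=; apply: eq_bigr => e _.
by apply: eq_bigr => i /andP[_ /eqP <-].
Qed.

Lemma bern_exp_indep (I : finType) (P : pred I) (f : I -> T) (phi : I -> bool -> R) :
  {in P &, injective f} ->
  bern_exp (fun w => \prod_(i | P i) phi i (w (f i)))
  = \prod_(i | P i) (p * phi i true + (1 - p) * phi i false).
Proof.
move=> finj; rewrite bern_exp_fam [RHS](partition_big f xpredT) //=.
apply: eq_bigr => e _.
have [i /andP[Pi /eqP fi]|none] := pickP (fun i => P i && (f i == e)).
  have uni : (fun j => P j && (f j == e)) =1 pred1 i.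
    move=> j /=; apply/andP/eqP => [[Pj /eqP fj]|->]; last by rewrite fi.
    by apply: finj => //; rewrite fj.
  by rewrite !(eq_bigl _ _ uni) !big_pred1_eq.
by rewrite !big_pred0//; lra.
Qed.

Definition bern_prob (A : pred {ffun T -> bool}) : R := bern_exp (fun w => (A w)%:R).

Lemma bern_markov (A : pred {ffun T -> bool}) (f : {ffun T -> bool} -> R) (c : R) :
  0 < c -> (forall w, 0 <= f w) -> (forall w, A w -> c <= f w) ->
  bern_prob A <= bern_exp f / c.
Proof.
move=> c0 f0 Af; rewrite ler_pdivlMr// mulrC -bern_expZ; apply: bern_exp_le => w.
by case Aw: (A w); rewrite ?mulr1 ?mulr0//; exact: Af.
Qed.

End BernoulliProduct.

(** * Traces of powers and closed walks *)

Section TraceWalks.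
Context {R : realType}.

Definition mpow (n : nat) (A : 'M[R]_n) (k : nat) : 'M[R]_n :=
  iter k (mulmx A) 1%:M.

Lemma mpowD (n : nat) (A : 'M[R]_n) k l : mpow A (k + l) = mpow A k *m mpow A l.
Proof.
elim: k => [|k IH]; first by rewrite /mpow /= mul1mx.
by rewrite addSn /mpow /= -mulmxA -IH.
Qed.

Lemma mpow_tr (n : nat) (A : 'M[R]_n) k : A^T = A -> (mpow A k)^T = mpow A k.
Proof.
move=> As; elim: k => [|k IH]; first by rewrite /mpow /= trmx1.
have -> : mpow A k.+1 = A *m mpow A k by [].
have A1 : A = mpow A 1 by rewrite /mpow /= mulmx1.
rewrite trmx_mul IH As; transitivity (mpow A k *m mpow A 1); first by rewrite -A1.
by rewrite -mpowD addn1.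
Qed.

Lemma tr_mpow_double (n : nat) (A : 'M[R]_n) k : A^T = A ->
  \tr (mpow A (k + k)) = mxdot (mpow A k) (mpow A k).
Proof. by move=> As; rewrite mpowD /mxdot mpow_tr. Qed.

(** Repeated squaring: |A^k x|^2 = <x, A^(2k) x> <= |A^(2k) x|. This replaces eigenvalues in the
    trace method and is why all exponents are powers of two. *)
Lemma norm_mul_pow2_le (n : nat) (A : 'M[R]_n) (x : 'cV[R]_n) m : A^T = A ->
  frobenius_norm x = 1 ->
  frobenius_norm (A *m x) ^+ (2 ^ m) <= frobenius_norm (mpow A (2 ^ m) *m x).
Proof.
move=> As x1; elim: m => [|m IH]; first by rewrite expn0 expr1 /mpow /= mulmx1.
rewrite expnS mul2n -addnn exprD -expr2; apply: (@le_trans _ _ (frobenius_norm (mpow A (2 ^ m) *m x) ^+ 2)).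
  by rewrite lerXn2r ?nnegrE ?exprn_ge0 ?frob_ge0.
rewrite frob_sqr mxdot_mull mpow_tr// mulmxA -mpowD.
by apply: le_trans (mxdot_le_frob _ _) _; rewrite x1 mul1r.
Qed.

Lemma norm_mul_trace (n : nat) (A : 'M[R]_n) (x : 'cV[R]_n) m : A^T = A ->
  frobenius_norm x = 1 ->
  frobenius_norm (A *m x) ^+ (2 ^ m.+1) <= \tr (mpow A (2 ^ m.+1)).
Proof.
move=> As x1; rewrite expnS mul2n -addnn tr_mpow_double// exprD -frob_sqr expr2.
have H : frobenius_norm (A *m x) ^+ (2 ^ m) <= frobenius_norm (mpow A (2 ^ m)).
  apply: le_trans (norm_mul_pow2_le m As x1) _.
  by apply: le_trans (frob_mulmx _ _) _; rewrite x1 mulr1.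
by apply: ler_pM; rewrite ?exprn_ge0 ?frob_ge0.
Qed.

Lemma mpow_norm_le (n : nat) (A : 'M[R]_n) k (x : 'cV[R]_n) :
  frobenius_norm (mpow A k *m x) <= spectral_norm A ^+ k * frobenius_norm x.
Proof.
elim: k => [|k IH]; first by rewrite /mpow /= mul1mx expr0 mul1r.
have -> : mpow A k.+1 = A *m mpow A k by [].
rewrite -mulmxA; apply: le_trans (spec_normP _ _) _.
by rewrite exprS -mulrA ler_wpM2l ?spec_norm_ge0.
Qed.

Lemma tr_mpow_le (n : nat) (A : 'M[R]_n) h : A^T = A ->
  \tr (mpow A (h + h)) <= n%:R * spectral_norm A ^+ (h + h).
Proof.
move=> As; rewrite tr_mpow_double// /mxdot /mxtrace.
apply: (@le_trans _ _ (\sum_(i < n) spectral_norm A ^+ (h + h))); last first.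
  by rewrite sumr_const card_ord mulr_natl.
apply: ler_sum => i _.
pose e : 'cV[R]_n := delta_mx i 0.
have -> : ((mpow A h)^T *m mpow A h) i i = frobenius_norm (mpow A h *m e) ^+ 2.
  rewrite frob_sqr mxdotE mxE; apply: eq_bigr => k _; rewrite big_ord1 !mxE.
  rewrite (bigD1 i) //= !mxE !eqxx mulr1 big1 ?addr0// => j ji.
  by rewrite !mxE (negbTE ji) mulr0.
rewrite addnn -mul2n mulnC exprM lerXn2r ?nnegrE ?frob_ge0 ?exprn_ge0 ?spec_norm_ge0//.
by apply: le_trans (mpow_norm_le _ _ _) _; rewrite frob_delta mulr1.
Qed.

Definition fcons (k : nat) (T : Type) (x : T) (w : {ffun 'I_k -> T}) :
  {ffun 'I_k.+1 -> T} := [ffun i => if unlift ord0 i is Some j then w j else x].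

Lemma fcons0 (k : nat) (T : Type) (x : T) (w : {ffun 'I_k -> T}) : fcons x w ord0 = x.
Proof. by rewrite ffunE unlift_none. Qed.

Lemma fconsS (k : nat) (T : Type) (x : T) (w : {ffun 'I_k -> T}) j :
  fcons x w (lift ord0 j) = w j.
Proof. by rewrite ffunE liftK. Qed.

Lemma sum_fcons (k : nat) (T : finType) (F : {ffun 'I_k.+1 -> T} -> R) :
  \sum_w F w = \sum_x \sum_w F (fcons x w).
Proof.
rewrite pair_bigA /=.
rewrite (reindex (fun q : T * {ffun 'I_k -> T} => fcons q.1 q.2)) //=.
exists (fun w => (w ord0, [ffun j => w (lift ord0 j)])) => [[x w] _|w _] /=.
  by rewrite fcons0; congr pair; apply/ffunP => j; rewrite ffunE fconsS.
by apply/ffunP => i; rewrite ffunE; case: unliftP => [j ->|-> //]; rewrite ffunE.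
Qed.

(** Arbitrary end weights make the induction work: the first edge is absorbed into h. Specialized,
    they also close the walk in [tr_walks]. *)
Lemma mpow_walks (n : nat) (A : 'M[R]_n) k (h g : 'I_n -> R) :
  \sum_(w : {ffun 'I_k.+1 -> 'I_n})
     (h (w ord0) * (\prod_(i < k) A (w (widen_ord (leqnSn k) i)) (w (lift ord0 i)))
      * g (w ord_max))
  = \sum_x \sum_y h x * mpow A k x y * g y.
Proof.
elim: k h => [|k IH] h.
  rewrite sum_fcons; apply: eq_bigr => x _.
  rewrite (bigD1 x) //= [X in _ = _ + X]big1 ?addr0; last first.
    by move=> y yx; rewrite mxE eq_sym (negbTE yx) mulr0 mul0r.
  rewrite mxE eqxx; under eq_bigr => w _.
    rewrite big_ord0 (_ : ord_max = ord0) ?fcons0; last exact: val_inj.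
    over.
  by rewrite sumr_const card_ffun !card_ord expn0.
rewrite sum_fcons.
under eq_bigr => x _.
  under eq_bigr => w _.
    rewrite big_ord_recl fcons0 fconsS.
    rewrite (_ : widen_ord _ ord0 = ord0) ?fcons0; last exact: val_inj.
    rewrite (_ : ord_max = lift ord0 ord_max) ?fconsS; last exact: val_inj.
    rewrite (eq_bigr (fun i : 'I_k => A (w (widen_ord (leqnSn k) i)) (w (lift ord0 i)))); last first.
      move=> i _; rewrite fconsS.
      by rewrite (_ : widen_ord _ (lift ord0 i) = lift ord0 (widen_ord (leqnSn k) i)) ?fconsS//; exact: val_inj.
    rewrite mulrA.
    over.
  rewrite (IH (fun z => h x * A x z)).
  over.
apply: eq_bigr => x _; rewrite exchange_big /=; apply: eq_bigr => y _.
have -> : mpow A k.+1 x y = \sum_z A x z * mpow A k z y by rewrite [LHS]mxE.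
by rewrite mulr_sumr mulr_suml; apply: eq_bigr => z _; ring.
Qed.

Lemma tr_walks (n : nat) (A : 'M[R]_n) k :
  \tr (mpow A k.+1)
  = \sum_(w : {ffun 'I_k.+1 -> 'I_n}) \prod_(i < k.+1) A (w i) (w (ordS i)).
Proof.
have -> : \tr (mpow A k.+1) = \sum_x \sum_y mpow A k x y * A y x.
  rewrite -addn1 mpowD; apply: eq_bigr => x _; rewrite mxE; apply: eq_bigr => y _.
  by rewrite /mpow /= mulmx1.
(* The auxiliary z ties the closing edge to the starting vertex, so that h and g each depend on one
   end only. *)
transitivity (\sum_z \sum_x \sum_y (z == x)%:R * mpow A k x y * A y z).
  rewrite [RHS]exchange_big /=; apply: eq_bigr => x _.
  rewrite [RHS]exchange_big /=; apply: eq_bigr => y _.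
  rewrite (bigD1 x) //= eqxx mul1r big1 ?addr0// => z zx.
  by rewrite (negbTE zx) !mul0r.
under eq_bigr => z _ do rewrite -(mpow_walks A k (fun x => (z == x)%:R) (fun y => A y z)).
rewrite exchange_big /=; apply: eq_bigr => w _.
rewrite (bigD1 (w ord0)) //= eqxx mul1r [X in _ + X]big1 ?addr0; last first.
  by move=> z zw; rewrite (negbTE zw) !mul0r.
rewrite [RHS]big_ord_recr /=; congr (_ * _); last first.
  by congr (A _ (w _)); apply: val_inj => /=; rewrite modnn.
apply: eq_bigr => i _; congr (A (w _) (w _)); apply: val_inj => //=.
by rewrite /bump /= add1n modn_small// ltnS.
Qed.

End TraceWalks.

(** * Counting walks by their pattern of repeated vertices *)

Section WalkKernels.
Context {R : realType}.
Variable L : nat.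

Definition same_kernel (n r : nat) (w : {ffun 'I_L -> 'I_n}) (v : {ffun 'I_L -> 'I_r}) :=
  [forall i, forall j, (w i == w j) == (v i == v j)].

Definition walk_verts (n : nat) (w : {ffun 'I_L -> 'I_n}) : {set 'I_n} :=
  [set w i | i in 'I_L]%SET.

Lemma same_kernelP (n r : nat) (w : {ffun 'I_L -> 'I_n}) (v : {ffun 'I_L -> 'I_r}) :
  reflect (forall i j, (w i == w j) = (v i == v j)) (same_kernel w v).
Proof.
apply: (iffP forallP) => [H i j|H i]; last by apply/forallP => j; rewrite H.
by have /forallP/(_ j)/eqP := H i.
Qed.

Lemma same_kernel_sym (n r : nat) (w : {ffun 'I_L -> 'I_n}) (v : {ffun 'I_L -> 'I_r}) :
  same_kernel w v = same_kernel v w.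
Proof. by apply/same_kernelP/same_kernelP => H i j; rewrite H. Qed.

Lemma card_verts_kernel (n : nat) (w : {ffun 'I_L -> 'I_n}) :
  #|walk_verts w| = #|[set [set j | w j == w i] | i in 'I_L]%SET|.
Proof.
have -> : [set [set j | w j == w i] | i in 'I_L]%SET
    = [set [set j | w j == x] | x in walk_verts w]%SET.
  by rewrite -imset_comp.
rewrite [RHS]card_in_imset// => x y /imsetP[i _ ->] /imsetP[j _ ->] /setP/(_ i).
by rewrite !inE eqxx => /esym/eqP.
Qed.

Lemma same_kernel_verts (n r : nat) (w : {ffun 'I_L -> 'I_n}) (v : {ffun 'I_L -> 'I_r}) :
  same_kernel w v -> #|walk_verts w| = #|walk_verts v|.
Proof.
move=> /same_kernelP H; rewrite !card_verts_kernel.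
congr #|pred_of_set _|; apply: eq_imset => i.
by apply/setP => j; rewrite !inE H.
Qed.

(** Walks with the kernel of w are the injective relabellings of its visited vertices. *)
Lemma card_same_kernel (n r : nat) (w : {ffun 'I_L -> 'I_n}) :
  #|[set v : {ffun 'I_L -> 'I_r} | same_kernel w v]%SET| = (r ^_ #|walk_verts w|)%N.
Proof.
pose D := {x : 'I_n | x \in walk_verts w}.
have wP i : w i \in walk_verts w by apply/imsetP; exists i.
pose wD i : D := exist _ (w i) (wP i).
pose h (g : {ffun D -> 'I_r}) : {ffun 'I_L -> 'I_r} := [ffun i => g (wD i)].
have hinj : injective h.
  move=> f g /ffunP fg; apply/ffunP => -[x xP].
  have /imsetP[i _ xE] := xP; have := fg i; rewrite !ffunE.
  by have -> : wD i = exist _ x xP by apply: val_inj; rewrite /= xE.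
have -> : [set v : {ffun 'I_L -> 'I_r} | same_kernel w v]%SET
    = (h @: [set g : {ffun D -> 'I_r} | injectiveb g])%SET.
  apply/setP => v; rewrite !inE; apply/idP/imsetP.
  - move=> /same_kernelP wv.
    have pre (x : D) : {i | w i == val x}.
      by apply: sigW; have /imsetP[i _ xE] := valP x; exists i; rewrite -xE.
    pose g : {ffun D -> 'I_r} := [ffun x => v (sval (pre x))].
    exists g; last first.
      apply/ffunP => i; rewrite !ffunE; apply/eqP.
      by rewrite -wv; have := svalP (pre (wD i)); rewrite eq_sym.
    rewrite inE; apply/injectiveP => x y; rewrite !ffunE => /eqP.
    by rewrite -wv => /eqP E; apply: val_inj; rewrite -(eqP (svalP (pre x))) E (eqP (svalP (pre y))).
  - move=> [g]; rewrite inE => /injectiveP ginj ->; apply/same_kernelP => i j.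
    by rewrite !ffunE (inj_eq ginj) -val_eqE.
rewrite card_imset// card_inj_ffuns card_ord card_sig.
by congr (_ ^_ _)%N; apply: eq_card => x; rewrite inE.
Qed.

(* Averaging over all walks with the same kernel replaces 'I_n by 'I_r. *)
Lemma sum_walks_transfer (n r : nat) (G : forall n, {ffun 'I_L -> 'I_n} -> R) :
  (L <= r)%N ->
  (forall (w : {ffun 'I_L -> 'I_n}) (v : {ffun 'I_L -> 'I_r}),
     same_kernel w v -> G n w = G r v) ->
  \sum_(w : {ffun 'I_L -> 'I_n}) G n w
  = \sum_(v : {ffun 'I_L -> 'I_r})
      G r v * (n ^_ #|walk_verts v|)%:R / (r ^_ #|walk_verts v|)%:R.
Proof.
move=> Lr HG.
have vL m (w : {ffun 'I_L -> 'I_m}) : (#|walk_verts w| <= L)%N.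
  by rewrite -[X in (_ <= X)%N]card_ord; exact: leq_imset_card.
have rv m (w : {ffun 'I_L -> 'I_m}) : (r ^_ #|walk_verts w|)%:R != 0 :> R.
  by rewrite pnatr_eq0 -lt0n ffact_gt0 (leq_trans (vL _ _)).
transitivity (\sum_(w : {ffun 'I_L -> 'I_n}) \sum_(v | same_kernel w v)
    (G r v / (r ^_ #|walk_verts v|)%:R)).
  apply: eq_bigr => w _.
  rewrite (eq_bigr (fun=> G n w / (r ^_ #|walk_verts w|)%:R)); last first.
    by move=> v wv; rewrite (HG _ _ wv) (same_kernel_verts wv).
  have -> : \sum_(v : {ffun 'I_L -> 'I_r} | same_kernel w v)
      (G n w / (r ^_ #|walk_verts w|)%:R)
      = G n w / (r ^_ #|walk_verts w|)%:R *+ #|[set v : {ffun 'I_L -> 'I_r} | same_kernel w v]%SET|.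
    by rewrite -sumr_const; apply: eq_bigl => v; rewrite inE.
  by rewrite card_same_kernel -mulr_natr divfK.
rewrite (exchange_big_dep xpredT) //=; apply: eq_bigr => v _.
have -> : \sum_(w : {ffun 'I_L -> 'I_n} | same_kernel w v) (G r v / (r ^_ #|walk_verts v|)%:R)
   = G r v / (r ^_ #|walk_verts v|)%:R *+ #|[set w : {ffun 'I_L -> 'I_n} | same_kernel v w]%SET|.
  by rewrite -sumr_const; apply: eq_bigl => w; rewrite inE same_kernel_sym.
by rewrite card_same_kernel -mulr_natr mulrAC.
Qed.

Definition walk_edge (n : nat) (w : {ffun 'I_L -> 'I_n}) (i : 'I_L) : 'I_n * 'I_n :=
  if (w i < w (ordS i))%N then (w i, w (ordS i)) else (w (ordS i), w i).

(* Walks whose product of independent centred entries can have nonzero mean. *)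
Definition good_walk (n : nat) (w : {ffun 'I_L -> 'I_n}) : bool :=
  [forall i, w i != w (ordS i)]
  && [forall i, exists j, (j != i) && (walk_edge w j == walk_edge w i)].

Lemma walk_edge_eq (n : nat) (w : {ffun 'I_L -> 'I_n}) i j :
  (walk_edge w i == walk_edge w j)
  = ((w i == w j) && (w (ordS i) == w (ordS j)))
    || ((w i == w (ordS j)) && (w (ordS i) == w j)).
Proof.
rewrite /walk_edge; move: (w i) (w j) (w (ordS i)) (w (ordS j)) => a c b d.
by case: ltnP => ab; case: ltnP => cd; rewrite xpair_eqE -!val_eqE /=; lia.
Qed.

Lemma same_kernel_good (n r : nat) (w : {ffun 'I_L -> 'I_n}) (v : {ffun 'I_L -> 'I_r}) :
  same_kernel w v -> good_walk w = good_walk v.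
Proof.
move=> /same_kernelP H; rewrite /good_walk; congr (_ && _).
  by apply: eq_forallb => i; rewrite H.
apply: eq_forallb => i; apply: eq_existsb => j.
by rewrite !walk_edge_eq !H.
Qed.

(** Trades the weight q per new vertex on n points for an unweighted count on r points. For m + 1
    vertices the number of labellings is at most n^(m+1) on n points and equals r (r - 1) ... (r -
    m) on r points, where each factor after the first is at least r - L >= n q. *)
Lemma good_walks_compare (n r : nat) (q : R) : (0 < L)%N -> 0 <= q ->
  n%:R * q + L%:R <= r%:R ->
  r%:R * (\sum_(w : {ffun 'I_L -> 'I_n} | good_walk w) q ^+ #|walk_verts w|.-1)
  <= n%:R * #|[set v : {ffun 'I_L -> 'I_r} | good_walk v]%SET|%:R.
Proof.
move=> L0 q0 nqr.
have Lr : (L <= r)%N.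
  by rewrite -(ler_nat R); apply: le_trans nqr; rewrite lerDr mulr_ge0.
have r0 : (0 < r)%N by exact: leq_trans Lr.
rewrite big_mkcond /=.
have := @sum_walks_transfer n r (fun m (w : {ffun 'I_L -> 'I_m}) =>
  if good_walk w then q ^+ #|walk_verts w|.-1 else 0) Lr _.
move=> ->; last first.
  by move=> w v wv; rewrite (same_kernel_good wv) (same_kernel_verts wv).
rewrite mulr_sumr -sum1dep_card natr_sum mulr_sumr [leRHS]big_mkcond /=.
apply: ler_sum => v _; case: ifP => _; last by rewrite !mul0r mulr0.
rewrite mulr1; set m := #|walk_verts v|.
have m0 : (0 < m)%N.
  by apply/card_gt0P; exists (v (Ordinal L0)); apply/imsetP; exists (Ordinal L0).
have mL : (m <= L)%N by rewrite -[X in (_ <= X)%N]card_ord; exact: leq_imset_card.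
have rm0 : 0 < (r ^_ m)%:R :> R by rewrite ltr0n ffact_gt0 (leq_trans mL).
rewrite mulrA ler_pdivrMr//.
case: m m0 mL {rm0} => // m _ mL /=.
have nm k : (n ^_ k)%:R <= n%:R ^+ k :> R.
  elim: k => [|k IH]; first by rewrite ffactn0 expr0.
  rewrite ffactnSr natrM exprSr; apply: ler_pM => //.
  by rewrite ler_nat leq_subr.
have rm k : (k <= m)%N -> (n%:R * q) ^+ k <= (r.-1 ^_ k)%:R.
  elim: k => [|k IH] km; first by rewrite ffactn0 expr0.
  rewrite ffactnSr natrM exprSr; apply: ler_pM; rewrite ?exprn_ge0 ?mulr_ge0//.
    exact: IH (ltnW km).
  have : r%:R <= L%:R + (r.-1 - k)%:R :> R by rewrite -natrD ler_nat; lia.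
  by move: nqr; lra.
rewrite (ffactnS r) natrM.
apply: (@le_trans _ _ (r%:R * (n%:R * (n%:R * q) ^+ m))).
  rewrite ler_wpM2l// mulrC.
  apply: (@le_trans _ _ (n%:R ^+ m.+1 * q ^+ m)).
    by apply: ler_wpM2r; [exact: exprn_ge0 | exact: nm].
  by rewrite exprS exprMn mulrA.
by rewrite mulrCA ler_wpM2l// ler_wpM2l// rm.
Qed.

End WalkKernels.

(** * Expected products along a closed walk *)

Section WalkMoments.
Context {R : realType}.

Lemma card_verts_edges (k n : nat) (w : {ffun 'I_k.+1 -> 'I_n}) :
  (#|walk_verts w| <= #|[set walk_edge w i | i in 'I_k.+1]%SET|.+1)%N.
Proof.
pose V m := [set w i | i in [set i : 'I_k.+1 | (i <= m)%N]%SET]%SET.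
pose E m := [set walk_edge w i | i in [set i : 'I_k.+1 | (i < m)%N]%SET]%SET.
have ends m i : (i < m)%N -> (m <= k)%N ->
    [/\ w (inord i) \in V m, w (inord i.+1) \in V m &
      walk_edge w (inord i) = if (w (inord i) < w (inord i.+1))%N
        then (w (inord i), w (inord i.+1)) else (w (inord i.+1), w (inord i))].
  move=> im mk.
  have oS : ordS (inord i : 'I_k.+1) = inord i.+1.
    by apply: val_inj; rewrite /= !inordK ?modn_small//; lia.
  split; last by rewrite /walk_edge oS.
  - by apply/imsetP; exists (inord i) => //; rewrite inE inordK; lia.
  - by apply/imsetP; exists (inord i.+1) => //; rewrite inE inordK; lia.
have main m : (m <= k)%N -> (#|V m| <= #|E m|.+1)%N.
  elim: m => [|m IH] mk.
    apply: (@leq_trans 1) => //.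
    have -> : V 0%N = [set w ord0]%SET.
      apply/setP => x; rewrite inE; apply/imsetP/eqP => [[i]|->].
        by rewrite inE leqn0 => /eqP i0 ->; congr (w _); apply: val_inj.
      by exists ord0; rewrite ?inE.
    by rewrite cards1.
  have VS : V m.+1 = (w (inord m.+1) |: V m)%SET.
    apply/setP => x; rewrite !inE; apply/imsetP/orP.
      move=> [i]; rewrite inE leq_eqVlt => /orP[/eqP im|im] ->.
        by left; apply/eqP; congr (w _); apply: val_inj; rewrite /= inordK//; lia.
      by right; apply/imsetP; exists i; rewrite ?inE.
    case=> [/eqP ->|/imsetP[i]].
      by exists (inord m.+1); rewrite // inE inordK//; lia.
    by rewrite inE => im ->; exists i; rewrite // inE; lia.
  have ES : (E m \subset E m.+1)%SET.
    by apply: imsetS; apply/fintype.subsetP => i; rewrite !inE; lia.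
  have [inV|notV] := boolP (w (inord m.+1) \in V m).
    rewrite VS (finset.setUidPr _) ?finset.sub1set//; apply: leq_trans (IH (ltnW mk)) _.
    by rewrite ltnS subset_leq_card.
  rewrite VS cardsU1 notV add1n ltnS; apply: leq_trans (IH (ltnW mk)) _.
  have [_ _ wem] := ends m.+1 m (ltnSn _) mk.
  have newE : walk_edge w (inord m) \notin E m.
    apply/negP => /imsetP[i]; rewrite inE => im.
    have [wi wi1 wei] := ends m i im (ltnW mk).
    have -> : i = inord i by apply: val_inj; rewrite /= inordK.
    rewrite wei wem => H; move: notV.
    by move: H; case: ifP => _; case: ifP => _ [E1 E2]; rewrite ?E1 ?E2 ?wi ?wi1.
  apply: leq_trans (_ : #|(walk_edge w (inord m) |: E m)%SET| <= _)%N.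
    by rewrite cardsU1 newE.
  apply: subset_leq_card; rewrite finset.subUset ES andbT finset.sub1set.
  by apply/imsetP; exists (inord m) => //; rewrite inE inordK//; lia.
have -> : walk_verts w = V k.
  apply/setP => x; apply/imsetP/imsetP => -[i _ ->]; exists i => //.
  by rewrite inE -ltnS.
apply: leq_trans (main k (leqnn k)) _; rewrite ltnS; apply: subset_leq_card.
by apply/fintype.subsetP => x /imsetP[i _ ->]; apply/imsetP; exists i.
Qed.

Variable p : R.
Hypotheses (p0 : 0 <= p) (p1 : p <= 1).

Definition edge_of (n : nat) (i j : 'I_n) : 'I_n * 'I_n :=
  if (i < j)%N then (i, j) else (j, i).

Lemma edge_ofC (n : nat) (i j : 'I_n) : edge_of i j = edge_of j i.
Proof. by rewrite /edge_of; case: ltngtP => // /val_inj ->. Qed.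

(* Only the coordinates (i, j) of w with i < j matter. *)
Definition rand_mx (n : nat) (a : 'M[R]_n) (w : {ffun 'I_n * 'I_n -> bool}) : 'M[R]_n :=
  \matrix_(i, j) (if i == j then 0 else a i j * ((w (edge_of i j))%:R - p)).

Lemma rand_mx_tr (n : nat) (a : 'M[R]_n) w : a^T = a -> (rand_mx a w)^T = rand_mx a w.
Proof.
move=> as'; apply/matrixP => i j; rewrite !mxE eq_sym edge_ofC.
by rewrite -[in LHS]as' mxE.
Qed.

Definition bern_moment k : R := p * (1 - p) ^+ k + (1 - p) * (0 - p) ^+ k.

Lemma bern_moment0 : bern_moment 0 = 1.
Proof. by rewrite /bern_moment !expr0; ring. Qed.

Lemma bern_moment1 : bern_moment 1 = 0.
Proof. by rewrite /bern_moment !expr1; ring. Qed.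

Lemma bern_moment_le k : (2 <= k)%N -> `|bern_moment k| <= p * (1 - p).
Proof.
case: k => [|[|k]] // _; rewrite /bern_moment.
have q0 : 0 <= 1 - p by rewrite subr_ge0.
apply: le_trans (ler_normD _ _) _.
have nE (x y : R) m : `|x * y ^+ m| = `|x| * `|y| ^+ m by rewrite normrM normrX.
rewrite !nE sub0r normrN (ger0_norm p0) (ger0_norm q0).
have -> : p * (1 - p) ^+ k.+2 + (1 - p) * p ^+ k.+2
    = p * (1 - p) * ((1 - p) ^+ k.+1 + p ^+ k.+1) by rewrite !(exprS _ k.+1); ring.
rewrite -[leRHS]mulr1; apply: ler_wpM2l; first exact: mulr_ge0.
have h (x : R) : 0 <= x -> x <= 1 -> x ^+ k.+1 <= x.
  by move=> x0 x1; rewrite exprS -[leRHS]mulr1 ler_wpM2l// exprn_ile1.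
have := h _ q0 _; have := h _ p0 p1; rewrite lerBlDr lerDl p0 => h1 /(_ isT) h2.
lra.
Qed.

Lemma walk_expectation (k n : nat) (a : 'M[R]_n) (v : {ffun 'I_k.+1 -> 'I_n}) :
  bern_exp p (fun w => \prod_i rand_mx a w (v i) (v (ordS i)))
  = if [forall i, v i != v (ordS i)] then
      (\prod_i a (v i) (v (ordS i)))
      * \prod_e bern_moment #|[pred i | walk_edge v i == e]|
    else 0.
Proof.
case: ifPn => [/forallP noloop|]; last first.
  rewrite negb_forall => /existsP[i]; rewrite negbK => vi.
  rewrite /bern_exp big1// => w _.
  by rewrite (bigD1 i) //= mxE vi mul0r mulr0.
transitivity (bern_exp p (fun w => (\prod_i a (v i) (v (ordS i)))
    * \prod_i (fun _ b => (b : bool)%:R - p) i (w (walk_edge v i)))).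
  apply: eq_bigr => w _; congr (_ * _); rewrite -big_split /=.
  by apply: eq_bigr => i _; rewrite mxE (negbTE (noloop i)).
rewrite bern_expZ (bern_exp_fam _ xpredT (walk_edge v) (fun _ b => (b : bool)%:R - p)).
congr (_ * _); apply: eq_bigr => e _.
by rewrite !prodr_const.
Qed.

(** An edge used once contributes the vanishing first moment; otherwise each distinct edge
    contributes at most p (1 - p) <= 1, and there are at least as many edges as vertices less
    one. *)
Lemma walk_expectation_le (k n : nat) (a : 'M[R]_n) (v : {ffun 'I_k.+1 -> 'I_n}) :
  (forall i j, `|a i j| <= 1) ->
  bern_exp p (fun w => \prod_i rand_mx a w (v i) (v (ordS i)))
  <= if good_walk v then (p * (1 - p)) ^+ #|walk_verts v|.-1 else 0.
Proof.
move=> a1; have q0 : 0 <= p * (1 - p) by rewrite mulr_ge0// subr_ge0.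
rewrite walk_expectation /good_walk; case: ifPn => //= noloop.
have medge i : (0 < #|[pred j | walk_edge v j == walk_edge v i]|)%N.
  by apply/card_gt0P; exists i; rewrite inE.
case: ifPn => [/forallP good|]; last first.
  rewrite negb_forall => /existsP[i]; rewrite negb_exists => /forallP single.
  rewrite (bigD1 (walk_edge v i)) //=.
  have -> : #|[pred j | walk_edge v j == walk_edge v i]| = 1%N.
    rewrite -(card1 i); apply: eq_card => j; rewrite !inE.
    apply/idP/eqP => [H|->]; last exact: eqxx.
    by have := single j; rewrite H andbT negbK => /eqP.
  by rewrite bern_moment1 mul0r mulr0.
apply: le_trans (ler_norm _) _; rewrite normrM !normr_prod.
apply: (@le_trans _ _ (1 * \prod_(e : 'I_n * 'I_n)
    (if e \in [set walk_edge v i | i in 'I_k.+1]%SET then p * (1 - p) else 1))).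
  apply: ler_pM; rewrite ?prodr_ge0//.
    have : \prod_(i < k.+1) `|a (v i) (v (ordS i))| <= \prod_(i < k.+1) 1.
      by apply: ler_prod => i _; rewrite normr_ge0 a1.
    by rewrite big1_eq.
  apply: ler_prod => e _; rewrite normr_ge0 /=; case: ifPn => [/imsetP[i _ ->]|ne].
    apply: bern_moment_le; have /existsP[j /andP[ji vji]] := good i.
    rewrite (cardD1 i) !inE eqxx (cardD1 j) !inE ji vji; lia.
  rewrite eq_card0 ?bern_moment0 ?normr1// => i; rewrite !inE.
  by apply: contraNF ne => /eqP <-; apply/imsetP; exists i.
rewrite mul1r -big_mkcond /= prodr_const.
apply: ler_wiXn2l => //; last first.
  by rewrite -subn1 leq_subLR add1n; exact: card_verts_edges.
by apply: mulr_ile1; rewrite ?subr_ge0// lerBlDr lerDl.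
Qed.

End WalkMoments.

(** * A grid net of the unit ball *)

Section Net.
Context {R : realType}.
Variable r : nat.
Hypothesis r0 : (0 < r)%N.

(** Sign and magnitude are kept apart so that rounding goes toward zero. Magnitudes are multiples of
    1 / (4 sqrt r), and 4 sqrt r <= 4 r bounds their number. *)
Definition grid := {ffun 'I_r -> 'I_(4 * r).+1 * bool}.

Let c : R := 4 * Num.sqrt r%:R.

Definition grid_vec (g : grid) : 'cV[R]_r :=
  \col_i ((-1) ^+ (g i).2 * ((g i).1)%:R / (4 * Num.sqrt r%:R)).

Definition grid_ball : pred grid :=
  [pred g : grid | (\sum_i ((g i).1 : nat) ^ 2 <= 16 * r)%N].

Lemma grid_c0 : 0 < c.
Proof. by rewrite mulr_gt0// sqrtr_gt0 ltr0n. Qed.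

Lemma grid_c2 : c ^+ 2 = 16 * r%:R.
Proof. by rewrite exprMn sqr_sqrtr//; congr (_ * _); ring. Qed.

Lemma grid_vec_norm (g : grid) : grid_ball g ->
  mxdot (grid_vec g) (grid_vec g) <= 1.
Proof.
rewrite /grid_ball inE => gb; rewrite mxdot_sqr.
have -> : \sum_i \sum_j grid_vec g i j ^+ 2 = (\sum_i ((g i).1 : nat) ^ 2)%:R / c ^+ 2.
  rewrite natr_sum mulr_suml; apply: eq_bigr => i _.
  by rewrite big_ord1 mxE expr_div_n exprMn sqrr_sign mul1r natrX.
rewrite ler_pdivrMr ?exprn_gt0 ?grid_c0// mul1r grid_c2.
by rewrite -natrM ler_nat.
Qed.

(** Rounding toward zero stays in the ball and moves each coordinate by at most 1 / (4 sqrt r), so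
    the squared error is at most r / (16 r). *)
Lemma grid_round (x : 'cV[R]_r) : mxdot x x <= 1 ->
  exists2 g : grid, grid_ball g & 
    mxdot (x - grid_vec g) (x - grid_vec g) <= 16^-1.
Proof.
have c0 := grid_c0.
rewrite mxdot_sqr; under eq_bigr do rewrite big_ord1; move=> x1.
pose k i := Num.truncn (c * `|x i 0|).
have kP i : (k i)%:R <= c * `|x i 0| < (k i).+1%:R.
  by apply: truncn_itv; rewrite mulr_ge0// ltW.
have xi1 i : `|x i 0| <= 1.
  rewrite -(@expr_le1 _ 2)// real_normK ?num_real//; apply: le_trans x1.
  by rewrite (bigD1 i) //= lerDl sum_sqr_ge0.
have kB i : (k i < (4 * r).+1)%N.
  rewrite ltnS -(ler_nat R); have /andP[h _] := kP i; apply: le_trans h _.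
  apply: (@le_trans _ _ c); first by rewrite -[leRHS]mulr1 ler_wpM2l// ltW.
  rewrite /c natrM ler_wpM2l//.
  rewrite -[leRHS]ger0_norm// -sqrtr_sqr ler_sqrt ?sqr_ge0//.
  by rewrite expr2 -natrM ler_nat leq_pmull.
pose g : grid := [ffun i => (Ordinal (kB i), x i 0 < 0)].
exists g.
  rewrite /grid_ball inE -(ler_nat R) natrM -grid_c2 natr_sum.
  apply: (@le_trans _ _ (c ^+ 2 * \sum_i x i 0 ^+ 2)); last first.
    by rewrite -[leRHS]mulr1 ler_wpM2l// sqr_ge0.
  rewrite mulr_sumr; apply: ler_sum => i _; rewrite ffunE /= natrX.
  rewrite -[x i 0 ^+ 2]real_normK ?num_real// -exprMn lerXn2r ?nnegrE ?mulr_ge0 ?(ltW c0)//.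
  by have /andP[] := kP i.
rewrite mxdot_sqr; apply: (@le_trans _ _ (\sum_(i < r) (c ^+ 2)^-1)).
  apply: ler_sum => i _; rewrite big_ord1 !mxE ffunE /=.
  have -> : x i 0 - (-1) ^+ (x i 0 < 0)%R * (k i)%:R / (4 * Num.sqrt r%:R)
     = (-1) ^+ (x i 0 < 0)%R * ((c * `|x i 0| - (k i)%:R) / c).
    have -> : (c * `|x i 0| - (k i)%:R) / c = `|x i 0| - (k i)%:R / c.
      by field; rewrite gt_eqF.
    by rewrite mulrBr mulrA -realEsign ?num_real.
  rewrite exprMn sqrr_sign mul1r expr_div_n ler_pdivrMr ?exprn_gt0//.
  rewrite mulVf ?gt_eqF ?exprn_gt0//.
  have /andP[h1 h2] := kP i; rewrite -natr1 in h2.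
  by rewrite exprn_ile1//; lra.
rewrite sumr_const card_ord grid_c2 -[leLHS]mulr_natr.
have -> : (16 * r%:R)^-1 * r%:R = 16^-1 :> R by field; rewrite pnatr_eq0 -lt0n.
exact: lexx.
Qed.

(** An exponential Markov count: on the ball the sum of the k_i is at most that of the k_i^2, hence
    at most 16 r, so the indicator is below exp(16 r - sum of k_i). The sum then factorizes, each
    factor being at most 4 <= exp 2. *)
Lemma grid_card : (#|grid_ball|)%:R <= expR (18 * r%:R) :> R.
Proof.
apply: (@le_trans _ _ (\sum_(g : grid) expR (16 * r%:R) * \prod_i expR (- ((g i).1)%:R))).
  rewrite -sum1_card natr_sum big_mkcond /=; apply: ler_sum => g _.
  rewrite -expR_sum -expRD sumrN; case: ifPn => [gb|_]; last exact: expR_ge0.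
  apply: le_trans (expR_ge1Dx _); rewrite lerDl subr_ge0; rewrite unfold_in /= in gb.
  rewrite -natr_sum -natrM ler_nat; apply: leq_trans gb.
  by apply: leq_sum => i _; case: (nat_of_ord _) => // k; rewrite expnS expn1 leq_pmulr.
rewrite -mulr_sumr -(bigA_distr_bigA (fun (_ : 'I_r) (kb : 'I_(4 * r).+1 * bool) => expR (- kb.1%:R))).
rewrite prodr_const card_ord.
have e2 : 2 <= expR 1 :> R by apply: le_trans (expR_ge1Dx 1); lra.
have H : \sum_(kb : 'I_(4 * r).+1 * bool) expR (- kb.1%:R) <= expR 2 :> R.
  rewrite -(pair_bigA _ (fun (k : 'I_(4 * r).+1) (_ : bool) => expR (- k%:R))) /=.
  apply: (@le_trans _ _ (2 * \sum_(k < (4 * r).+1) 2^-1 ^+ k)).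
    rewrite mulr_sumr; apply: ler_sum => k _; rewrite big_bool /=.
    have : expR (- k%:R) <= 2^-1 ^+ k :> R.
      rewrite expRN exprVn lef_pV2 ?posrE ?expR_gt0 ?exprn_gt0//.
      by rewrite -[k%:R]mulr1 expRM_natl lerXn2r ?nnegrE ?expR_ge0.
    lra.
  have geo m : \sum_(k < m) 2^-1 ^+ k <= 2 - 2 * 2^-1 ^+ m :> R.
    elim: m => [|m IH]; first by rewrite big_ord0 expr0; lra.
    by rewrite big_ord_recr /= exprS; lra.
  have := geo (4 * r).+1; have : 0 <= 2^-1 ^+ (4 * r).+1 :> R by rewrite exprn_ge0.
  have : 2 * 2 <= expR 2 :> R.
    have -> : 2 = 1 + 1 :> R by lra.
    by rewrite expRD; apply: ler_pM => //; lra.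
  lra.
have -> : expR (18 * r%:R) = expR (16 * r%:R) * expR 2 ^+ r :> R.
  by rewrite -expRM_natl -expRD; congr expR; ring.
rewrite ler_wpM2l ?expR_ge0// lerXn2r ?nnegrE ?expR_ge0//.
by apply: sumr_ge0 => k _; exact: expR_ge0.
Qed.

Definition grid_form (Y : 'M[R]_r) (g g' : grid) : R :=
  mxdot (grid_vec g) (Y *m grid_vec g').

(** The net has radius 1/4 on both sides, so the norm s satisfies s <= m + s / 4 + s / 4. *)
Lemma spec_norm_grid (Y : 'M[R]_r) (m : R) : 0 <= m ->
  (forall g g', grid_ball g -> grid_ball g' -> `|grid_form Y g g'| <= m) ->
  spectral_norm Y <= 2 * m.
Proof.
move=> m0 H; set s := spectral_norm Y.
have s0 : 0 <= s := spec_norm_ge0 Y.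
suff : s <= m + s / 2 by lra.
have frob_le (x : 'cV[R]_r) (t : R) : 0 <= t -> mxdot x x <= t ^+ 2 -> frobenius_norm x <= t.
  by move=> t0; rewrite -frob_sqr => h; rewrite -(@ler_pXn2r _ 2) ?nnegrE ?frob_ge0.
apply: spec_norm_le => // x x1.
have [Yx0|Yx0] := eqVneq (frobenius_norm (Y *m x)) 0; first by rewrite Yx0; lra.
have Yxp : 0 < frobenius_norm (Y *m x) by rewrite lt_def Yx0 frob_ge0.
pose y := (frobenius_norm (Y *m x))^-1 *: (Y *m x).
have y1 : frobenius_norm y = 1.
  by rewrite /y frobZ gtr0_norm ?invr_gt0// mulVf.
have yYx : mxdot y (Y *m x) = frobenius_norm (Y *m x).
  by rewrite /y mxdotZl -frob_sqr expr2 mulrA mulVf// mul1r.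
have [|g gb gx] := @grid_round x; first by rewrite -frob_sqr x1 expr1n.
have [|g' gb' gy] := @grid_round y; first by rewrite -frob_sqr y1 expr1n.
have ex : frobenius_norm (x - grid_vec g) <= 4^-1.
  by apply: frob_le => //; rewrite exprVn; apply: le_trans gx _; rewrite lef_pV2 ?posrE//; lra.
have ey : frobenius_norm (y - grid_vec g') <= 4^-1.
  by apply: frob_le => //; rewrite exprVn; apply: le_trans gy _; rewrite lef_pV2 ?posrE//; lra.
have g1 : frobenius_norm (grid_vec g') <= 1.
  by apply: frob_le => //; rewrite expr1n grid_vec_norm.
rewrite -yYx.
have -> : mxdot y (Y *m x) = grid_form Y g' g
    + mxdot (y - grid_vec g') (Y *m x) + mxdot (grid_vec g') (Y *m (x - grid_vec g)).
  by rewrite /grid_form mulmxBr !mxdot_lin; ring.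
have b1 := le_trans (ler_norm _) (H _ _ gb' gb).
have b2 : mxdot (y - grid_vec g') (Y *m x) <= 4^-1 * s.
  apply: le_trans (mxdot_le_frob _ _) _; apply: ler_pM; rewrite ?frob_ge0//.
  by apply: le_trans (spec_normP _ _) _; rewrite x1 mulr1.
have b3 : mxdot (grid_vec g') (Y *m (x - grid_vec g)) <= 1 * (s * 4^-1).
  apply: le_trans (mxdot_le_frob _ _) _; apply: ler_pM; rewrite ?frob_ge0//.
  by apply: le_trans (spec_normP _ _) _; rewrite ler_wpM2l.
lra.
Qed.

(** Bounding a maximum by a sum of even powers lets expectations be taken term by term. *)
Lemma spec_norm_grid_sum (Y : 'M[R]_r) L : ~~ odd L -> (0 < L)%N ->
  spectral_norm Y ^+ L
  <= 2 ^+ L * \sum_(g | grid_ball g) \sum_(g' | grid_ball g') grid_form Y g g' ^+ L.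
Proof.
move=> Lev L0; set Sg := \sum_(g | _) _.
have even0 (x : R) : 0 <= x ^+ L by rewrite exprn_even_ge0.
have evenN (x : R) : `|x| ^+ L = x ^+ L by rewrite -normrX ger0_norm.
have [[[g g'] /= [gb gb' Hm]]|none] := pselect (exists gg : grid * grid,
    [/\ grid_ball gg.1, grid_ball gg.2 & spectral_norm Y <= 2 * `|grid_form Y gg.1 gg.2|]).
  apply: (@le_trans _ _ ((2 * `|grid_form Y g g'|) ^+ L)).
    by rewrite lerXn2r ?nnegrE ?spec_norm_ge0 ?mulr_ge0.
  rewrite exprMn evenN ler_wpM2l ?exprn_ge0// /Sg (bigD1 g) //= (bigD1 g') //=.
  rewrite -addrA lerDl addr_ge0//; first by apply: sumr_ge0.
  by apply: sumr_ge0 => ? _; apply: sumr_ge0.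
have [s0|sn0] := eqVneq (spectral_norm Y) 0.
  rewrite s0 expr0n gtn_eqF// mulr_ge0 ?exprn_ge0//.
  by apply: sumr_ge0 => ? _; apply: sumr_ge0.
exfalso; apply: none.
apply: contrapT => /forallNP none.
have sp : 0 < spectral_norm Y by rewrite lt_def sn0 spec_norm_ge0.
pose M : R := \big[Num.max/0]_(gg : grid * grid | grid_ball gg.1 && grid_ball gg.2)
  `|grid_form Y gg.1 gg.2|.
have M0 : 0 <= M by apply: bigmax_ge_id.
have : spectral_norm Y <= 2 * M.
  apply: spec_norm_grid => // g g' gb gb'.
  apply: (@le_bigmax_cond _ _ _ 0 (g, g') _
    (fun gg : grid * grid => `|grid_form Y gg.1 gg.2|)); by rewrite gb gb'.
apply/negP; rewrite -ltNge -ltr_pdivlMl//.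
apply: bigmax_lt; first by rewrite mulr_gt0// invr_gt0.
move=> [g g'] /= /andP[gb gb']; rewrite ltr_pdivlMl// ltNge.
by apply/negP => h; apply: (none (g, g')).
Qed.

End Net.

(** * The reference matrix with Bernoulli(1/3) entries *)

Section ReferenceMatrix.
Context {R : realType}.

(* Reference model for the walk count: an entry of this matrix takes the values 2
   and -1 with probabilities 1/3 and 2/3, so that all its moments of order at
   least two are at least 1 and every good walk contributes at least 1 to the
   expected trace. *)
Definition third_mx (r : nat) (w : {ffun 'I_r * 'I_r -> bool}) : 'M[R]_r :=
  3 *: rand_mx 3^-1 (const_mx 1) w.

Let t0 : 0 <= 3^-1 :> R. Proof. by rewrite invr_ge0. Qed.
Let t1 : 3^-1 <= 1 :> R. Proof. by rewrite invf_le1//; lra. Qed.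

Lemma third_mx_tr (r : nat) w : (@third_mx r w)^T = third_mx w.
Proof. by rewrite /third_mx linearZ /= rand_mx_tr// trmx_const. Qed.

Lemma third_moment_ge0 k : 0 <= 3 ^+ k * bern_moment (3^-1 : R) k.
Proof.
have -> : 3 ^+ k * bern_moment (3^-1 : R) k = (2 ^+ k + 2 * (-1) ^+ k) / 3.
  rewrite /bern_moment mulrDr !(mulrCA (3 ^+ k)) -!exprMn.
  have -> : 3 * (1 - 3^-1) = 2 :> R by field.
  have -> : 3 * (0 - 3^-1) = -1 :> R by field.
  by field.
rewrite divr_ge0//; case: k => [|k]; first by rewrite !expr0; lra.
have : 1 <= 2 ^+ k :> R by rewrite exprn_ege1//; lra.
have : -1 <= (-1) ^+ k.+1 :> R by rewrite -signr_odd; case: odd; rewrite ?expr0 ?expr1; lra.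
by rewrite (exprS 2 k); lra.
Qed.

Lemma third_moment_ge1 k : k != 1%N -> 1 <= 3 ^+ k * bern_moment (3^-1 : R) k.
Proof.
have -> : 3 ^+ k * bern_moment (3^-1 : R) k = (2 ^+ k + 2 * (-1) ^+ k) / 3.
  rewrite /bern_moment mulrDr !(mulrCA (3 ^+ k)) -!exprMn.
  have -> : 3 * (1 - 3^-1) = 2 :> R by field.
  have -> : 3 * (0 - 3^-1) = -1 :> R by field.
  by field.
case: k => [|[|[|k]]]// _; rewrite ?expr0; try by rewrite !expr2; lra.
  by lra.
have : 1 <= 2 ^+ k :> R by rewrite exprn_ege1//; lra.
have : -1 <= (-1) ^+ k.+3 :> R by rewrite -signr_odd; case: odd; rewrite ?expr0 ?expr1; lra.
have -> : 2 ^+ k.+3 = 8 * 2 ^+ k :> R by rewrite !exprS; ring.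
lra.
Qed.

(** The scaled moments (2^k + 2 (-1)^k) / 3 are never negative, so the remaining walks do not lower
    the trace, and an edge of multiplicity 0 contributes exactly 1. *)
Lemma good_walks_third (k r : nat) :
  #|[set v : {ffun 'I_k.+1 -> 'I_r} | good_walk v]%SET|%:R
  <= bern_exp (3^-1 : R) (fun w => \tr (mpow (@third_mx r w) k.+1)).
Proof.
rewrite -sum1dep_card natr_sum big_mkcond /=.
have -> : bern_exp (3^-1 : R) (fun w => \tr (mpow (@third_mx r w) k.+1))
  = \sum_(v : {ffun 'I_k.+1 -> 'I_r}) 3 ^+ k.+1 * bern_exp (3^-1 : R)
      (fun w => \prod_i rand_mx 3^-1 (const_mx 1) w (v i) (v (ordS i))).
  rewrite -(eq_bigr _ (fun v _ => bern_expZ _ _ _)) -bern_exp_sum.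
  apply: eq_bigr => w _; congr (_ * _); rewrite tr_walks; apply: eq_bigr => v _.
  rewrite -[X in _ ^+ X](card_ord k.+1) -prodr_const -big_split /=.
  by apply: eq_bigr => i _; rewrite mxE.
apply: ler_sum => v _; rewrite walk_expectation.
have E : 3 ^+ k.+1 * \prod_e bern_moment (3^-1 : R) #|[pred i | walk_edge v i == e]|
  = \prod_e (3 ^+ #|[pred i | walk_edge v i == e]|
             * bern_moment (3^-1 : R) #|[pred i | walk_edge v i == e]|).
  rewrite big_split /=; congr (_ * _).
  rewrite -[X in _ ^+ X](card_ord k.+1) -prodr_const (partition_big (walk_edge v) xpredT) //=.
  by apply: eq_bigr => e _; rewrite prodr_const.
rewrite /good_walk; case: ifPn => [/andP[-> /forallP good]|_]; last first.
  case: ifP => _; last by rewrite mulr0.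
  rewrite big1 ?mul1r; last by move=> i _; rewrite mxE.
  by rewrite E; apply: prodr_ge0 => e _; exact: third_moment_ge0.
rewrite big1 ?mul1r; last by move=> i _; rewrite mxE.
rewrite E /=.
apply: (@le_trans _ _ (\prod_(e : 'I_r * 'I_r) 1)); first by rewrite big1_eq.
apply: ler_prod => e _; rewrite ler01 /=; apply: third_moment_ge1.
apply/negP => /card1P[i Hi].
have : i \in [pred i | walk_edge v i == e] by rewrite Hi inE.
rewrite inE => /eqP vi; have /existsP[j /andP[ji /eqP vj]] := good i.
have : j \in [pred i | walk_edge v i == e] by rewrite inE vj vi.
by rewrite Hi inE (negbTE ji).
Qed.

Lemma sum_upper (r : nat) (F : 'I_r -> 'I_r -> R) : (forall i, F i i = 0) ->
  \sum_i \sum_j F i j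
  = \sum_(e : 'I_r * 'I_r) (if (e.1 < e.2)%N then F e.1 e.2 + F e.2 e.1 else 0).
Proof.
move=> F0; rewrite -(pair_bigA _ (fun i j : 'I_r => if (i < j)%N then F i j + F j i else 0)) /=.
transitivity (\sum_(i < r) \sum_(j < r) ((if (i < j)%N then F i j else 0)
    + (if (j < i)%N then F i j else 0))).
  apply: eq_bigr => i _; apply: eq_bigr => j _.
  by case: ltngtP => [_|_|/val_inj ->]; rewrite ?addr0 ?add0r.
transitivity (\sum_(i < r) \sum_(j < r) (if (i < j)%N then F i j else 0)
   + \sum_(i < r) \sum_(j < r) (if (i < j)%N then F j i else 0)).
  rewrite [X in _ = _ + X]exchange_big /= -big_split; apply: eq_bigr => i _ /=.
  by rewrite -big_split.
rewrite -big_split; apply: eq_bigr => i _ /=.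
rewrite -big_split; apply: eq_bigr => j _ /=.
by case: ifP; rewrite ?addr0.
Qed.

Lemma third_mx_mgf (r : nat) (y x : 'cV[R]_r) (s : R) :
  mxdot y y <= 1 -> mxdot x x <= 1 ->
  bern_exp (3^-1 : R) (fun w => expR (s * mxdot y (third_mx w *m x)))
  <= expR (16 * s ^+ 2).
Proof.
move=> y1 x1.
pose cc (e : 'I_r * 'I_r) : R :=
  if (e.1 < e.2)%N then y e.1 0 * x e.2 0 + y e.2 0 * x e.1 0 else 0.
pose phi (e : 'I_r * 'I_r) (b : bool) := expR (s * cc e * (3 * (b%:R - 3^-1))).
have formE w : s * mxdot y (third_mx w *m x)
   = \sum_e s * cc e * (3 * ((w e)%:R - 3^-1)).
  have -> : mxdot y (third_mx w *m x)
     = \sum_i \sum_j y i 0 * x j 0 * third_mx w i j.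
    rewrite mxdotE; apply: eq_bigr => i _; rewrite big_ord1 [X in _ * X]mxE mulr_sumr.
    by apply: eq_bigr => j _; ring.
  rewrite sum_upper => [|i]; last by rewrite !mxE eqxx !mulr0.
  rewrite mulr_sumr; apply: eq_bigr => -[i j] _ /=; rewrite /cc /=.
  case: ifPn => [ij|_]; last by rewrite !mulr0 mul0r.
  rewrite !mxE edge_ofC [j == i]eq_sym.
  have -> : (i == j) = false by apply/negbTE; rewrite -val_eqE /= ltn_eqF.
  by rewrite /edge_of ltnNge (ltnW ij) /=; ring.
have -> : bern_exp (3^-1 : R) (fun w => expR (s * mxdot y (third_mx w *m x)))
   = \prod_e (3^-1 * phi e true + (1 - 3^-1) * phi e false).
  rewrite -bern_exp_prod; apply: eq_bigr => w _; congr (_ * _).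
  by rewrite formE expR_sum.
have step e : 3^-1 * phi e true + (1 - 3^-1) * phi e false
    <= expR (8 * s ^+ 2 * cc e ^+ 2).
  rewrite /phi; set u := s * cc e.
  have -> : u * (3 * (true%:R - 3^-1)) = 2 * u by rewrite /=; field.
  have -> : u * (3 * (false%:R - 3^-1)) = - u by rewrite /=; field.
  (* The linear terms cancel because the entry is centred: (1/3) 2 u + (2/3) (- u) = 0. *)
  have h1 := expR_le_subgaussian (2 * u); have h2 := expR_le_subgaussian (- u).
  have h3 : expR (2 * (- u) ^+ 2) <= expR (2 * (2 * u) ^+ 2).
    by rewrite ler_expR; have := sqr_ge0 u; lra.
  have -> : 8 * s ^+ 2 * cc e ^+ 2 = 2 * (2 * u) ^+ 2 by rewrite /u; ring.
  lra.
apply: (@le_trans _ _ (\prod_e expR (8 * s ^+ 2 * cc e ^+ 2))).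
  apply: ler_prod => e _; rewrite step andbT addr_ge0// mulr_ge0 ?expR_ge0//.
  by rewrite subr_ge0.
rewrite -expR_sum ler_expR -mulr_sumr.
have : \sum_e cc e ^+ 2 <= 2 * (mxdot y y * mxdot x x).
  have -> : mxdot y y * mxdot x x = \sum_(e : 'I_r * 'I_r) (y e.1 0 * x e.2 0) ^+ 2.
    rewrite !mxdot_sqr big_distrlr /= pair_bigA; apply: eq_bigr => -[i j] _ /=.
    by rewrite !big_ord1 exprMn.
  rewrite -(pair_bigA _ (fun i j => (y i 0 * x j 0) ^+ 2)) /=.
  rewrite /cc.
  apply: (@le_trans _ _ (2 * \sum_(e : 'I_r * 'I_r)
     (if (e.1 < e.2)%N then (y e.1 0 * x e.2 0) ^+ 2 + (y e.2 0 * x e.1 0) ^+ 2 else 0))).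
    rewrite mulr_sumr; apply: ler_sum => e _; case: ifP => _; last by rewrite expr0n mulr0.
    by have := sqr_ge0 (y e.1 0 * x e.2 0 - y e.2 0 * x e.1 0); lra.
  rewrite ler_wpM2l//.
  have := @sum_upper r (fun i j => if i == j then 0 else (y i 0 * x j 0) ^+ 2).
  move=> /(_ (fun i => _)) H.
  apply: (@le_trans _ _ (\sum_i \sum_j (if i == j then 0 else (y i 0 * x j 0) ^+ 2))).
    rewrite H => [|i]; last by rewrite eqxx.
    apply: ler_sum => -[i j] _ /=; case: ifP => // ij.
    have -> : (i == j) = false by apply/negbTE; rewrite -val_eqE /= ltn_eqF.
    have -> : (j == i) = false by apply/negbTE; rewrite -val_eqE /= gtn_eqF.
    exact: lexx.
  apply: ler_sum => i _; apply: ler_sum => j _; case: ifP => // _; exact: sqr_ge0.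
have yx1 : mxdot y y * mxdot x x <= 1.
  by apply: mulr_ile1; rewrite ?mxdot_ge0.
move=> H; apply: (@le_trans _ _ (8 * s ^+ 2 * 2)); last by lra.
apply: ler_wpM2l; first by rewrite mulr_ge0 ?sqr_ge0.
lra.
Qed.

(** Exponential moments at s = sqrt r cost exp(16 r), the same order as the size of the net, and L!
    / s^L <= L^h. With r = 2 L the exponent is 2 + 2 (36 + 16) = 106 times L. *)
Lemma third_mx_norm_moment (h L : nat) : (0 < h)%N -> L = (h + h)%N ->
  bern_exp (3^-1 : R) (fun w => spectral_norm (@third_mx (L + L)%N w) ^+ L)
  <= expR (106 * L%:R) * L%:R ^+ h.
Proof.
move=> h0 LE; set r := (L + L)%N.
have L0 : (0 < L)%N by rewrite LE; lia.
have r0 : (0 < r)%N by rewrite /r; lia.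
have Lev : ~~ odd L by rewrite LE addnn odd_double.
set s := Num.sqrt r%:R : R.
have s2 : s ^+ 2 = r%:R by rewrite sqr_sqrtr.
have sL : s ^+ L = r%:R ^+ h by rewrite LE addnn -mul2n exprM s2.
have sLp : 0 < s ^+ L by rewrite sL exprn_gt0// ltr0n.
have pair_bound (g g' : grid r) : grid_ball g -> grid_ball g' ->
    bern_exp (3^-1 : R) (fun w => grid_form (third_mx w) g g' ^+ L)
    <= (s ^+ L)^-1 * (L`!%:R * (2 * expR (16 * r%:R))).
  move=> gb gb'; rewrite -(ler_pM2l sLp) mulVKf ?gt_eqF// -bern_expZ.
  apply: (@le_trans _ _ (bern_exp (3^-1 : R) (fun w => L`!%:R *
     (expR (s * grid_form (third_mx w) g g') + expR (- s * grid_form (third_mx w) g g'))))).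
    apply: bern_exp_le => // w; rewrite -exprMn mulNr; exact: even_exp_le_cosh.
  rewrite bern_expZ; apply: ler_wpM2l => //.
  have -> : bern_exp (3^-1 : R) (fun w => expR (s * grid_form (third_mx w) g g')
       + expR (- s * grid_form (third_mx w) g g'))
     = bern_exp (3^-1 : R) (fun w => expR (s * grid_form (third_mx w) g g'))
       + bern_exp (3^-1 : R) (fun w => expR (- s * grid_form (third_mx w) g g')).
    by rewrite /bern_exp -big_split /=; apply: eq_bigr => w _; rewrite mulrDr.
  have b1 := third_mx_mgf s (grid_vec_norm r0 gb) (grid_vec_norm r0 gb').
  have b2 := third_mx_mgf (- s) (grid_vec_norm r0 gb) (grid_vec_norm r0 gb').
  by rewrite sqrrN s2 in b2; rewrite s2 in b1; rewrite /grid_form; lra.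
apply: (@le_trans _ _ (2 ^+ L * \sum_(g : grid r | grid_ball g) \sum_(g' : grid r | grid_ball g')
    (s ^+ L)^-1 * (L`!%:R * (2 * expR (16 * r%:R))))).
  apply: (@le_trans _ _ (bern_exp (3^-1 : R) (fun w => 2 ^+ L *
    \sum_(g : grid r | grid_ball g) \sum_(g' : grid r | grid_ball g')
      grid_form (third_mx w) g g' ^+ L))).
    by apply: bern_exp_le => // w; exact: spec_norm_grid_sum.
  rewrite bern_expZ ler_wpM2l ?exprn_ge0// bern_exp_sum; apply: ler_sum => g gb.
  by rewrite bern_exp_sum; apply: ler_sum => g' gb'; exact: pair_bound.
rewrite !sumr_const -mulrnA -[X in 2 ^+ L * X]mulr_natr natrM.
have cg := @grid_card R r.
have cg0 : 0 <= (#|@grid_ball r|)%:R :> R by [].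
have cg2 : (#|@grid_ball r|)%:R * (#|@grid_ball r|)%:R <= expR (36 * r%:R) :> R.
  have -> : 36 * r%:R = 18 * r%:R + 18 * r%:R :> R by ring.
  by rewrite expRD; apply: ler_pM.
have Lfact : L`!%:R <= L%:R ^+ h * L%:R ^+ h :> R.
  rewrite -exprD -LE -natrX ler_nat -ffactnn ffact_prod.
  rewrite -[X in (_ <= _ ^ X)%N](card_ord L) -prod_nat_const.
  by apply: leq_prod => i _; exact: leq_subr.
have sLge : L%:R ^+ h <= s ^+ L.
  by rewrite sL lerXn2r ?nnegrE// ler_nat /r leq_addr.
have q1 : (s ^+ L)^-1 * L`!%:R <= L%:R ^+ h.
  rewrite mulrC ler_pdivrMr//; apply: le_trans Lfact _.
  by rewrite ler_wpM2l ?exprn_ge0.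
have e2 : 2 <= expR 1 :> R by apply: le_trans (expR_ge1Dx 1); lra.
have q2 : 2 ^+ L * 2 <= expR (2 * L%:R) :> R.
  rewrite -exprSr; apply: (@le_trans _ _ (2 ^+ (L + L))).
    by apply: ler_weXn2l; [rewrite ler1n | lia].
  have -> : 2 * L%:R = (L + L)%:R * 1 :> R by rewrite natrD; ring.
  by rewrite expRM_natl lerXn2r ?nnegrE ?expR_ge0.
have -> : 106 * L%:R = 2 * L%:R + (36 * r%:R + 16 * r%:R) :> R.
  by rewrite /r natrD; ring.
rewrite !expRD.
have -> : 2 ^+ L * ((s ^+ L)^-1 * (L`!%:R * (2 * expR (16 * r%:R)))
    * ((#|@grid_ball r|)%:R * (#|@grid_ball r|)%:R))
  = (2 ^+ L * 2) * ((#|@grid_ball r|)%:R * (#|@grid_ball r|)%:R * expR (16 * r%:R))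
    * ((s ^+ L)^-1 * L`!%:R) by ring.
have nn (x y : R) : 0 <= x -> 0 <= y -> 0 <= x * y by exact: mulr_ge0.
apply: ler_pM; [| |apply: ler_pM|exact: q1].
- by do ?apply: nn; rewrite ?exprn_ge0 ?expR_ge0.
- by apply: nn => //; rewrite invr_ge0 ltW.
- by apply: nn; rewrite ?exprn_ge0.
- by do ?apply: nn; rewrite ?expR_ge0.
- exact: q2.
by apply: ler_wpM2r; [exact: expR_ge0 | exact: cg2].
Qed.

End ReferenceMatrix.

Section Tail.
Context {R : realType}.
Variable p : R.
Hypotheses (p0 : 0 <= p) (p1 : p <= 1).

(** The reference size 2 L meets the condition of [good_walks_compare] because n p (1 - p) <= L. The
    factor r of that lemma cancels against the r of [tr_mpow_le]. *)
Lemma rand_mx_trace_moment (n h L : nat) (a : 'M[R]_n) :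
  (0 < h)%N -> L = (h + h)%N -> (forall i j, `|a i j| <= 1) ->
  n%:R * (p * (1 - p)) <= L%:R ->
  bern_exp p (fun w => \tr (mpow (rand_mx p a w) L))
  <= n%:R * (expR (106 * L%:R) * L%:R ^+ h).
Proof.
move=> h0 LE a1 nL.
case: L LE nL => [|k] LE nL; first by lia.
set L := k.+1 in LE nL *.
have q0 : 0 <= p * (1 - p) by rewrite mulr_ge0// subr_ge0.
pose r := (L + L)%N.
have r0 : 0 < r%:R :> R by rewrite ltr0n.
have cmp := @good_walks_compare R L n r (p * (1 - p)) (ltn0Sn _) q0.
rewrite -(ler_pM2l r0).
have b1 : bern_exp p (fun w => \tr (mpow (rand_mx p a w) L))
    <= \sum_(v : {ffun 'I_L -> 'I_n} | good_walk v) (p * (1 - p)) ^+ #|walk_verts v|.-1.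
  rewrite [leRHS]big_mkcond /=.
  have -> : bern_exp p (fun w => \tr (mpow (rand_mx p a w) L))
     = \sum_(v : {ffun 'I_L -> 'I_n}) bern_exp p
         (fun w => \prod_i rand_mx p a w (v i) (v (ordS i))).
    by rewrite -bern_exp_sum; apply: eq_bigr => w _; rewrite tr_walks.
  by apply: ler_sum => v _; exact: walk_expectation_le.
apply: (@le_trans _ _ (r%:R * \sum_(v : {ffun 'I_L -> 'I_n} | good_walk v)
    (p * (1 - p)) ^+ #|walk_verts v|.-1)); first by rewrite ler_pM2l.
apply: le_trans.
  by apply: cmp; rewrite /r natrD lerD2r.
rewrite mulrCA; apply: ler_wpM2l => //.
apply: le_trans (@good_walks_third R k r) _.
apply: (@le_trans _ _ (bern_exp (3^-1 : R) (fun w =>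
    r%:R * spectral_norm (@third_mx R r w) ^+ L))); last first.
  by rewrite bern_expZ ler_pM2l//; exact: third_mx_norm_moment LE.
apply: bern_exp_le => [| |w]; rewrite ?invr_ge0//.
  by rewrite invf_le1//; lra.
by rewrite -/L LE; apply: tr_mpow_le; exact: third_mx_tr.
Qed.

(** Markov's inequality for the L-th power; 108 exceeds 106 by the 2 that appears in the
    exponent. *)
Lemma rand_mx_tail (n m : nat) (a : 'M[R]_n) : (0 < n)%N ->
  a^T = a -> (forall i j, `|a i j| <= 1) ->
  n%:R * (p * (1 - p)) <= (2 ^ m.+1)%:R ->
  bern_prob p [pred w | expR 108 * Num.sqrt (2 ^ m.+1)%:R
                        < spectral_norm (rand_mx p a w)]
  <= n%:R * expR (- (2 * (2 ^ m.+1)%:R)).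
Proof.
move=> n0 asym a1 nL; set L := (2 ^ m.+1)%N in nL *.
pose h := (2 ^ m)%N.
have LE : L = (h + h)%N by rewrite /L expnS mul2n addnn.
have h0 : (0 < h)%N by rewrite expn_gt0.
have L0 : 0 < L%:R :> R by rewrite ltr0n expn_gt0.
pose t := expR 108 * Num.sqrt L%:R : R.
have t0 : 0 < t by rewrite mulr_gt0 ?expR_gt0 ?sqrtr_gt0.
have tL : t ^+ L = expR (108 * L%:R) * L%:R ^+ h.
  rewrite exprMn -expRM_natr; congr (_ * _).
  by rewrite LE addnn -mul2n exprM sqr_sqrtr// ltW.
have sym w : (rand_mx p a w)^T = rand_mx p a w by exact: rand_mx_tr.
apply: (le_trans (@bern_markov R _ p p0 p1 _
  (fun w => \tr (mpow (rand_mx p a w) L)) (t ^+ L) (exprn_gt0 _ t0) _ _)).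
- by move=> w; rewrite LE tr_mpow_double// mxdot_ge0.
- move=> w /=; apply: contraTT; rewrite -ltNge -leNgt => tr_lt.
  apply: spec_norm_le => // x x1.
  rewrite -(@ler_pXn2r _ L) ?nnegrE ?frob_ge0 ?(ltW t0)//; last first.
    by rewrite expn_gt0.
  by apply: le_trans (ltW tr_lt); exact: norm_mul_trace.
rewrite ler_pdivrMr ?exprn_gt0// tL.
apply: le_trans (rand_mx_trace_moment h0 LE a1 nL) _.
rewrite -mulrA ler_wpM2l// mulrA -expRD.
have -> : - (2 * L%:R) + 108 * L%:R = 106 * L%:R :> R by ring.
exact: lexx.
Qed.

End Tail.

(** * A lower bound for sampled quadratic forms *)

Section BiasedCube.
Context {R : realType}.
Variable I : finType.
Variable b : I -> R.
Hypothesis b1 : forall i, `|b i| <= 1.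

Definition sgn (s : bool) : R := if s then 1 else -1.

Definition cube_weight (th : {ffun I -> bool}) : R :=
  \prod_i ((1 + b i * sgn (th i)) / 2).

Definition cube_exp (f : {ffun I -> bool} -> R) : R := \sum_th cube_weight th * f th.

Lemma cube_factor_ge0 i s : 0 <= (1 + b i * sgn s) / 2.
Proof.
have := b1 i; rewrite ler_norml => /andP[h1 h2].
by rewrite divr_ge0//; case: s; rewrite /sgn; lra.
Qed.

Lemma cube_weight_ge0 th : 0 <= cube_weight th.
Proof. by apply: prodr_ge0 => i _; exact: cube_factor_ge0. Qed.

Lemma cube_exp_prod (phi : I -> bool -> R) :
  cube_exp (fun th => \prod_i phi i (th i))
  = \prod_i ((1 + b i) / 2 * phi i true + (1 - b i) / 2 * phi i false).
Proof.
transitivity (\sum_(th : {ffun I -> bool}) \prod_i ((1 + b i * sgn (th i)) / 2 * phi i (th i))).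
  by apply: eq_bigr => w _; rewrite big_split.
rewrite -(bigA_distr_bigA (fun i s => (1 + b i * sgn s) / 2 * phi i s)).
by apply: eq_bigr => i _; rewrite big_bool /sgn mulr1 mulrN1.
Qed.

Lemma cube_exp1 : \sum_th cube_weight th = 1.
Proof.
transitivity (cube_exp (fun th => \prod_i (fun _ _ => 1) i (th i))).
  by apply: eq_bigr => th _; rewrite big1_eq mulr1.
by rewrite (cube_exp_prod (fun _ _ => 1)) big1// => i _; lra.
Qed.

Lemma cube_exp_le f g : (forall th, f th <= g th) -> cube_exp f <= cube_exp g.
Proof. by move=> fg; apply: ler_sum => th _; rewrite ler_wpM2l ?cube_weight_ge0. Qed.

Lemma cube_expD f g : cube_exp (fun th => f th + g th) = cube_exp f + cube_exp g.
Proof. by rewrite /cube_exp -big_split; apply: eq_bigr => th _; rewrite mulrDr. Qed.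

Lemma cube_expZ c f : cube_exp (fun th => c * f th) = c * cube_exp f.
Proof. by rewrite /cube_exp mulr_sumr; apply: eq_bigr => th _; rewrite mulrCA. Qed.

Lemma cube_exp_cst c : cube_exp (fun=> c) = c.
Proof. by rewrite /cube_exp -mulr_suml cube_exp1 mul1r. Qed.

Lemma cube_exp_sum (J : finType) (P : pred J) (f : J -> {ffun I -> bool} -> R) :
  cube_exp (fun th => \sum_(j | P j) f j th) = \sum_(j | P j) cube_exp (f j).
Proof. by rewrite /cube_exp exchange_big; apply: eq_bigr => th _; rewrite mulr_sumr. Qed.

Lemma cube_exp_coord1 i : cube_exp (fun th => sgn (th i)) = b i.
Proof.
transitivity (cube_exp (fun th => \prod_j (fun j s => if j == i then sgn s else 1) j (th j))).
  apply: eq_bigr => th _; congr (_ * _).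
  by rewrite (bigD1 i) //= eqxx big1 ?mulr1// => j /negbTE ->.
rewrite (cube_exp_prod (fun j s => if j == i then sgn s else 1)) (bigD1 i) //= eqxx big1.
  by rewrite /sgn; field.
by move=> j /negbTE ->; field.
Qed.

Lemma cube_exp_coord2 i j : cube_exp (fun th => sgn (th i) * sgn (th j))
  = if i == j then 1 else b i * b j.
Proof.
case: eqVneq => [->|ij].
  rewrite -[RHS](cube_exp_cst 1); apply: eq_bigr => th _; congr (_ * _).
  by rewrite /sgn; case: (th j); rewrite ?mulr1 ?mulrNN ?mulr1.
pose phi k s : R := if k == i then sgn s else if k == j then sgn s else 1.
transitivity (cube_exp (fun th => \prod_k phi k (th k))).
  apply: eq_bigr => th _; congr (_ * _).
  rewrite (bigD1 i) //= (bigD1 j) /= ?(eq_sym j)// /phi eqxx eq_sym (negbTE ij) eqxx.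
  by rewrite big1 ?mulr1// => k /andP[/negbTE -> /negbTE ->].
rewrite cube_exp_prod (bigD1 i) //= (bigD1 j) /= ?(eq_sym j)// /phi.
rewrite !eqxx eq_sym (negbTE ij) [X in _ * (_ * X)]big1.
  by rewrite /sgn; field.
by move=> k /andP[/negbTE -> /negbTE ->]; field.
Qed.

Lemma cube_exp_jensen f : expR (cube_exp f) <= cube_exp (fun th => expR (f th)).
Proof.
set m := cube_exp f.
have H : cube_exp (fun th => expR m * (1 + (f th - m))) <= cube_exp (fun th => expR (f th)).
  apply: cube_exp_le => th.
  have -> : expR (f th) = expR m * expR (f th - m) by rewrite -expRD; congr expR; lra.
  by apply: ler_wpM2l; [exact: expR_ge0 | exact: expR_ge1Dx].
apply: le_trans H; rewrite cube_expZ cube_expD cube_exp_cst.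
have -> : cube_exp (fun th => f th - m) = 0.
  by rewrite cube_expD (cube_exp_cst (- m)) subrr.
by rewrite addr0 mulr1.
Qed.

Section LinearForm.
Variables (u : I -> R) (v mu h : R).
Hypotheses (mu0 : 0 < mu) (h0 : 0 < h) (umu : \sum_i u i ^+ 2 <= mu).
Let y := \sum_i u i * (h * b i).
Let lin (th : {ffun I -> bool}) := \sum_i u i * (h * sgn (th i)).

Lemma cube_exp_lin_sqr :
  cube_exp (fun th => lin th ^+ 2)
  = y ^+ 2 + h ^+ 2 * \sum_i u i ^+ 2 - \sum_i u i ^+ 2 * (h * b i) ^+ 2.
Proof.
transitivity (\sum_i \sum_j u i * u j * h ^+ 2
   * cube_exp (fun th => sgn (th i) * sgn (th j))).
  transitivity (cube_exp (fun th => \sum_i \sum_j u i * u j * h ^+ 2 * (sgn (th i) * sgn (th j)))).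
    apply: eq_bigr => th _; congr (_ * _); rewrite expr2 /lin big_distrlr /=.
    by apply: eq_bigr => i _; apply: eq_bigr => j _; ring.
  rewrite cube_exp_sum; apply: eq_bigr => i _; rewrite cube_exp_sum.
  by apply: eq_bigr => j _; rewrite cube_expZ.
rewrite [y ^+ 2]expr2 /y big_distrlr /= mulr_sumr -big_split -sumrB /=; apply: eq_bigr => i _.
rewrite (bigD1 i) //= [in RHS](bigD1 i) //= cube_exp_coord2 eqxx.
rewrite (eq_bigr (fun j => u i * (h * b i) * (u j * (h * b j)))) => [|j ji]; last first.
  by rewrite cube_exp_coord2 eq_sym (negbTE ji); ring.
ring.
Qed.

(** Stated for s = 1 and s = -1 together, as [even_exp_le_cosh] needs both. The 8 arises because sgn
    - b_i has absolute value at most 2. *)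
Lemma cube_exp_mgf (s : R) : s ^+ 2 = 1 ->
  cube_exp (fun th => expR (s * ((lin th - y) / (h * Num.sqrt mu)))) <= expR 8.
Proof.
move=> s2; have m0 : 0 < Num.sqrt mu by rewrite sqrtr_gt0.
have mm : Num.sqrt mu ^+ 2 = mu by rewrite sqr_sqrtr// ltW.
pose c i := s * u i / Num.sqrt mu.
pose phi i t := expR (c i * (sgn t - b i)).
have -> : cube_exp (fun th => expR (s * ((lin th - y) / (h * Num.sqrt mu))))
    = cube_exp (fun th => \prod_i phi i (th i)).
  apply: eq_bigr => th _; congr (_ * _); rewrite -expR_sum; congr expR.
  rewrite /lin /y -sumrB mulr_suml mulr_sumr; apply: eq_bigr => i _.
  by rewrite /c; field; rewrite !gt_eqF.
rewrite cube_exp_prod; apply: (@le_trans _ _ (\prod_i expR (8 * c i ^+ 2))); last first.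
  rewrite -expR_sum ler_expR -mulr_sumr.
  have -> : \sum_i c i ^+ 2 = (\sum_i u i ^+ 2) / mu.
    rewrite mulr_suml; apply: eq_bigr => i _.
    by rewrite /c expr_div_n exprMn s2 mul1r mm.
  rewrite -[leRHS]mulr1 ler_wpM2l// ler_pdivrMr// mul1r//.
apply: ler_prod => i _.
have := b1 i; rewrite ler_norml => /andP[h1 h2].
apply/andP; split.
  by rewrite addr_ge0// mulr_ge0 ?expR_ge0// divr_ge0//; lra.
rewrite /phi /sgn.
have e1 := expR_le_subgaussian (c i * (1 - b i)).
have e2 := expR_le_subgaussian (c i * (-1 - b i)).
have f1 : expR (2 * (c i * (1 - b i)) ^+ 2) <= expR (8 * c i ^+ 2).
  rewrite ler_expR exprMn; have := sqr_ge0 (c i).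
  have : (1 - b i) ^+ 2 <= 4 by nra.
  nra.
have f2 : expR (2 * (c i * (-1 - b i)) ^+ 2) <= expR (8 * c i ^+ 2).
  rewrite ler_expR exprMn; have := sqr_ge0 (c i).
  have : (-1 - b i) ^+ 2 <= 4 by nra.
  nra.
have g1 : expR (c i * (1 - b i)) <= c i * (1 - b i) + expR (8 * c i ^+ 2) by lra.
have g2 : expR (c i * (-1 - b i)) <= c i * (-1 - b i) + expR (8 * c i ^+ 2) by lra.
have k1 : 0 <= (1 + b i) / 2 by rewrite divr_ge0//; lra.
have k2 : 0 <= (1 - b i) / 2 by rewrite divr_ge0//; lra.
have := ler_wpM2l k1 g1; have := ler_wpM2l k2 g2; lra.
Qed.

(** The constant is 4! times the two exponential moments of the normalized deviation. *)
Lemma cube_exp_fourth :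
  cube_exp (fun th => (lin th - y) ^+ 4) <= 48 * expR 8 * (h ^+ 4 * mu ^+ 2).
Proof.
have m0 : 0 < Num.sqrt mu by rewrite sqrtr_gt0.
have m4 : Num.sqrt mu ^+ 4 = mu ^+ 2 by rewrite (exprM _ 2 2) sqr_sqrtr// ltW.
have d0 : 0 < h * Num.sqrt mu by rewrite mulr_gt0.
pose tau th := (lin th - y) / (h * Num.sqrt mu).
have -> : cube_exp (fun th => (lin th - y) ^+ 4)
    = h ^+ 4 * mu ^+ 2 * cube_exp (fun th => tau th ^+ 4).
  rewrite -cube_expZ; apply: eq_bigr => th _; congr (_ * _).
  by rewrite -m4 -exprMn -exprMn; congr (_ ^+ 4); rewrite /tau mulrC divfK// gt_eqF.
rewrite mulrC ler_wpM2r ?mulr_ge0 ?exprn_ge0 ?(ltW h0) ?(ltW mu0)//.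
apply: (@le_trans _ _ (cube_exp (fun th => 24 * (expR (1 * tau th) + expR (-1 * tau th))))).
  apply: cube_exp_le => th; rewrite mul1r mulN1r.
  by apply: le_trans (even_exp_le_cosh _ _) _.
rewrite cube_expZ cube_expD.
have n1 : (-1) ^+ 2 = 1 :> R by rewrite sqrrN expr1n.
have := cube_exp_mgf (expr1n R 2); have := cube_exp_mgf n1.
rewrite -/tau; lra.
Qed.

End LinearForm.
End BiasedCube.

(** * Change of measure on the cube *)

Section PacBayes.
Context {R : realType}.
Variables (T K I : finType) (p : R) (D : pred K) (f : K -> T) (U : K -> I -> R).
Variables (mu h t x : R).
Hypotheses (p0 : 0 <= p) (p1 : p <= 1) (finj : {in D &, injective f}).
Hypotheses (mu0 : 0 < mu) (Umu : forall k, \sum_i U k i ^+ 2 <= mu).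
Hypotheses (h0 : 0 < h) (t0 : 0 <= t) (thmu : t * (h ^+ 2 * mu) <= 1).

Let lin (k : K) (th : {ffun I -> bool}) : R := \sum_i U k i * (h * sgn (th i)).
Let dev (k : K) (th : {ffun I -> bool}) : R :=
  lin k th ^+ 2 - h ^+ 2 * \sum_i U k i ^+ 2.
(* The second summand compensates the log-Laplace transform of the first, so that
   the exponential of expo has mean at most 1 for every th, hence also on average
   over the cube. *)
Let expo (w : {ffun T -> bool}) (th : {ffun I -> bool}) : R :=
  \sum_(k | D k) (- t * (w (f k))%:R * dev k th
                  + (p * t * dev k th - 2 * p * t ^+ 2 * dev k th ^+ 2)).
Let avg (w : {ffun T -> bool}) : R :=
  \sum_(th : {ffun I -> bool}) 2^-1 ^+ #|I| * expR (expo w th).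

(** The argument is one-sided: dev >= - h^2 mu, so - t dev <= 1 by [thmu] and the quadratic bound on
    the exponential applies although dev has no comparable upper bound. *)
Lemma expo_mgf th : bern_exp p (fun w => expR (expo w th)) <= 1.
Proof.
pose phi k (b : bool) := expR (- t * b%:R * dev k th
                  + (p * t * dev k th - 2 * p * t ^+ 2 * dev k th ^+ 2)).
have -> : bern_exp p (fun w => expR (expo w th))
   = bern_exp p (fun w => \prod_(k | D k) phi k (w (f k))).
  by apply: eq_bigr => w _; rewrite /expo expR_sum.
rewrite (bern_exp_indep _ phi finj).
apply: (@le_trans _ _ (\prod_(k | D k) 1)); last by rewrite big1_eq.
apply: ler_prod => k _; rewrite /phi; set a := dev k th.
have q0 : 0 <= 1 - p by rewrite subr_ge0.
rewrite addr_ge0 ?mulr_ge0 ?expR_ge0//=.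
have a1 : - t * a <= 1.
  apply: le_trans thmu; rewrite mulNr -mulrN; apply: ler_wpM2l => //.
  rewrite /a /dev opprB; have := ler_wpM2l (sqr_ge0 h) (Umu k).
  by have := sqr_ge0 (lin k th); lra.
have e1 := expR_le_quadratic a1.
set s := p * t * a - _.
have -> : expR (- t * true%:R * a + s) = expR s * expR (- t * a).
  by rewrite -expRD; congr expR; rewrite /=; ring.
have -> : expR (- t * false%:R * a + s) = expR s by congr expR; rewrite /=; ring.
have e3 : p * expR (- t * a) + (1 - p) <= expR (- s).
  apply: le_trans (expR_ge1Dx _).
  have := ler_wpM2l p0 e1; rewrite /s; lra.
have := ler_wpM2l (expR_ge0 s) e3; rewrite expRxMexpNx_1; lra.
Qed.

Lemma avg_ge0 w : 0 <= avg w.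
Proof. by apply: sumr_ge0 => th _; rewrite mulr_ge0 ?expR_ge0 ?exprn_ge0. Qed.

(** Markov's inequality for the averaged exponential: one exceptional event, independent of z. *)
Lemma avg_tail : bern_prob p [pred w | expR x < avg w] <= expR (- x).
Proof.
have half0 : 0 <= 2^-1 ^+ #|I| :> R by rewrite exprn_ge0.
have m : bern_exp p avg <= 1.
  rewrite /avg bern_exp_sum.
  apply: (@le_trans _ _ (\sum_(th : {ffun I -> bool}) 2^-1 ^+ #|I|)).
    apply: ler_sum => th _; rewrite bern_expZ -[leRHS]mulr1 ler_wpM2l//.
    exact: expo_mgf.
  rewrite sumr_const card_ffun card_bool -[leLHS]mulr_natr natrX -exprMn mulVf// expr1n.
apply: (le_trans (@bern_markov R _ p p0 p1 _ avg (expR x) (expR_gt0 _) avg_ge0 _)).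
  by move=> w /= /ltW.
by rewrite expRN ler_pdivrMr ?expR_gt0// mulVf ?gt_eqF ?expR_gt0.
Qed.

(* Jensen's inequality after tilting the cube so that h * sgn th has mean z; the
   entropy of the tilt costs at most h^-2. *)
Lemma avg_posterior w (z : I -> R) (y : K -> R) : avg w <= expR x ->
  (forall k, y k = \sum_i U k i * z i) ->
  (forall i, `|z i| <= h) -> \sum_i z i ^+ 2 <= 1 ->
  t * p * (\sum_(k | D k) y k ^+ 2)
    - t * p * (\sum_(k | D k) \sum_i U k i ^+ 2 * z i ^+ 2)
    - 2 * p * t ^+ 2 * (16 * mu * (\sum_(k | D k) y k ^+ 2)
        + (16 * (48 * expR 8) + 2) * (h ^+ 4 * mu ^+ 2) * #|D|%:R)
    - (h ^+ 2)^-1 - x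
  <= t * \sum_(k | D k) (w (f k))%:R * y k ^+ 2.
Proof.
move=> avgx yE0 zh z1.
pose b i := z i / h.
have b1 i : `|b i| <= 1 by rewrite /b normrM normfV (gtr0_norm h0) ler_pdivrMr// mul1r.
have hb i : h * b i = z i by rewrite /b mulrC divfK// gt_eqF.
have yE k : \sum_i U k i * (h * b i) = y k.
  by rewrite yE0; apply: eq_bigr => i _; rewrite hb.
pose lng th := expo w th - \sum_i b i * sgn (th i).
(* From 1 + v <= exp v. The mean of this log-density bound is the sum of the b_i^2, at most h^-2,
   and plays the role of the relative entropy. *)
have wle th : cube_weight b th <= 2^-1 ^+ #|I| * expR (\sum_i b i * sgn (th i)).
  rewrite expR_sum -prodr_const -big_split /=; apply: ler_prod => i _.
  rewrite cube_factor_ge0//= mulrC ler_wpM2l// expR_ge1Dx//.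
have step1 : cube_exp b lng <= x.
  rewrite -ler_expR; apply: le_trans avgx.
  apply: le_trans (cube_exp_jensen b1 _) _; apply: ler_sum => th _.
  rewrite /lng expRD mulrA mulrAC.
  apply: (@le_trans _ _ ((2^-1 ^+ #|I| * expR (\sum_i b i * sgn (th i)))
      * expR (- \sum_i b i * sgn (th i)) * expR (expo w th))).
    rewrite ler_wpM2r ?expR_ge0// ler_wpM2r ?expR_ge0//.
  by rewrite -[X in X * _]mulrA expRxMexpNx_1 mulr1.
have bias : cube_exp b (fun th => \sum_i b i * sgn (th i)) = (h ^+ 2)^-1 * \sum_i z i ^+ 2.
  rewrite cube_exp_sum mulr_sumr; apply: eq_bigr => i _.
  by rewrite cube_expZ cube_exp_coord1 /b; field; rewrite gt_eqF.
have devE k : cube_exp b (dev k) = y k ^+ 2 - \sum_i U k i ^+ 2 * z i ^+ 2.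
  rewrite /dev cube_expD cube_exp_cst cube_exp_lin_sqr yE.
  under [X in _ - X - _]eq_bigr do rewrite hb.
  ring.
have y2 k : y k ^+ 2 <= mu.
  rewrite yE0; apply: le_trans (sum_cauchy_sqr _ _) _.
  by rewrite -[leRHS]mulr1 ler_pM ?sum_sqr_ge0.
(* Splitting lin as y plus its deviation costs 16 y^4, 16 fourth moments, and 2 for the square of
   the subtracted mean; y^4 <= mu y^2 keeps the first term quadratic. *)
have dev2 k : cube_exp b (fun th => dev k th ^+ 2)
    <= 16 * mu * y k ^+ 2 + (16 * (48 * expR 8) + 2) * (h ^+ 4 * mu ^+ 2).
  apply: (@le_trans _ _ (cube_exp b (fun th =>
     (16 * y k ^+ 4 + 2 * (h ^+ 4 * mu ^+ 2)) + 16 * (lin k th - y k) ^+ 4))).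
    apply: cube_exp_le => // th.
    have s0 : 0 <= h ^+ 2 * (\sum_i U k i ^+ 2) by rewrite mulr_ge0 ?sqr_ge0 ?sum_sqr_ge0.
    have s1 : h ^+ 2 * (\sum_i U k i ^+ 2) <= h ^+ 2 * mu by rewrite ler_wpM2l ?sqr_ge0.
    have s2 : (h ^+ 2 * (\sum_i U k i ^+ 2)) ^+ 2 <= h ^+ 4 * mu ^+ 2.
      have -> : h ^+ 4 * mu ^+ 2 = (h ^+ 2 * mu) ^+ 2 by ring.
      by rewrite lerXn2r ?nnegrE ?(le_trans s0).
    rewrite /dev; move: s2; set s := h ^+ 2 * _; set l := lin k th; set e := y k.
    have q1 : (l ^+ 2 - s) ^+ 2 <= 2 * l ^+ 4 + 2 * s ^+ 2.
      by have := sqr_ge0 (l ^+ 2 + s); lra.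
    have q2 : l ^+ 4 <= 8 * e ^+ 4 + 8 * (l - e) ^+ 4.
      have r1 : l ^+ 2 <= 2 * e ^+ 2 + 2 * (l - e) ^+ 2.
        by have := sqr_ge0 (l - 2 * e); lra.
      have r2 : l ^+ 2 * l ^+ 2 <= (2 * e ^+ 2 + 2 * (l - e) ^+ 2) ^+ 2.
        by rewrite -expr2; apply: lerXn2r; rewrite ?nnegrE ?sqr_ge0//; have := sqr_ge0 e; have := sqr_ge0 (l - e); lra.
      by have := sqr_ge0 (e ^+ 2 - (l - e) ^+ 2); lra.
    lra.
  rewrite cube_expD cube_exp_cst cube_expZ.
  have := cube_exp_fourth b1 mu0 h0 (Umu k); rewrite yE -/(lin k).
  have : y k ^+ 4 <= mu * y k ^+ 2.
    have -> : y k ^+ 4 = y k ^+ 2 * y k ^+ 2 by ring.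
    by rewrite ler_wpM2r ?sqr_ge0.
  lra.
have expoE : cube_exp b (expo w)
    = \sum_(k | D k) ((p * t - t * (w (f k))%:R) * cube_exp b (dev k)
        - 2 * p * t ^+ 2 * cube_exp b (fun th => dev k th ^+ 2)).
  rewrite /expo cube_exp_sum; apply: eq_bigr => k _.
  rewrite /cube_exp !mulr_sumr -sumrB; apply: eq_bigr => th _; ring.
have lngE : cube_exp b lng = cube_exp b (expo w) - (h ^+ 2)^-1 * \sum_i z i ^+ 2.
  by rewrite /lng -bias /cube_exp -sumrB; apply: eq_bigr => th _; ring.
have kl : (h ^+ 2)^-1 * (\sum_i z i ^+ 2) <= (h ^+ 2)^-1.
  by rewrite -[leRHS]mulr1 ler_wpM2l// invr_ge0 sqr_ge0.
have main : \sum_(k | D k) ((p * t - t * (w (f k))%:R) * cube_exp b (dev k)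
        - 2 * p * t ^+ 2 * cube_exp b (fun th => dev k th ^+ 2)) <= x + (h ^+ 2)^-1.
  by rewrite -expoE; move: step1; rewrite lngE; lra.
set bnd := \sum_(k | D k) _ in main.
suff : \sum_(k | D k) (t * p * y k ^+ 2 - t * p * (\sum_i U k i ^+ 2 * z i ^+ 2)
      - 2 * p * t ^+ 2 * (16 * mu * y k ^+ 2
          + (16 * (48 * expR 8) + 2) * (h ^+ 4 * mu ^+ 2))
      - t * ((w (f k))%:R * y k ^+ 2))
    <= bnd.
  have cst c : \sum_(k | D k) c = c * #|D|%:R :> R by rewrite sumr_const -[LHS]mulr_natr.
  rewrite !sumrB -!mulr_sumr big_split /= -!mulr_sumr cst.
  move: main; lra.
rewrite /bnd; apply: ler_sum => k _; rewrite devE.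
have v0 : 0 <= \sum_i U k i ^+ 2 * z i ^+ 2.
  by apply: sumr_ge0 => i _; rewrite mulr_ge0 ?sqr_ge0.
have := ler_wpM2l (_ : 0 <= 2 * p * t ^+ 2) (dev2 k).
rewrite !mulr_ge0 ?sqr_ge0// => /(_ isT).
have : 0 <= t * (w (f k))%:R * \sum_i U k i ^+ 2 * z i ^+ 2 by rewrite !mulr_ge0.
lra.
Qed.

End PacBayes.

(** * The lower bound for one column of the mask *)

Section ColumnGap.
Context {R : realType}.
Variables (n r : nat) (p mu x : R) (U : 'M[R]_(n, r)) (l : 'I_n).
Hypotheses (p0 : 0 < p) (p1 : p <= 1) (np1 : 1 <= n%:R * p) (x0 : 0 <= x).
Hypothesis rowU : forall k, \sum_a U k a ^+ 2 <= mu.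

(** The 2 pays for the missing diagonal term and for the coordinate variances, the bracket for the
    second moments of dev, and the rest is (h^-2 + x) / t divided by mu. *)
Definition gap_const : R := 2 + (16 * (48 * expR 8) + 2) + 32 * 48 * (Num.sqrt (n%:R * p) + x).

Definition column_gap (w : {ffun 'I_n * 'I_n -> bool}) : Prop :=
  forall z : 'cV[R]_r, p * (47 / 48) * \sum_k (U *m z) k 0 ^+ 2
    <= \sum_k ((k != l) && w (edge_of k l))%:R * (U *m z) k 0 ^+ 2
       + mu * gap_const * mxdot z z.

Lemma gap_n0 : (0 < n)%N.
Proof. exact: leq_ltn_trans (leq0n l) (ltn_ord l). Qed.

Lemma gap_const_ge0 : 0 <= gap_const.
Proof.
have e8 : 0 <= expR (8 : R) := expR_ge0 _.
have s0 : 0 <= Num.sqrt (n%:R * p) := sqrtr_ge0 _.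
by rewrite /gap_const; move: x0 e8 s0; lra.
Qed.

Lemma gap_mu_ge0 : 0 <= mu.
Proof. by apply: le_trans (rowU l); exact: sum_sqr_ge0. Qed.

Lemma column_gap_unit (w : {ffun 'I_n * 'I_n -> bool}) :
  (forall z : 'cV[R]_r, mxdot z z = 1 ->
     p * (47 / 48) * \sum_k (U *m z) k 0 ^+ 2
     <= \sum_k ((k != l) && w (edge_of k l))%:R * (U *m z) k 0 ^+ 2 + mu * gap_const) ->
  column_gap w.
Proof.
move=> H z; have [->|zn0] := eqVneq z 0.
  rewrite mulmx0 mxdot0r mulr0 addr0 big1 ?mulr0; last by move=> k _; rewrite mxE expr0n.
  by apply: sumr_ge0 => k _; rewrite mulr_ge0 ?sqr_ge0.
have zz := mxdot_gt0 zn0.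
pose c := frobenius_norm z.
have c2 : c ^+ 2 = mxdot z z by rewrite frob_sqr.
have c0 : 0 < c.
  rewrite lt_def frob_ge0 andbT; apply/eqP => c00.
  by move: c2; rewrite c00 expr0n /= => c2; rewrite -c2 ltxx in zz.
pose z1 := c^-1 *: z.
have z11 : mxdot z1 z1 = 1.
  by rewrite mxdotZl mxdotZr -c2; field; rewrite gt_eqF.
have Uz k : (U *m z) k 0 = c * (U *m z1) k 0.
  by rewrite /z1 -scalemxAr [in RHS]mxE mulVKf// gt_eqF.
have E (F : 'I_n -> R) : \sum_k F k * (U *m z) k 0 ^+ 2
    = c ^+ 2 * \sum_k F k * (U *m z1) k 0 ^+ 2.
  by rewrite mulr_sumr; apply: eq_bigr => k _; rewrite Uz; ring.
have E1 : \sum_k (U *m z) k 0 ^+ 2 = c ^+ 2 * \sum_k (U *m z1) k 0 ^+ 2.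
  by rewrite mulr_sumr; apply: eq_bigr => k _; rewrite Uz; ring.
have c20 : 0 <= c ^+ 2 := sqr_ge0 c.
rewrite E E1 -c2; have := ler_wpM2l c20 (H z1 z11); lra.
Qed.

(** Each coordinate of z is split into n equal copies, so that every unit vector fits into a cube of
    half-width h = (n p)^(-1/4) >= n^(-1/2), and the coordinate variances add up to at most mu. *)
Lemma column_gap_tail :
  bern_prob p [pred w | ~~ `[< column_gap w >] ] <= expR (- x).
Proof.
have n0 := gap_n0; have n0R : 0 < n%:R :> R by rewrite ltr0n.
have muge0 := gap_mu_ge0.
have [mu00|mun0] := eqVneq mu 0.
  apply: (@le_trans _ _ 0); last exact: expR_ge0.
  rewrite /bern_prob /bern_exp big1// => w _.
  suff -> : [pred w | ~~ `[< column_gap w >] ] w = false by rewrite mulr0.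
  apply/negbTE; rewrite /= negbK; apply/asboolP => z.
  have U0 : U = 0.
    apply/matrixP => k a; rewrite mxE; apply/eqP; rewrite -sqrf_eq0 eq_le sqr_ge0 andbT.
    apply: (@le_trans _ _ (\sum_a U k a ^+ 2)); last by rewrite -[leRHS]mu00; exact: rowU.
    by rewrite (bigD1 a) //= lerDl sum_sqr_ge0.
  rewrite U0 mul0mx mu00 mul0r mul0r addr0.
  rewrite big1 ?mulr0; last by move=> k _; rewrite mxE expr0n.
  by apply: sumr_ge0 => k _; rewrite mulr_ge0 ?sqr_ge0.
have mu0 : 0 < mu by rewrite lt_def mun0.
pose np : R := Num.sqrt (n%:R * p).
have np00 : 0 < n%:R * p by rewrite mulr_gt0.
have np2 : np ^+ 2 = n%:R * p by rewrite sqr_sqrtr// ltW.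
have np1' : 1 <= np.
  by rewrite -(@ler_pXn2r _ 2) ?nnegrE ?sqrtr_ge0// np2 expr1n; exact: np1.
have np0 : 0 < np by exact: lt_le_trans np1'.
(* This choice makes h^4 n p = 1, which bounds the second moment term, while the entropy h^-2 is
   only sqrt(n p). *)
pose h := Num.sqrt np^-1.
have h2 : h ^+ 2 = np^-1 by rewrite sqr_sqrtr// invr_ge0 ltW.
have h0 : 0 < h by rewrite sqrtr_gt0 invr_gt0.
(* Makes 2 p t^2 * 16 mu equal to p t / 48: the 1/48 lost in [column_gap]. *)
pose t := (32 * 48 * mu)^-1.
have tm : 0 < 32 * 48 * mu by rewrite mulr_gt0//; lra.
have t0 : 0 < t by rewrite invr_gt0.
have sn : 0 < Num.sqrt n%:R :> R by rewrite sqrtr_gt0.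
have sn2 : Num.sqrt n%:R ^+ 2 = n%:R :> R by rewrite sqr_sqrtr.
pose U' (k : 'I_n) (ib : 'I_r * 'I_n) := U k ib.1 / Num.sqrt n%:R.
have rep (F : 'I_r -> R) : \sum_(ib : 'I_r * 'I_n) F ib.1 / n%:R = \sum_i F i.
  rewrite -(pair_bigA _ (fun i (_ : 'I_n) => F i / n%:R)) /=; apply: eq_bigr => i _.
  by rewrite sumr_const card_ord -[LHS]mulr_natr divfK// gt_eqF.
have U'mu k : \sum_ib U' k ib ^+ 2 <= mu.
  apply: le_trans (rowU k); rewrite -(rep (fun i => U k i ^+ 2)).
  by apply: ler_sum => ib _; rewrite /U' expr_div_n sn2.
have inj : {in (fun k => k != l) &, injective (fun k : 'I_n => edge_of k l)}.
  move=> k k' _ _; rewrite /edge_of; case: ifP => _; case: ifP => _ [] // ? ?; congruence.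
have thmu : t * (h ^+ 2 * mu) <= 1.
  rewrite h2 /t mulrC ler_pdivrMr// mul1r.
  have : np^-1 <= 1 by rewrite invf_le1.
  nra.
have tail := @avg_tail R _ _ _ p (fun k => k != l) (fun k => edge_of k l) U' mu h t x
  (ltW p0) p1 inj U'mu (ltW t0) thmu.
apply: le_trans tail; apply: bern_exp_le; rewrite ?(ltW p0)// => w.
rewrite ler_nat /=.
case: asboolP => // ngap; rewrite lt0b ltNge.
apply/negP => avgx; apply: ngap; apply: column_gap_unit => z z1.
pose z' (ib : 'I_r * 'I_n) := z ib.1 0 / Num.sqrt n%:R.
have zsum : \sum_i z i 0 ^+ 2 = 1.
  by rewrite -z1 mxdot_sqr; apply: eq_bigr => i _; rewrite big_ord1.
have z'1 : \sum_ib z' ib ^+ 2 <= 1.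
  rewrite -zsum -(rep (fun i => z i 0 ^+ 2)); apply: ler_sum => ib _.
  by rewrite /z' expr_div_n sn2.
have zb i : z i 0 ^+ 2 <= 1.
  by rewrite -zsum (bigD1 i) //= lerDl sum_sqr_ge0.
have z'b ib : z' ib ^+ 2 <= n%:R^-1.
  by rewrite /z' expr_div_n sn2 -[leRHS]mul1r ler_wpM2r ?invr_ge0.
have npn : np <= n%:R.
  rewrite -(@ler_pXn2r _ 2) ?nnegrE ?(ltW np0)// np2.
  rewrite expr2 ler_wpM2l//; apply: le_trans p1 _; by rewrite ler1n.
have z'h ib : `|z' ib| <= h.
  rewrite -(@ler_pXn2r _ 2) ?nnegrE ?(ltW h0)// real_normK ?num_real// h2.
  by apply: le_trans (z'b ib) _; rewrite lef_pV2 ?posrE.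
have yE k : (U *m z) k 0 = \sum_ib U' k ib * z' ib.
  rewrite mxE -rep; apply: eq_bigr => ib _.
  by rewrite /U' /z' mulf_div -expr2 sn2.
have := avg_posterior (ltW p0) mu0 U'mu h0 (ltW t0) avgx yE z'h z'1.
pose Y k := (U *m z) k 0 ^+ 2; rewrite -/(Y _).
set SD := \sum_(k | k != l) (U *m z) k 0 ^+ 2.
set SV := \sum_(k | k != l) \sum_i _.
set SW := \sum_(k | k != l) (w (edge_of k l))%:R * _.
set c5 := 16 * (48 * expR 8) + 2.
move=> H.
have SV0 : SV <= mu.
  apply: (@le_trans _ _ (\sum_(k | k != l) mu / n%:R)).
    apply: ler_sum => k _.
    apply: (@le_trans _ _ (\sum_ib U' k ib ^+ 2 * n%:R^-1)).
      by apply: ler_sum => ib _; rewrite ler_wpM2l ?sqr_ge0.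
    by rewrite -mulr_suml ler_wpM2r ?invr_ge0.
  apply: (@le_trans _ _ (\sum_(k < n) mu / n%:R)).
    rewrite [leRHS](bigD1 l) //= lerDr divr_ge0//.
  by rewrite sumr_const card_ord -[leLHS]mulr_natr divfK// gt_eqF.
(* The diagonal is never sampled; its term is at most mu. *)
have allS : \sum_k (U *m z) k 0 ^+ 2 <= SD + mu.
  rewrite (bigD1 l) //= addrC lerD2l yE.
  apply: le_trans (sum_cauchy_sqr _ _) _.
  by rewrite -[leRHS]mulr1 ler_pM ?sum_sqr_ge0.
have SWE : \sum_k ((k != l) && w (edge_of k l))%:R * (U *m z) k 0 ^+ 2 = SW.
  rewrite /SW [RHS]big_mkcond /=; apply: eq_bigr => k _.
  by case: eqVneq => _ /=; rewrite ?mul0r.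
rewrite SWE.
have Dn : #|(fun k => k != l)|%:R <= n%:R :> R.
  by rewrite ler_nat -[X in (_ <= X)%N](card_ord n) max_card.
have c50 : 0 <= c5 by rewrite /c5; have e8 : 0 <= expR (8 : R) := expR_ge0 _; lra.
have h4 : h ^+ 4 * (n%:R * p) = 1.
  by rewrite -np2 (exprM h 2 2) h2 -exprMn mulVf ?expr1n// gt_eqF.
have t1 : t * (32 * 48 * mu) = 1 by rewrite /t mulVf// gt_eqF.
have noise : p * (h ^+ 4 * mu ^+ 2) * #|(fun k => k != l)|%:R <= mu ^+ 2.
  have -> : p * (h ^+ 4 * mu ^+ 2) * #|(fun k => k != l)|%:R
     = (p * h ^+ 4 * mu ^+ 2) * #|(fun k => k != l)|%:R by ring.
  apply: (@le_trans _ _ ((p * h ^+ 4 * mu ^+ 2) * n%:R)).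
    by rewrite ler_wpM2l// !mulr_ge0 ?sqr_ge0 ?exprn_ge0 ?ltW.
  have -> : (p * h ^+ 4 * mu ^+ 2) * n%:R = (h ^+ 4 * (n%:R * p)) * mu ^+ 2 by ring.
  by rewrite h4 mul1r.
have hinv : h ^- 2 = np by rewrite h2 invrK.
rewrite hinv in H.
set d := #|_|%:R in H noise.
have H1 := ler_wpM2l (ltW tm) H.
have E1 : 32 * 48 * mu * (t * SW) = SW by rewrite mulrA [_ * t]mulrC t1 mul1r.
have E2 : 32 * 48 * mu * (t * p * SD - t * p * SV
      - 2 * p * t ^+ 2 * (16 * mu * SD + c5 * (h ^+ 4 * mu ^+ 2) * d) - np - x)
    = p * SD - p * SV - p * SD / 48 - (2 * t) * (c5 * (p * (h ^+ 4 * mu ^+ 2) * d))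
      - 32 * 48 * mu * (np + x).
  by rewrite /t; field; rewrite gt_eqF.
rewrite E1 E2 in H1.
have tmu : 2 * t * mu <= 1 by move: t1 (ltW t0) (ltW mu0); nra.
have n1 : (2 * t) * (c5 * (p * (h ^+ 4 * mu ^+ 2) * d)) <= c5 * mu.
  apply: (@le_trans _ _ ((2 * t) * (c5 * mu ^+ 2))).
    by rewrite ler_wpM2l ?mulr_ge0 ?(ltW t0)// ler_wpM2l.
  have -> : (2 * t) * (c5 * mu ^+ 2) = c5 * mu * (2 * t * mu) by ring.
  by rewrite -[leRHS]mulr1 ler_wpM2l// mulr_ge0.
have n2 : p * SV <= mu.
  apply: le_trans (ler_wpM2l (ltW p0) SV0) _.
  by rewrite -[leRHS]mul1r ler_wpM2r.
have n3 : p * (47 / 48) * \sum_k (U *m z) k 0 ^+ 2 <= p * (47 / 48) * (SD + mu).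
  by rewrite ler_wpM2l// mulr_ge0 ?(ltW p0)//; lra.
have n4 : p * mu <= mu by rewrite -[leRHS]mul1r ler_wpM2r.
have -> : mu * gap_const = 2 * mu + c5 * mu + 32 * 48 * mu * (np + x).
  by rewrite /gap_const -/np -/c5; ring.
move: H1 n1 n2 n3 n4 (mulr_ge0 (ltW p0) muge0).
by move: (2 * t * _) (p * SV) => a1 a2; lra.
Qed.

End ColumnGap.

(** * From the sample to the product space *)

Section Transfer.
Context {R : realType} (d : measure_display) (T : measurableType d)
  (P : probability T R).
Variables (n : nat) (p : R) (Omega : T -> {set 'I_n * 'I_n}).
Hypothesis BerO : offdiag_symmetric_Ber P p Omega.

Let upper : {set 'I_n * 'I_n} := [set e : 'I_n * 'I_n | (e.1 < e.2)%N]%SET.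
Let entry (e : 'I_n * 'I_n) : set T := [set t | e \in Omega t].

(** The product space has a coordinate for every pair, the sample only for pairs above the diagonal;
    the others are set to false to compare the two. *)
Definition upper_res (w : {ffun 'I_n * 'I_n -> bool}) : {ffun 'I_n * 'I_n -> bool} :=
  [ffun e : 'I_n * 'I_n => (e.1 < e.2)%N && w e].

Definition sample_fun (t : T) : {ffun 'I_n * 'I_n -> bool} :=
  [ffun e : 'I_n * 'I_n => (e.1 < e.2)%N && (e \in Omega t)].

Lemma sample_fun_mem t i j :
  ((i, j) \in Omega t) = (i != j) && sample_fun t (edge_of i j).
Proof.
case: BerO => diag _ _ sym; rewrite /edge_of; case: ltngtP => ij.
- by rewrite ffunE /= ij -val_eqE /= ltn_eqF.
- by rewrite ffunE /= ij sym// -val_eqE /= gtn_eqF.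
- by have /val_inj -> := ij; rewrite eqxx (negbTE (diag _ _)).
Qed.

Let cylinder (J : {set 'I_n * 'I_n}) (K : seq ('I_n * 'I_n)) : set T :=
  [set t | (forall e, e \in J -> e \in Omega t) /\ (forall e, e \in K -> e \notin Omega t)].

(** The model gives product formulas only for intersections of the events themselves; complements
    are added one at a time by subtraction, moving the new coordinate into J. *)
Lemma cylinder_prob (J : {set 'I_n * 'I_n}) (K : seq ('I_n * 'I_n)) :
  J \subset upper -> {subset K <= upper} -> uniq K -> (forall e, e \in K -> e \notin J) ->
  measurable (cylinder J K)
  /\ P (cylinder J K) = (p ^+ #|J| * (1 - p) ^+ size K)%:E.
Proof.
case: BerO => _ [meas indep] pe _.
elim: K J => [|k K IH] J JU KU uK KJ.
  have -> : cylinder J [::] = \bigcap_(e in [set` J]) entry e.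
    by apply/seteqP; split=> t /= => [[Jt _]|Jt] //; split.
  have Je e : e \in J -> e \in upper by apply: (fintype.subsetP JU).
  split.
    apply: fin_bigcap_measurable => [|e eJ]; first exact: finite_finpred.
    exact/meas/Je.
  rewrite indep// mulr1 (eq_bigr (fun=> p%:E)) => [|e eJ]; last by rewrite pe// Je.
  by rewrite prodEFin prodr_const.
have kU : k \in upper by apply: KU; rewrite inE eqxx.
have kJ : k \notin J by apply: KJ; rewrite inE eqxx.
move: uK => /= /andP[kK uK].
have KU' : {subset K <= upper} by move=> e eK; apply: KU; rewrite inE eK orbT.
have KJ0 e : e \in K -> e \notin J by move=> eK; apply: KJ; rewrite inE eK orbT.
have [m1 P1] := IH J JU KU' uK KJ0.
have JU' : (k |: J)%SET \subset upper.
  by apply/fintype.subsetP => e; rewrite !inE => /orP[/eqP ->|/(fintype.subsetP JU)];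
    [have := kU; rewrite inE | rewrite inE].
have KJ' e : e \in K -> e \notin (k |: J)%SET.
  move=> eK; rewrite !inE negb_or (KJ0 e eK) andbT.
  by apply: contraNneq kK => <-.
have [m2 P2] := IH _ JU' KU' uK KJ'.
have E : cylinder J (k :: K) = cylinder J K `\` cylinder (k |: J)%SET K.
  apply/seteqP; split=> t /=.
    move=> [Jt Kt]; split; first by split=> // e eK; apply: Kt; rewrite inE eK orbT.
    move=> [kt _]; have := Kt k; rewrite inE eqxx => /(_ isT)/negP; apply.
    by apply: kt; rewrite !inE eqxx.
  move=> [[Jt Kt] nt]; split=> // e; rewrite inE => /orP[/eqP ->|]; last exact: Kt.
  apply/negP => kt; apply: nt; split=> // f.
  by rewrite !inE => /orP[/eqP ->|]; [exact: kt | exact: Jt].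
have I' : cylinder J K `&` cylinder (k |: J)%SET K = cylinder (k |: J)%SET K.
  apply/seteqP; split=> t /= [] // Jt Kt; split; last by split.
  by split=> // e eJ; apply: Jt; rewrite !inE eJ orbT.
split; first by rewrite E; exact: measurableD.
have PD : P (cylinder J K `\` cylinder (k |: J)%SET K)
    = (P (cylinder J K) - P (cylinder J K `&` cylinder (k |: J)%SET K))%E.
  by apply: measureD => //; rewrite -ge0_fin_numE ?fin_num_measure.
rewrite E PD I'.
rewrite P1 P2 -EFinB; congr EFin; rewrite cardsU1 kJ /= add1n !exprS; ring.
Qed.

Definition upper_weight (v : {ffun 'I_n * 'I_n -> bool}) : R :=
  \prod_(e : 'I_n * 'I_n | (e.1 < e.2)%N) bern_weight p (v e).

Lemma sample_atom_prob v : upper_res v = v ->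
  measurable [set t | sample_fun t = v]
  /\ P [set t | sample_fun t = v] = (upper_weight v)%:E.
Proof.
move=> vres.
pose J := [set e in upper | v e]%SET.
pose K := enum [set e in upper | ~~ v e]%SET.
have E : [set t | sample_fun t = v] = cylinder J K.
  apply/seteqP; split=> t /=.
    move=> sv; have ve e : v e = (e.1 < e.2)%N && (e \in Omega t) by rewrite -sv ffunE.
    by split=> e; rewrite ?mem_enum !inE ve; case: (e.1 < e.2)%N.
  move=> [Jt Kt]; apply/ffunP => e; rewrite ffunE -[in RHS]vres ffunE.
  case ue: (e.1 < e.2)%N => //=; case ve: (v e).
    by apply: Jt; rewrite !inE ue.
  by apply/negbTE; apply: Kt; rewrite mem_enum !inE ue ve.
have [||||m Pc] := @cylinder_prob J K.
- by apply/fintype.subsetP => e; rewrite inE => /andP[].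
- by move=> e; rewrite mem_enum inE => /andP[].
- exact: enum_uniq.
- by move=> e; rewrite mem_enum !inE => /andP[_ /negbTE ->]; rewrite andbF.
rewrite E; split=> //; rewrite Pc; congr EFin.
rewrite /upper_weight (bigID v) /=; congr (_ * _).
  rewrite (eq_bigr (fun=> p)) => [|e /andP[_ ->]//]; rewrite prodr_const.
  by congr (_ ^+ _); apply: eq_card => e; rewrite !inE.
rewrite (eq_bigr (fun=> 1 - p)) => [|e /andP[_ /negbTE ->]//]; rewrite prodr_const.
by rewrite /K -cardE; congr (_ ^+ _); apply: eq_card => e; rewrite !inE.
Qed.

Lemma sample_seq_prob (s : seq {ffun 'I_n * 'I_n -> bool}) :
  uniq s -> (forall v, v \in s -> upper_res v = v) ->
  measurable [set t | sample_fun t \in s]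
  /\ P [set t | sample_fun t \in s] = (\sum_(v <- s) upper_weight v)%:E.
Proof.
elim: s => [|v s IH] /=.
  move=> _ _; have -> : [set t | sample_fun t \in [::]] = set0 by apply/seteqP; split.
  by rewrite big_nil measure0.
move=> /andP[vs us] sres.
have [m1 P1] := sample_atom_prob (sres v (mem_head _ _)).
have sres' w : w \in s -> upper_res w = w by move=> ws; apply: sres; rewrite inE ws orbT.
have [m2 P2] := IH us sres'.
have E : [set t | sample_fun t \in v :: s]
    = [set t | sample_fun t = v] `|` [set t | sample_fun t \in s].
  apply/seteqP; split=> t /=; rewrite inE; first by move=> /orP[/eqP|]; [left|right].
  by move=> [->|->]; rewrite ?eqxx ?orbT.
rewrite E; split; first exact: measurableU.
have PU : P ([set t | sample_fun t = v] `|` [set t | sample_fun t \in s])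
    = (P [set t | sample_fun t = v] + P [set t | sample_fun t \in s])%E.
  apply: measureU => //; apply/seteqP; split=> t //= [tv ts].
  by rewrite -tv ts in vs.
by rewrite PU P1 P2 big_cons EFinD.
Qed.

Lemma upper_marginal (v : {ffun 'I_n * 'I_n -> bool}) : upper_res v = v ->
  \sum_(w | upper_res w == v) \prod_e bern_weight p (w e) = upper_weight v.
Proof.
move=> vres.
pose Q (e : 'I_n * 'I_n) : pred bool := fun b => (e.1 < e.2)%N ==> (b == v e).
transitivity (\sum_(w in family Q) \prod_e bern_weight p (w e)).
  apply: eq_bigl => w; apply/eqP/familyP => [wv e|Qw].
    by rewrite unfold_in /Q -wv ffunE; case: (e.1 < e.2)%N => //=.
  apply/ffunP => e; rewrite -vres !ffunE; have := Qw e; rewrite unfold_in /Q.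
  by case: (e.1 < e.2)%N => //= /eqP.
rewrite -(bigA_distr_big_dep Q (fun _ b => bern_weight p b)) /upper_weight [RHS]big_mkcond /=.
apply: eq_bigr => e _; rewrite /Q; case: (e.1 < e.2)%N => /=.
  by rewrite big_pred1_eq.
by rewrite big_bool /=; lra.
Qed.

(** Measurability is proved along with the probability, since the model provides it only for single
    entries; the event is a finite union of atoms. *)
Lemma sample_prob (G : pred {ffun 'I_n * 'I_n -> bool}) :
  measurable [set t | G (sample_fun t)]
  /\ P [set t | G (sample_fun t)] = (bern_prob p [pred w | G (upper_res w)])%:E.
Proof.
have res_idem w : upper_res (upper_res w) = upper_res w.
  by apply/ffunP => e; rewrite !ffunE andbA andbb.
have sample_res t : upper_res (sample_fun t) = sample_fun t.
  by apply/ffunP => e; rewrite !ffunE andbA andbb.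
pose s := enum [pred v | (upper_res v == v) && G v].
have [||m Ps] := @sample_seq_prob s; first exact: enum_uniq.
  by move=> v; rewrite mem_enum inE => /andP[/eqP].
have E : [set t | sample_fun t \in s] = [set t | G (sample_fun t)].
  by apply/seteqP; split=> t /=; rewrite mem_enum inE sample_res eqxx.
rewrite E in m Ps; split=> //; rewrite Ps; congr EFin.
rewrite /s big_enum (eq_bigl (fun v => (upper_res v == v) && G v))// big_mkcondr /=.
rewrite /bern_prob /bern_exp [RHS](partition_big upper_res
  (fun v => upper_res v == v)) /=; last by move=> w _; rewrite res_idem.
apply: eq_bigr => v /eqP vres.
rewrite -(upper_marginal vres); case: ifPn => Gv.
  by apply: eq_bigr => w /eqP wv; rewrite wv Gv mulr1.
by rewrite big1// => w /eqP wv; rewrite wv (negbTE Gv) mulr0.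
Qed.

Lemma edge_of_res w (i j : 'I_n) : i != j ->
  upper_res w (edge_of i j) = w (edge_of i j).
Proof.
rewrite -val_eqE /= /edge_of ffunE => ij; case: (ltngtP i j) ij => //= h _;
  by rewrite h.
Qed.

Lemma rand_mx_res (a : 'M[R]_n) w : rand_mx p a (upper_res w) = rand_mx p a w.
Proof.
by apply/matrixP => i j; rewrite !mxE; case: eqVneq => // ij; rewrite edge_of_res.
Qed.

End Transfer.

(** * Samples with all three properties *)

Section GoodSamples.
Context {R : realType}.
Implicit Types (n r : nat) (p : R).

Lemma linf_norm_entry n (A : 'M[R]_n) i j : `|A i j| <= linf_norm A.
Proof.
rewrite linf_normE.
exact: (le_bigmax _ (fun ij : 'I_n * 'I_n => `|A ij.1 ij.2|) (i, j)).
Qed.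

Lemma linf_norm_ge0 n (A : 'M[R]_n) : 0 <= linf_norm A.
Proof. exact: normr_ge0. Qed.

Lemma linf_norm_const1 n : linf_norm (const_mx 1 : 'M[R]_n) <= 1.
Proof.
by rewrite linf_normE; apply: bigmax_le => // ij _; rewrite mxE normr1.
Qed.

Lemma spec_norm_scale_le n (A : 'M[R]_n) c : (0 < n)%N -> 0 <= c ->
  spectral_norm (c *: A) <= c * spectral_norm A.
Proof.
move=> n0 c0; apply: spec_norm_le => // x x1.
rewrite -scalemxAl frobZ ger0_norm// ler_wpM2l//.
by apply: le_trans (spec_normP _ _) _; rewrite x1 mulr1.
Qed.

Lemma mask_proj_const1 n (S : {set 'I_n * 'I_n}) :
  mask_proj S (const_mx 1) = mask_mx S :> 'M[R]_n.
Proof. by apply/matrixP => i j; rewrite !mxE; case: ifP. Qed.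

(** [rand_mx] has zero diagonal while the centred projection has - p A_ii there; this diagonal part
    costs p |A|. *)
Lemma mask_proj_noise n p (A : 'M[R]_n) (S : {set 'I_n * 'I_n})
    (w : {ffun 'I_n * 'I_n -> bool}) : (0 < n)%N -> 0 <= p ->
  (forall i j, ((i, j) \in S) = (i != j) && w (edge_of i j)) ->
  spectral_norm (mask_proj S A - p *: A)
  <= spectral_norm (rand_mx p A w) + p * linf_norm A.
Proof.
move=> n0 p0 Sw; pose D := diag_mx (\row_i A i i).
have -> : mask_proj S A - p *: A = rand_mx p A w - p *: D.
  apply/matrixP => i j; rewrite !mxE Sw.
  case: eqVneq => [->|ij] /=; first by rewrite mulr1n.
  by rewrite mulr0n mulr0 subr0; case: (w _); rewrite /=; ring.
have Dx (x : 'cV[R]_n) : frobenius_norm (D *m x) <= linf_norm A * frobenius_norm x.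
  rewrite -(@ler_pXn2r _ 2) ?nnegrE ?mulr_ge0 ?frob_ge0 ?linf_norm_ge0//.
  rewrite exprMn !frob_sqr !mxdot_sqr mulr_sumr; apply: ler_sum => i _.
  rewrite mulr_sumr; apply: ler_sum => j _.
  rewrite mul_diag_mx !mxE exprMn ler_wpM2r ?sqr_ge0// -[leLHS]real_normK ?num_real//.
  by rewrite ler_pXn2r ?nnegrE ?linf_norm_ge0// linf_norm_entry.
apply: spec_norm_le => // x x1; rewrite mulmxBl.
apply: le_trans (frobD _ _) _; rewrite frobN lerD//.
  by apply: le_trans (spec_normP _ _) _; rewrite x1 mulr1.
rewrite -scalemxAl frobZ ger0_norm// ler_wpM2l//.
by apply: le_trans (Dx _) _; rewrite x1 mulr1.
Qed.

Lemma rand_mxZ n p c (A : 'M[R]_n) w : rand_mx p (c *: A) w = c *: rand_mx p A w.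
Proof.
by apply/matrixP => i j; rewrite !mxE; case: ifP => _; rewrite ?mulr0// mulrA.
Qed.

Lemma linf_normK n (A : 'M[R]_n) : linf_norm A *: ((linf_norm A)^-1 *: A) = A.
Proof.
have [A0|An0] := eqVneq (linf_norm A) 0; last by rewrite scalerA divff// scale1r.
rewrite A0 scale0r; apply/matrixP => i j; rewrite mxE.
by apply/esym/eqP; rewrite -normr_eq0 eq_le normr_ge0 andbT -[leRHS]A0 linf_norm_entry.
Qed.

Lemma normalized_entry n (A : 'M[R]_n) i j : `|((linf_norm A)^-1 *: A) i j| <= 1.
Proof.
have [A0|An0] := eqVneq (linf_norm A) 0.
  by rewrite A0 invr0 scale0r mxE normr0 ler01.
have A0 : 0 < linf_norm A by rewrite lt_neqAle eq_sym An0 linf_norm_ge0.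
rewrite mxE normrM ger0_norm ?invr_ge0 ?linf_norm_ge0// mulrC ler_pdivrMr// mul1r.
exact: linf_norm_entry.
Qed.

(** N is divided by its max norm to have entries at most 1 as in [rand_mx_tail]; for N = 0 the
    quotient is 0. *)
Definition good_sample n r p (mu x b : R) (U : 'M[R]_(n, r)) (N : 'M[R]_n) w : Prop :=
  [/\ spectral_norm (rand_mx p (const_mx 1) w) <= b,
      spectral_norm (rand_mx p ((linf_norm N)^-1 *: N) w) <= b &
      forall l, column_gap p mu x U l w].

Lemma good_sample_prob n r m p mu x (U : 'M[R]_(n, r)) (N : 'M[R]_n) :
  (0 < n)%N -> 0 < p -> p <= 1 -> 1 <= n%:R * p -> N^T = N ->
  (forall k, \sum_a U k a ^+ 2 <= mu) ->
  n%:R * (p * (1 - p)) <= (2 ^ m.+1)%:R ->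
  1 - (2 * (n%:R * expR (- (2 * (2 ^ m.+1)%:R))) + n%:R * expR (- x))
  <= bern_prob p [pred w | `[< good_sample p mu x
        (expR 108 * Num.sqrt (2 ^ m.+1)%:R) U N w >]].
Proof.
move=> n0 p0 p1 np1 Nsym rowU nL; set b := _ * Num.sqrt _.
pose G := [pred w | `[< good_sample p mu x b U N w >]].
pose B1 := [pred w | b < spectral_norm (rand_mx p (const_mx 1 : 'M[R]_n) w)].
pose B2 := [pred w | b < spectral_norm (rand_mx p ((linf_norm N)^-1 *: N) w)].
pose B3 l := [pred w | ~~ `[< column_gap p mu x U l w >]].
have bernD f g : bern_exp p (fun w : {ffun 'I_n * 'I_n -> bool} => f w + g w)
    = bern_exp p f + bern_exp p g.
  by rewrite /bern_exp -big_split; apply: eq_bigr => w _; rewrite /= mulrDr.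
have cover : 1 <= bern_prob p G + (bern_prob p B1 + bern_prob p B2
    + \sum_l bern_prob p (B3 l)).
  rewrite -[leLHS](@bern_exp_cst R ('I_n * 'I_n)%type p).
  rewrite /bern_prob -bern_exp_sum -!bernD; apply: bern_exp_le => // [|w]; first exact: ltW.
  have B30 : 0 <= \sum_l (B3 l w)%:R :> R by apply: sumr_ge0 => l _; exact: ler0n.
  have [Gw|nG] := boolP (G w).
    by rewrite lerDl !addr_ge0 ?ler0n.
  rewrite add0r.
  have [b1|nb1] := boolP (B1 w); first by rewrite -addrA lerDl addr_ge0 ?ler0n.
  have [b2|nb2] := boolP (B2 w); first by rewrite add0r lerDl.
  have [l nl] : exists l, B3 l w.
    apply: contrapT => nB; move: nG; rewrite /G /= => /asboolP; apply; split.
    - by move: nb1; rewrite /= -leNgt.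
    - by move: nb2; rewrite /= -leNgt.
    move=> l; apply: contrapT => ng; apply: nB; exists l.
    by apply/negP => /asboolP.
  rewrite !add0r (bigD1 l)// nl lerDl.
  by apply: sumr_ge0 => k _; exact: ler0n.
have P1 : bern_prob p B1 <= n%:R * expR (- (2 * (2 ^ m.+1)%:R)).
  apply: rand_mx_tail => //; first exact: ltW.
  - by rewrite trmx_const.
  - by move=> i j; rewrite mxE normr1.
have P2 : bern_prob p B2 <= n%:R * expR (- (2 * (2 ^ m.+1)%:R)).
  apply: rand_mx_tail => //; first exact: ltW.
  - by rewrite linearZ /= Nsym.
  - exact: normalized_entry.
have P3 : \sum_l bern_prob p (B3 l) <= n%:R * expR (- x).
  apply: (@le_trans _ _ (\sum_(l < n) expR (- x))).
    by apply: ler_sum => l _; exact: column_gap_tail.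
  by rewrite sumr_const card_ord mulr_natl.
move: cover P1 P2 P3; rewrite -/G; lra.
Qed.

(** Supplies the power of two required as exponent by the trace method. *)
Lemma dyadic_above (s : R) : 1 <= s -> exists m, s <= (2 ^ m.+1)%:R <= 2 * s.
Proof.
move=> s1; have s0 : 0 <= s by lra.
have k1 : (0 < Num.truncn s)%N by rewrite truncn_gt0.
exists (trunc_log 2 (Num.truncn s)); apply/andP; split.
  apply: ltW; apply: lt_le_trans (truncnS_gt s) _.
  by rewrite ler_nat; exact: trunc_log_ltn.
rewrite expnS natrM ler_wpM2l//.
apply: (@le_trans _ _ (Num.truncn s)%:R); last by rewrite truncn_le.
by rewrite ler_nat; exact: trunc_logP.
Qed.

(** Lets additive constants be absorbed into multiples of log n. *)
Lemma ln_nat_ge_half n : (1 < n)%N -> 2^-1 <= ln n%:R :> R.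
Proof.
move=> n1; have := mul_sub1_expR (2^-1 : R) => H.
have e2 : expR (2^-1) <= 2 :> R by lra.
rewrite -[leLHS]expRK ler_ln ?posrE ?expR_gt0 ?ltr0n//; last by lia.
by apply: le_trans e2 _; rewrite ler_nat.
Qed.

Lemma expR_ln_nat n (k : nat) : (0 < n)%N ->
  expR (- (k%:R * ln n%:R)) = (n%:R ^+ k)^-1 :> R.
Proof.
move=> n0; rewrite expRN mulr_natl -lnXn ?ltr0n// lnK// posrE exprn_gt0// ltr0n//.
Qed.

End GoodSamples.

(** * Constants *)

Section Assembly.
Context {R : realType}.

(** From sqrt L <= 3 sqrt q and 1 <= 2 sqrt q in [noise_scale], the second paying for the
    diagonal. *)
Definition noise_const : R := 3 * expR 108 + 2.

Definition kappa_const : R := 2 + (16 * (48 * expR 8) + 2) + 32 * 48 * 4.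

(* 130 * 100 comes from regularizer_taylor, and 200^3 from
   lambda * alpha^2 <= 200 noise * (200^2 |Mr|). *)
Definition ridge_const : R := 130 * 100 * (200 * (200 * 200)).

Definition level_const : R :=
  6 * kappa_const + (12 + ridge_const) * (2 * noise_const).

(** Dominates both coefficients 16 and 96 of [deterministic_bound]. *)
Definition tail_const : R := 16 * level_const + 96.

Definition error_const : R := 10 / 256 + 872 * noise_const ^+ 2.

Lemma noise_const_ge0 : 0 <= noise_const.
Proof. by rewrite addr_ge0// mulr_ge0// expR_ge0. Qed.

Lemma ridge_const_ge0 : 0 <= ridge_const.
Proof.
have c (k m : nat) : 0 <= k%:R * m%:R :> R by rewrite mulr_ge0.
exact: mulr_ge0 (c _ _) (mulr_ge0 (ler0n _ _) (c _ _)).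
Qed.

Lemma kappa_const_ge0 : 0 <= kappa_const.
Proof. by rewrite !addr_ge0// !mulr_ge0// expR_ge0. Qed.

Lemma level_const_ge0 : 0 <= level_const.
Proof.
rewrite addr_ge0 ?mulr_ge0 ?kappa_const_ge0 ?noise_const_ge0//.
by rewrite addr_ge0 ?ridge_const_ge0.
Qed.

Lemma error_const_ge :
  [/\ 10 / 256 <= error_const, 872 * noise_const ^+ 2 <= error_const &
      0 <= error_const].
Proof.
have := sqr_ge0 noise_const; rewrite /error_const.
by move: (noise_const ^+ 2) => c c0; split; lra.
Qed.

Lemma noise_scale (L q : R) : 2^-1 <= q -> L <= 6 * q ->
  expR 108 * Num.sqrt L + 1 <= noise_const * Num.sqrt q.
Proof.
move=> q0 Lq.
have sq0 := sqrtr_ge0 q; have q1 : 0 <= q by lra.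
have h1 : Num.sqrt L <= 3 * Num.sqrt q.
  have h : 0 <= 3 * Num.sqrt q by lra.
  rewrite -(ger0_norm h) -sqrtr_sqr ler_wsqrtr// exprMn sqr_sqrtr//; lra.
have h2 : 1 <= 2 * Num.sqrt q.
  have h : 0 <= 2 * Num.sqrt q by lra.
  rewrite -[leLHS]sqrtr1 -(ger0_norm h) -sqrtr_sqr ler_wsqrtr// exprMn sqr_sqrtr//; lra.
have e0 : 0 <= expR 108 :> R := expR_ge0 _.
rewrite /noise_const; move: e0; set e := expR 108 => e0.
by have := ler_wpM2l e0 h1; lra.
Qed.

(** For l >= 1/2 the square root of l is below 2 l; this is how sqrt(log n) becomes the log n of the
    bound. *)
Lemma variance_scale (a q l : R) : 0 <= a -> 2^-1 <= l -> q <= a + l ->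
  Num.sqrt q <= Num.sqrt a + 2 * l.
Proof.
move=> a0 l0 qal; have sa := sqrtr_ge0 a.
have h : 0 <= Num.sqrt a + 2 * l by lra.
rewrite -(ger0_norm h) -sqrtr_sqr ler_sqrt ?sqr_ge0//.
have := sqr_sqrtr a0.
nra.
Qed.

Lemma gap_const_scale n (p l : R) : 1 <= n%:R * p -> 0 <= l ->
  gap_const n p (4 * l) <= kappa_const * (Num.sqrt (n%:R * p) + l).
Proof.
move=> np1 l0; rewrite /gap_const /kappa_const.
have w1 : 1 <= Num.sqrt (n%:R * p).
  by rewrite -[leLHS]sqrtr1 ler_sqrt//; lra.
have e0 : 0 <= expR 8 :> R := expR_ge0 _.
set s := Num.sqrt _ in w1 *; set e := expR 8 in e0 *.
have : e <= e * (s + l) by rewrite ler_peMr//; lra.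
lra.
Qed.

Lemma sample_density_div n (p : R) : 0 < p ->
  Num.sqrt (n%:R * p) / p = Num.sqrt (n%:R / p).
Proof.
move=> p0; have -> : n%:R / p = n%:R * p * p^-1 ^+ 2 by field; rewrite gt_eqF.
by rewrite [RHS]sqrtrM ?mulr_ge0 ?(ltW p0)// sqrtr_sqr ger0_norm// invr_ge0 ltW.
Qed.

Lemma tail_const_ge : 16 * level_const <= tail_const /\ 96 <= tail_const.
Proof.
by have := level_const_ge0; rewrite /tail_const; move: level_const => c c0; split; lra.
Qed.

End Assembly.

(** * The bound on a good sample *)

Section Final.
Context {R : realType}.

Lemma eigenvalue_ge0 n (M : 'M[R]_n) sigma (u : nat -> 'cV[R]_n) i :
  spectral_decomposition M sigma u -> (0 < i)%N -> 0 <= sigma i.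
Proof.
case=> _ spos sz _ _ i0; have [h|h] := leqP i n; first by apply: spos; rewrite i0.
by rewrite sz.
Qed.

Lemma good_sample_error n r m (p : R) (M : 'M[R]_n) sigma (u : nat -> 'cV[R]_n)
    (S : {set 'I_n * 'I_n}) (w : {ffun 'I_n * 'I_n -> bool}) al la (X : 'M[R]_(n, r)) :
  let Mr := spectral_truncation sigma u r in
  let N := M - Mr in
  let nu := spectral_norm (mask_mx S - p *: const_mx 1) in
  (1 < n)%N -> (r <= n)%N -> spectral_decomposition M sigma u ->
  0 < p -> p <= 1 -> 1 <= n%:R * p ->
  (2 ^ m.+1)%:R <= 2 * (n%:R * (p * (1 - p)) + 3 * ln n%:R) ->
  (forall i j, ((i, j) \in S) = (i != j) && w (edge_of i j)) ->
  good_sample p (linf_norm Mr) (4 * ln n%:R) (expR 108 * Num.sqrt (2 ^ m.+1)%:R)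
    (spectral_factor r sigma u) N w ->
  100 * Num.sqrt (linf_norm Mr) <= al <= 200 * Num.sqrt (linf_norm Mr) ->
  100 * nu <= la <= 200 * nu ->
  local_minimum (completion_objective S M al la) X ->
  mxdot (X *m X^T - Mr) (X *m X^T - Mr)
  <= error_const * (\sum_(1 <= i < r.+1)
         pos_part (tail_const * (Num.sqrt (n%:R / p) + ln n%:R / p) * linf_norm Mr
                   + tail_const * sigma (2 * r + 1 - i)%N - sigma i) ^+ 2)
     + error_const * ((p * (1 - p) * n%:R + ln n%:R) * r%:R * linf_norm N ^+ 2 / p ^+ 2).
Proof.
move=> Mr N nu n1 rn Mdec p0 p1 np1 Lle Sw [g1 g2 g3] alP laP Xmin.
have n0 : (0 < n)%N by exact: ltnW.
have p0' := ltW p0.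
pose l : R := ln n%:R; have l1 : 2^-1 <= l by exact: ln_nat_ge_half.
pose q := p * (1 - p) * n%:R + l.
have pq0 : 0 <= p * (1 - p) * n%:R by rewrite !mulr_ge0// subr_ge0.
have q1 : 2^-1 <= q by rewrite /q; lra.
set b := expR 108 * _ in g1 g2.
have bq : b + 1 <= noise_const * Num.sqrt q.
  by apply: noise_scale => //; apply: le_trans Lle _; rewrite /q -/l; move: l1 pq0; lra.
pose mu := linf_norm Mr; have mu0 : 0 <= mu := linf_norm_ge0 _.
have nuE : nu <= noise_const * Num.sqrt q.
  rewrite /nu -mask_proj_const1.
  apply: le_trans (mask_proj_noise _ n0 p0' Sw) _; apply: le_trans bq.
  rewrite lerD// -[leRHS]mulr1 ler_pM// ?linf_norm_ge0//.
  exact: linf_norm_const1.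
have c6 : 0 <= noise_const * Num.sqrt q :> R.
  by rewrite mulr_ge0 ?noise_const_ge0 ?sqrtr_ge0.
pose Dn := linf_norm N * (noise_const * Num.sqrt q).
have DnP : spectral_norm (mask_proj S N - p *: N) <= Dn.
  apply: le_trans (mask_proj_noise _ n0 p0' Sw) _.
  apply: (@le_trans _ _ (linf_norm N * b + 1 * linf_norm N)).
    rewrite lerD ?ler_wpM2r ?linf_norm_ge0// -{1}(linf_normK N) rand_mxZ.
    apply: le_trans (spec_norm_scale_le _ n0 (linf_norm_ge0 _)) _.
    by rewrite ler_wpM2l ?linf_norm_ge0.
  by rewrite mul1r -[X in _ + X]mulr1 -mulrDr ler_wpM2l ?linf_norm_ge0.
pose kap := mu * gap_const n p (4 * l).
have kap0 : 0 <= kap by rewrite mulr_ge0// gap_const_ge0//; move: l1; lra.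
have gap : alignment_gap S p kap (spectral_factor r sigma u).
  move=> k z; apply: le_trans (g3 k z) _; rewrite lerD2r; apply: ler_sum => j _.
  by rewrite [mask_mx _ _ _]mxE Sw.
have Ssym i j : ((i, j) \in S) = ((j, i) \in S) by rewrite !Sw eq_sym edge_ofC.
have := deterministic_bound rn Mdec Ssym p0 kap0 (lexx _) gap DnP alP laP Xmin.
rewrite -/Mr -/nu -/N -/mu => main; apply: le_trans main _.
pose W := Num.sqrt (n%:R * p) + l.
have W0 : 0 <= W by rewrite addr_ge0 ?sqrtr_ge0//; move: l1; lra.
pose K := 6 * kap + (12 + ridge_const) * (nu * mu).
have KW : K / p <= level_const * (Num.sqrt (n%:R / p) + l / p) * mu.
  have -> : Num.sqrt (n%:R / p) + l / p = W / p.
    by rewrite mulrDl sample_density_div.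
  rewrite mulrA -[leRHS]mulrAC ler_wpM2r ?invr_ge0//.
  have k1 : kap <= kappa_const * W * mu.
    rewrite /kap mulrC ler_wpM2r//; apply: gap_const_scale => //; move: l1; lra.
  have q2 : Num.sqrt q <= 2 * W.
    apply: (@le_trans _ _ (Num.sqrt (n%:R * p) + 2 * l)); last first.
      by have := sqrtr_ge0 (n%:R * p); rewrite /W; lra.
    apply: variance_scale => //; first by rewrite mulr_ge0.
    by rewrite /q lerD2r [n%:R * p]mulrC ler_wpM2r// ler_piMr//; lra.
  have n2 : nu * mu <= 2 * noise_const * W * mu.
    rewrite ler_wpM2r//; apply: le_trans nuE _.
    have := ler_wpM2l noise_const_ge0 q2; rewrite -/q.
    by rewrite mulrCA mulrA.
  rewrite /K; have r0 : 0 <= 12 + ridge_const :> R by rewrite addr_ge0 ?ridge_const_ge0.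
  have n3 := ler_wpM2l r0 n2.
  apply: le_trans (lerD (ler_wpM2l _ k1) n3) _ => //.
  by rewrite /level_const le_eqVlt; apply/orP; left; apply/eqP; ring.
have [e1 e2 e3] := @error_const_ge R.
apply: lerD.
  apply: ler_pM; [exact: divr_ge0 (ler0n _ _) (ler0n _ _)| |exact: e1|].
    by apply: sumr_ge0 => i _; exact: sqr_ge0.
  rewrite !big_nat; apply: ler_sum => i /andP[i1 ir].
  rewrite ler_pXn2r ?nnegrE ?pos_part_ge0//; apply: pos_part_le.
  have s0 : 0 <= sigma (2 * r + 1 - i)%N.
    by apply: (eigenvalue_ge0 Mdec); move: ir; clear; lia.
  have [t16 t96] := @tail_const_ge R.
  have ts : 96 * sigma (2 * r + 1 - i)%N <= tail_const * sigma (2 * r + 1 - i)%N.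
    exact: ler_wpM2r.
  have tw : 16 * (K / p) <= tail_const * (Num.sqrt (n%:R / p) + l / p) * mu.
    apply: le_trans (ler_wpM2l _ KW) _ => //.
    rewrite 2!mulrA; apply: ler_wpM2r => //; apply: ler_wpM2r t16.
    by rewrite addr_ge0 ?sqrtr_ge0// divr_ge0//; move: l1; lra.
  by rewrite lerD2r; exact: lerD tw ts.
have q0 : 0 <= q by lra.
have -> : Dn ^+ 2 * r%:R / p ^+ 2
    = noise_const ^+ 2 * (q * r%:R * linf_norm N ^+ 2 / p ^+ 2).
  by rewrite /Dn !exprMn sqr_sqrtr//; ring.
rewrite mulrA; apply: ler_wpM2r e2.
exact: divr_ge0 (mulr_ge0 (mulr_ge0 q0 (ler0n _ _)) (sqr_ge0 _)) (sqr_ge0 _).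
Qed.

End Final.

(** Goodness reads only coordinates above the diagonal, so its probability is the same for the
    sample and on the whole product space. *)
Lemma good_sample_res (R : realType) n r (p mu x b : R) (U : 'M[R]_(n, r))
    (N : 'M[R]_n) w :
  good_sample p mu x b U N (upper_res w) <-> good_sample p mu x b U N w.
Proof.
have gapE l : column_gap p mu x U l (upper_res w) <-> column_gap p mu x U l w.
  suff E (z : 'cV[R]_r) :
      \sum_k ((k != l) && upper_res w (edge_of k l))%:R * (U *m z) k 0 ^+ 2
      = \sum_k ((k != l) && w (edge_of k l))%:R * (U *m z) k 0 ^+ 2.
    by split=> H z; have := H z; rewrite E.
  by apply: eq_bigr => k _; case: eqVneq => // kl; rewrite edge_of_res.
rewrite /good_sample !rand_mx_res.
by split=> -[g1 g2 g3]; split=> // l; apply/gapE.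
Qed.

Theorem theorem2p1 (R : realType) :
  exists C1 C2 C3 : R, [/\ 0 < C1, 0 < C2 & 0 < C3] /\
  forall (n r : nat) (M : 'M[R]_n) (sigma : nat -> R) (u : nat -> 'cV[R]_n)
    (p : R) (d : measure_display) (T : measurableType d)
    (P : probability T R) (Omega : T -> {set 'I_n * 'I_n}),
  (1 <= r)%N -> (r <= n)%N ->
  psd M ->
  spectral_decomposition M sigma u ->
  0 < p -> p <= 1 ->
  C1 * (ln n%:R / n%:R) <= p ->
  offdiag_symmetric_Ber P p Omega ->
  let Mr := spectral_truncation sigma u r in
  let N := M - Mr in
  let J : 'M[R]_n := const_mx 1 in
  let noise (t : T) := spectral_norm (mask_mx (Omega t) - p *: J) in
  let bound :=
    C2 * (\sum_(1 <= i < r.+1)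
            pos_part (C3 * (Num.sqrt (n%:R / p) + ln n%:R / p) * linf_norm Mr
                      + C3 * sigma (2 * r + 1 - i)%N - sigma i) ^+ 2)
    + C2 * ((p * (1 - p) * n%:R + ln n%:R) * r%:R * linf_norm N ^+ 2
            / p ^+ 2) in
  exists E : set T,
    [/\ measurable E,
        ((1 - 2 * (n%:R ^+ 3)^-1)%:E <= P E)%E &
        forall t, E t ->
        forall alpha lambda : R,
          100 * Num.sqrt (linf_norm Mr) <= alpha <= 200 * Num.sqrt (linf_norm Mr) ->
          100 * noise t <= lambda <= 200 * noise t ->
        forall X : 'M[R]_(n, r),
          local_minimum (completion_objective (Omega t) M alpha lambda) X ->
          frobenius_norm (X *m X^T - Mr) ^+ 2 <= bound /\
          frobenius_norm (X *m X^T - M) ^+ 2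
            <= bound + frobenius_norm N ^+ 2].
Proof.
(* C1 = 2 gives n p >= 2 log n >= 1 for n >= 2. *)
exists 2, (error_const : R), (tail_const : R); split.
  split=> //.
    by rewrite /error_const; have := sqr_ge0 (noise_const : R); lra.
  by rewrite /tail_const; have : 0 <= level_const :> R := level_const_ge0; lra.
move=> n r M sigma u p d T P Omega r1 rn Mpsd Mdec p0 p1 pn BerO Mr N J noise bound.
have [n1|n1] := leqP n 1.
  (* For n = 1 the required probability is 1 - 2 < 0. *)
  exists set0; split=> //; have -> : n = 1%N by lia.
  by rewrite expr1n invr1 measure0 lee_fin; lra.
have n0 : (0 < n)%N by exact: ltnW.
have nR : 0 < n%:R :> R by rewrite ltr0n.
pose l : R := ln n%:R; have l1 : 2^-1 <= l by exact: ln_nat_ge_half.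
have np2 : 2 * l <= n%:R * p.
  by move: pn; rewrite mulrA ler_pdivrMr// mulrC [p * _]mulrC -/l.
have np1 : 1 <= n%:R * p by move: l1 np2; lra.
have v0 : 0 <= n%:R * (p * (1 - p)) by rewrite !mulr_ge0 ?subr_ge0// ltW.
(* The 3 log n makes exp(-2 L) <= n^-6 for L = 2^(m+1). *)
have [|m /andP[mL Lm]] := @dyadic_above R (n%:R * (p * (1 - p)) + 3 * l).
  by move: l1 v0; lra.
pose U : 'M[R]_(n, r) := spectral_factor r sigma u.
pose b : R := expR 108 * Num.sqrt (2 ^ m.+1)%:R.
pose G := [pred w | `[< good_sample p (linf_norm Mr) (4 * l) b U N w >]].
pose s (t : T) := sample_fun Omega t.
have [mE PE] := sample_prob BerO G.
exists [set t | G (s t)]; split=> //.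
  have -> : P [set t | G (s t)] = (bern_prob p G)%:E.
    rewrite PE; congr EFin; rewrite /bern_prob; apply: eq_bigr => w _.
    by congr (_ * (nat_of_bool _)%:R); apply: asbool_equiv_eq; exact: good_sample_res.
  rewrite lee_fin; have nL : n%:R * (p * (1 - p)) <= (2 ^ m.+1)%:R.
    by apply: le_trans mL; rewrite lerDl; move: l1; lra.
  have Nsym : N^T = N := residual_sym rn Mdec.
  apply: le_trans (good_sample_prob (4 * l) n0 p0 p1 np1 Nsym (factor_row_le r Mdec) nL).
  rewrite lerD2l lerN2.
  (* The two norm bounds fail with probability at most 2 n^-5 <= n^-3, and the n columns, with x = 4
     log n, with at most n n^-4. *)
  have e1 : expR (- (2 * (2 ^ m.+1)%:R)) <= (n%:R ^+ 6)^-1 :> R.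
    rewrite -expR_ln_nat// ler_expR lerN2; move: mL v0; rewrite -/l; lra.
  rewrite expR_ln_nat//.
  have e2 : n%:R * expR (- (2 * (2 ^ m.+1)%:R)) <= n%:R * (n%:R ^+ 6)^-1 :> R.
    by rewrite ler_wpM2l// ltW.
  have -> : n%:R * (n%:R ^+ 4)^-1 = (n%:R ^+ 3)^-1 :> R by field; rewrite gt_eqF.
  have e3 : n%:R * (n%:R ^+ 6)^-1 <= (2 * n%:R ^+ 3)^-1 :> R.
    have -> : n%:R * (n%:R ^+ 6)^-1 = (n%:R ^+ 2 * n%:R ^+ 3)^-1 :> R.
      by field; rewrite gt_eqF.
    rewrite lef_pV2 ?posrE ?mulr_gt0 ?exprn_gt0// ler_wpM2r ?exprn_ge0 ?(ltW nR)//.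
    by rewrite -natrX ler_nat (@leq_trans (2 ^ 2))// leq_exp2r.
  move: e2 e3; rewrite invfM; lra.
move=> t /= /asboolP Gt al la alP laP X Xmin.
have Sw i j : ((i, j) \in Omega t) = (i != j) && s t (edge_of i j).
  exact: (sample_fun_mem BerO).
have E := good_sample_error n1 rn Mdec p0 p1 np1 Lm Sw Gt alP laP Xmin.
rewrite !frob_sqr; split; first exact: E.
by apply: le_trans (residual_pythagoras X rn Mdec) _; rewrite lerD2r; exact: E.
Qed.
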